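(* Let $B$ be a unital algebra, let $(\mathcal{A},E,\varepsilon)$ be a $B$-$B$-non-commutative probability space, let $D\subseteq B$ be a unital subalgebra with $1_B\in D$, and let $F:B\to D$ be a conditional expectation (a linear map with $F(d)=d$ and $F(d_1bd_2)=d_1F(b)d_2$ for all $d,d_1,d_2\in D$, $b\in B$). Let $I,J$ be disjoint index sets, $\{Z_i\}_{i\in I}\subseteq\mathcal{A}_\ell$, $\{Z_j\}_{j\in J}\subseteq\mathcal{A}_r$, and $Z=\{Z_i\}_{i\in I}\sqcup\{Z_j\}_{j\in J}$. Assume that $F$ satisfies the following faithfulness condition: if $b_1\in B$ and $F(b_2b_1)=0$ for all $b_2\in B$, then $b_1=0$. Then $(\mathrm{alg}(\varepsilon(D\otimes 1_D),\{Z_i\}_{i\in I}),\ \mathrm{alg}(\varepsilon(1_D\otimes D^{\mathrm{op}}),\{Z_j\}_{j\in J}))$ is bi-free from $(\varepsilon(B\otimes 1_B),\varepsilon(1_B\otimes B^{\mathrm{op}}))$ with amalgamation over $D$ (in the $D$-$D$-non-commutative probability space $(\mathcal{A},F\circ E,\varepsilon|_{D\otimes D^{\mathrm{op}}})$) if and only if $$\kappa^B_{Z,\omega}(b_1,\ldots,b_{n-1})=F\big(\kappa^B_{Z,\omega}(F(b_1),\ldots,F(b_{n-1}))\big)\qquad( * )$$ for all $n\ge1$, $\omega:\{1,\ldots,n\}\to I\sqcup J$ and $b_1,\ldots,b_{n-1}\in B$. Moreover, $( * )$ (for all such $n,\omega,b_k$) is equivalent to $$\kappa^B_{Z,\omega}(b_1,\ldots,b_{n-1})=\kappa^D_{Z,\omega}(F(b_1),\ldots,F(b_{n-1}))$$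 for all $n\ge1$, $\omega:\{1,\ldots,n\}\to I\sqcup J$ and $b_1,\ldots,b_{n-1}\in B$.
   Context: All algebras are unital over $\mathbb{C}$. A $B$-$B$-non-commutative probability space is a triple $(\mathcal{A},E,\varepsilon)$ where $\mathcal{A}$ is a unital algebra, $\varepsilon:B\otimes B^{\mathrm{op}}\to\mathcal{A}$ is a unital homomorphism injective on $B\otimes 1_B$ and on $1_B\otimes B^{\mathrm{op}}$, and $E:\mathcal{A}\to B$ is linear with $E(1_{\mathcal A})=1_B$, $E(\varepsilon(b_1\otimes b_2)Z)=b_1E(Z)b_2$ and $E(Z\varepsilon(b\otimes1_B))=E(Z\varepsilon(1_B\otimes b))$ for all $b,b_1,b_2\in B$, $Z\in\mathcal{A}$. Write $L_b=\varepsilon(b\otimes1_B)$, $R_b=\varepsilon(1_B\otimes b)$ (so $L_{bb'}=L_bL_{b'}$, $R_{bb'}=R_{b'}R_b$), $\mathcal{A}_\ell=\{Z: ZR_b=R_bZ\ \forall b\in B\}$, $\mathcal{A}_r=\{Z: ZL_b=L_bZ\ \forall b\in B\}$. Bi-non-crossing partitions. For $\chi:\{1,\ldots,n\}\to\{\ell,r\}$ with $\chi^{-1}(\ell)=\{k_1<\cdots<k_p\}$, $\chi^{-1}(r)=\{k_{p+1}>\cdots>k_n\}$, put $s_\chi(q)=k_q$ and let $a\prec_\chi a'$ iff $s_\chi^{-1}(a)<s_\chi^{-1}(a')$. $BNC(\chi)$ is the set of partitions of $\{1,\ldots,n\}$ that are non-crossing for the total order $\prec_\chi$, ordered by refinement;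 $1_\chi$ is the one-block partition and $\mu_{BNC}$ is the Möbius function of this lattice. A $\chi$-interval is an interval for $\prec_\chi$. Moments and cumulants. For $Z_k\in\mathcal{A}_{\chi(k)}$ and $\pi\in BNC(\chi)$, $E^B_\pi(Z_1,\ldots,Z_n)\in B$ is defined recursively (independently of choices): $E^B_{1_\chi}(Z_1,\ldots,Z_n)=E(Z_1\cdots Z_n)$; if $V$ is a proper non-empty $\chi$-interval that is a union of blocks of $\pi$, $W$ is its complement, and $\beta=E^B_{\pi|_V}((Z_k)_{k\in V})$, then $E^B_\pi=\beta\,E^B_{\pi|_W}((Z_k)_{k\in W})$ if $V$ is initial for $\prec_\chi$, $E^B_\pi=E^B_{\pi|_W}((Z_k)_{k\in W})\,\beta$ if $V$ is terminal, and otherwise $E^B_\pi=E^B_{\pi|_W}((Z'_k)_{k\in W})$, where $Z'_k=Z_k$ except that for the immediate $\prec_\chi$-predecessor $p$ of $V$, $Z'_p=Z_pL_\beta$ if $\chi(p)=\ell$ and $Z_p'=R_\beta Z_p$ if $\chi(p)=r$. (Tuples keep their natural order.) The cumulants are $\kappa^B_\pi=\sum_{\sigma\in BNC(\chi),\,\sigma\le\pi}E^B_\sigma\,\mu_{BNC}(\sigma,\pi)$ and $\kappa^B_\chi:=\kappa^B_{1_\chi}$. Bi-freeness. A pair of $B$-faces is a pair $(A_\ell,A_r)$ of unital subalgebras with $\varepsilon(B\otimes1_B)\subseteq A_\ell\subseteq\mathcal{A}_\ell$, $\varepsilon(1_B\otimes B^{\mathrm{op}})\subseteq A_r\subseteq\mathcal{A}_r$.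 A family $\{(A_{k,\ell},A_{k,r})\}_{k\in K}$ of pairs of $B$-faces is bi-free with amalgamation over $B$ iff $\kappa^B_\chi(Z_1,\ldots,Z_n)=0$ for all $n$, $\chi$, all non-constant $\epsilon:\{1,\ldots,n\}\to K$ and all $Z_k\in A_{\epsilon(k),\chi(k)}$. $D$-valued notions: $(\mathcal{A},F\circ E,\varepsilon|_{D\otimes D^{\mathrm{op}}})$ is a $D$-$D$-non-commutative probability space, with left and right algebras $\mathcal{A}^D_\ell=\{Z: ZR_d=R_dZ\ \forall d\in D\}$ and $\mathcal{A}^D_r=\{Z: ZL_d=L_dZ\ \forall d\in D\}$. For $Z_k\in\mathcal{A}^D_{\chi(k)}$ and $\pi\in BNC(\chi)$, $E^D_\pi(Z_1,\ldots,Z_n)\in D$ is defined recursively (independently of choices): $E^D_{1_\chi}(Z_1,\ldots,Z_n)=F(E(Z_1\cdots Z_n))$; if $V$ is a proper non-empty $\chi$-interval that is a union of blocks of $\pi$, $W$ is its complement, and $\beta=E^D_{\pi|_V}((Z_k)_{k\in V})\in D$, then $E^D_\pi=\beta\,E^D_{\pi|_W}((Z_k)_{k\in W})$ if $V$ is initial for $\prec_\chi$, $E^D_\pi=E^D_{\pi|_W}((Z_k)_{k\in W})\,\beta$ if $V$ is terminal, and otherwise $E^D_\pi=E^D_{\pi|_W}((Z'_k)_{k\in W})$, where $Z'_k=Z_k$ except that for the immediate $\prec_\chi$-predecessor $p$ of $V$, $Z'_p=Z_pL_\beta$ if $\chi(p)=\ell$ and $Z'_p=R_\beta Z_p$ if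 $\chi(p)=r$. The $D$-valued cumulants are $\kappa^D_\pi=\sum_{\sigma\in BNC(\chi),\,\sigma\le\pi}E^D_\sigma\,\mu_{BNC}(\sigma,\pi)$ and $\kappa^D_\chi:=\kappa^D_{1_\chi}$. A pair of $D$-faces is a pair $(A_\ell,A_r)$ of unital subalgebras with $\varepsilon(D\otimes1_D)\subseteq A_\ell\subseteq\mathcal{A}^D_\ell$, $\varepsilon(1_D\otimes D^{\mathrm{op}})\subseteq A_r\subseteq\mathcal{A}^D_r$. A family $\{(A_{k,\ell},A_{k,r})\}_{k\in K}$ of pairs of $D$-faces is bi-free with amalgamation over $D$ iff $\kappa^D_\chi(Z_1,\ldots,Z_n)=0$ for all $n$, $\chi$, all non-constant $\epsilon:\{1,\ldots,n\}\to K$ and all $Z_k\in A_{\epsilon(k),\chi(k)}$. Notation $\kappa^B_{Z,\omega}$ (and likewise $\kappa^D_{Z,\omega}$ with $b_k\in D$). For $\omega:\{1,\ldots,n\}\to I\sqcup J$ let $\chi_\omega(k)=\ell$ if $\omega(k)\in I$ and $r$ if $\omega(k)\in J$; let $C^{(k)}_b=L_b$ if $\omega(k)\in I$, $C^{(k)}_b=R_b$ if $\omega(k)\in J$. If $\omega$ takes values only in $I$ or only in $J$, $\kappa^B_{Z,\omega}(b_1,\ldots,b_{n-1})=\kappa^B_{\chi_\omega}(Z_{\omega(1)},C^{(2)}_{b_1}Z_{\omega(2)},\ldots,C^{(n)}_{b_{n-1}}Z_{\omega(n)})$. Otherwise let $k_0>1$ be the first index with $\chi_\omega(k_0)\ne\chi_\omega(1)$;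 then $\kappa^B_{Z,\omega}(b_1,\ldots,b_{n-1})=\kappa^B_{\chi_\omega}(W_1,\ldots,W_{n-1},W_nC^{(n)}_{b_{n-1}})$ with $W_1=Z_{\omega(1)}$, $W_k=C^{(k)}_{b_{k-1}}Z_{\omega(k)}$ for $1<k<k_0$, $W_{k_0}=Z_{\omega(k_0)}$, $W_k=C^{(k)}_{b_{k-2}}Z_{\omega(k)}$ for $k_0<k\le n$. *)

(* Defs.v *)
From HB Require Import structures.
From mathcomp Require Import all_boot all_order all_algebra.
From mathcomp Require Import boolp classical_sets.

Set Implicit Arguments.
Unset Strict Implicit.
Unset Printing Implicit Defensive.

Import GRing.Theory.

Local Open Scope classical_set_scope.
Local Open Scope ring_scope.

(* A side is a boolean: [true] stands for "left", [false] for "right". *)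

Section BiNonCrossing.

Context (n : nat) (chi : 'I_n -> bool).
Implicit Types (a b c d p q : 'I_n) (S V W X Y : {set 'I_n}).
Implicit Types (sigma pi : {set {set 'I_n}}).

(* The sequence s_chi(1), ..., s_chi(n). *)
Definition chi_seq : seq 'I_n :=
  [seq k <- enum 'I_n | chi k] ++ rev [seq k <- enum 'I_n | ~~ chi k].

Definition chi_lt a b : bool := (index a chi_seq < index b chi_seq)%N.

Definition noncrossing pi : bool :=
  [forall X in pi, forall Y in pi, (X != Y) ==>
    ~~ [exists a in X, exists b in Y, exists c in X, exists d in Y,
          [&& chi_lt a b, chi_lt b c & chi_lt c d]]].

Definition BNC : {set {set {set 'I_n}}} :=
  [set pi | finset.partition pi [set: 'I_n] & noncrossing pi].

(* Intervals, initial and terminal parts are relative to the restriction of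
   the order to a set [S] of indices that are still present. *)
Definition chi_interval S V : bool :=
  (V \subset S) &&
  [forall a in V, forall b in S, forall c in V,
     chi_lt a b && chi_lt b c ==> (b \in V)].

Definition chi_initial S V : bool :=
  [forall a in V, forall b in S :\: V, chi_lt a b].

Definition chi_terminal S V : bool :=
  [forall a in V, forall b in S :\: V, chi_lt b a].

(* [p] is the last element of [S :\: V] that precedes all of [V]. *)
Definition chi_pred S V p : bool :=
  let before q := [forall a in V, chi_lt q a] in
  [&& p \in S :\: V, before p &
      [forall q in S :\: V, before q ==> ~~ chi_lt p q]].

Definition restr pi V : {set {set 'I_n}} := [set X in pi | X \subset V].

(* [V] is a proper non-empty chi-interval of [S] that is a union of blocks. *)
Definition splits S pi V : bool :=
  [&& V != finset.set0, V \proper S, chi_interval S V & finset.cover (restr pi V) == V].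

End BiNonCrossing.

Definition refines (T : finType) (sigma pi : {set {set T}}) : bool :=
  [forall X in sigma, exists Y in pi, X \subset Y].

(* Moebius function of the sub-poset [P]: mu(x,x) = 1,
   mu(x,y) = - sum_(x <= z < y) mu(x,z), and 0 unless x <= y. The first argument
   of [mobius_rec] only bounds the recursion depth, which cannot exceed the
   length of a chain. *)

Section Mobius.

Context (T : finType) (le : rel T) (P : {set T}).

Fixpoint mobius_rec (m : nat) (x y : T) : int :=
  if m is m'.+1 then
    if x == y then 1
    else if le x y then
      - \sum_(z in P | [&& le x z, le z y & z != y]) mobius_rec m' x z
    else 0
  else 0.

Definition mobius : T -> T -> int := mobius_rec #|T|.

End Mobius.

Definition subalgebra (K : pzRingType) (A : algType K) (S : set A) : Prop :=
  GRing.subalg_closed (mem S).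

Definition gen_alg (K : pzRingType) (A : algType K) (X : set A) : set A :=
  smallest (@subalgebra K A) X.

(* A unital homomorphism eps out of B (x) B^op amounts to a unital homomorphism
   L and a unital anti-homomorphism R from B with commuting ranges, through
   eps(b1 (x) b2) = L b1 * R b2. *)

Record bb_space (K : fieldType) (B A : algType K) := BBSpace {
  Lb : {lrmorphism B -> A};
  Rb : {linear B -> A};
  expect : {linear A -> B};
  Rb1 : Rb 1 = 1;
  RbM : forall b b', Rb (b * b') = Rb b' * Rb b;
  LbRbC : forall b b', Lb b * Rb b' = Rb b' * Lb b;
  Lb_inj : injective Lb;
  Rb_inj : injective Rb;
  expect1 : expect 1 = 1;
  expect_bimod : forall b1 b2 Z, expect (Lb b1 * Rb b2 * Z) = b1 * expect Z * b2;
  expect_LR : forall b Z, expect (Z * Lb b) = expect (Z * Rb b)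
}.

(* For a subalgebra [D] of [B], [F] seen as a map B -> B with range in [D]. *)
Definition cond_expectation (K : pzRingType) (B : algType K) (D : set B)
    (F : {linear B -> B}) : Prop :=
  [/\ forall b, D (F b),
      forall d, D d -> F d = d
    & forall d1 b d2, D d1 -> D d2 -> F (d1 * b * d2) = d1 * F b * d2].

(* The notions below are relative to a subalgebra [D] of [B] and a map
   [Ex : A -> B] with range in [D]: the B-valued ones are obtained for
   [D = setT] and [Ex = expect Sp], the D-valued ones for [Ex = F \o expect Sp]. *)

Section Cumulants.

Context (K : fieldType) (B A : algType K) (Sp : bb_space B A).

Local Notation L := (Lb Sp).
Local Notation R := (Rb Sp).

Definition left_alg (D : set B) : set A :=
  [set Z | forall d, D d -> Z * R d = R d * Z].

Definition right_alg (D : set B) : set A :=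
  [set Z | forall d, D d -> Z * L d = L d * Z].

Section Moments.

Context (Ex : A -> B) (n : nat) (chi : 'I_n -> bool).
Implicit Types (S V W : {set 'I_n}) (sigma pi : {set {set 'I_n}}).
Implicit Types (Z : 'I_n -> A).

(* The tuple Z' obtained by inserting [beta] at the predecessor of [V]. *)
Definition insert_at S V (beta : B) Z : 'I_n -> A := fun k =>
  if chi_pred chi S V k then
    if chi k then Z k * L beta else R beta * Z k
  else Z k.

(* Moment of the subtuple (Z k)_(k in S) along the partition [pi] of [S]. The
   product over [k in S] is taken in the natural order of 'I_n. The result does
   not depend on which splitting interval is picked when [Z k] lies in the left
   or right algebra according to [chi k]; a splitting interval exists when [pi]
   is non-crossing and has several blocks. Both sets of indices occurring in the
   recursive calls are smaller than [S], so that depth [n] suffices. *)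
Fixpoint moment_rec (m : nat) S pi Z : B :=
  if m is m'.+1 then
    if pi == [set S]%SET then Ex (\prod_(k in S) Z k)
    else if [pick V | splits chi S pi V] is Some V then
      let W := S :\: V in
      let beta := moment_rec m' V (restr pi V) Z in
      if chi_initial chi S V then
        beta * moment_rec m' W (restr pi W) Z
      else if chi_terminal chi S V then
        moment_rec m' W (restr pi W) Z * beta
      else moment_rec m' W (restr pi W) (insert_at S V beta Z)
    else 0
  else 0.

Definition moment pi Z : B := moment_rec n [set: 'I_n]%SET pi Z.

Definition cumulant_part pi Z : B :=
  \sum_(sigma in BNC chi | refines sigma pi)
     moment sigma Z *~ mobius (@refines 'I_n) (BNC chi) sigma pi.

Definition cumulant Z : B := cumulant_part [set [set: 'I_n]]%SET Z.

End Moments.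

(* The pair (A_l, A_r) is encoded as a map from sides. *)
Definition pair_of_faces (D : set B) (X : bool -> set A) : Prop :=
  [/\ subalgebra (X true), subalgebra (X false),
      L @` D `<=` X true /\ X true `<=` left_alg D
    & R @` D `<=` X false /\ X false `<=` right_alg D].

Definition bifree (D : set B) (Ex : A -> B) (I : Type)
    (X : I -> bool -> set A) : Prop :=
  (forall i, pair_of_faces D (X i)) /\
  forall (n : nat) (chi : 'I_n -> bool) (eps : 'I_n -> I) (Z : 'I_n -> A),
    (exists i j, eps i <> eps j) ->
    (forall k, X (eps k) (chi k) (Z k)) ->
    cumulant Ex chi Z = 0.

Section Families.

Context (I J : Type) (ZI : I -> A) (ZJ : J -> A).

Definition var (x : I + J) : A :=
  match x with inl i => ZI i | inr j => ZJ j end.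

Definition side (x : I + J) : bool :=
  match x with inl _ => true | inr _ => false end.

Context (n : nat) (omega : 'I_n.+1 -> I + J).

Definition chi_of (k : 'I_n.+1) : bool := side (omega k).

Definition Cb (k : 'I_n.+1) (b : B) : A := if chi_of k then L b else R b.

Definition first_change : option 'I_n.+1 :=
  [pick k | (chi_of k != chi_of ord0) &&
            [forall j : 'I_n.+1, (j < k)%N ==> (chi_of j == chi_of ord0)]].

(* The arguments of kappa_{Z,omega}(b_1, ..., b_n), for n+1 variables. Indices
   start at 0 here: position [k] is position k+1 on paper, and [b`_k] is
   the coefficient b_{k+1}. There is no first change exactly when the variables
   are all left or all right. *)
Definition kappa_args (b : n.-tuple B) (k : 'I_n.+1) : A :=
  let z := var (omega k) in
  if first_change is Some k0 then
    let w := if k == ord0 then z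
             else if (k < k0)%N then Cb k b`_k.-1 * z
             else if k == k0 then z
             else Cb k b`_k.-2 * z in
    if k == ord_max then w * Cb k b`_n.-1 else w
  else if k == ord0 then z else Cb k b`_k.-1 * z.

Definition kappa (Ex : A -> B) (b : n.-tuple B) : B :=
  cumulant Ex chi_of (kappa_args b).

End Families.

End Cumulants.

(* Main.v *)
(* The moments of words b1 x1 b2 x2 ... read in the order of chi determine the
   cumulants and conversely, by summing over the block of the first letter. Hence
   kappa^B and kappa^D are the cumulants of two functionals on words with
   coefficients: the expectation E, and F o E on words with coefficients in D. A
   letter that is a scalar of B is absorbed by the next coefficient.

   The main tool is a centring lemma for cumulants that do not mix two colours and
   that, on the first colour, take values in D and vanish as soon as a coefficient
   is killed by F: alternating products of monochromatic words, each centred by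
   F o E, have F o E-moment zero. On words with coefficients in D this vanishing
   determines all moments from the monochromatic ones.

   Condition ( * ) says that the cumulants of Z have these properties, while scalars
   of B, the second colour, have cumulants of a single letter. So the centred
   moments of generators vanish, those of the generated algebras vanish by
   multilinearity, and therefore the F o E-moments agree with those of a free
   family, whose mixed D-cumulants are zero.

   Conversely, if Z and B are bi-free over D, then the F o E-moments of words in
   variables and scalars agree with the F-moments computed from the cumulants
   kappa^D o F. As scalars realize arbitrary coefficients, the faithfulness of F
   upgrades this to an equality of B-valued moments, so kappa^B = kappa^D o F.
   Finally, under ( * ) the E-moments of words with coefficients in D lie in D, so
   that both kinds of cumulants coincide on such words. *)
Require Import Defs.
From HB Require Import structures.
From mathcomp Require Import all_boot all_order all_algebra zify.
From mathcomp Require boolp.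

Set Implicit Arguments.
Unset Strict Implicit.
Unset Printing Implicit Defensive.

Import GRing.Theory.
Local Open Scope ring_scope.

(** * Moments and cumulants of words *)

(** Bi-freeness is carried to the generated algebras through centred moments because cumulants with
    products as entries would need a partition formula of their own, whereas a centred moment is
    additive in every letter, and a letter may be replaced by several letters standing at its place.
    This is why letters carry times that may repeat instead of positions in the product. The two
    sides meet only when a scalar moves inside the natural-order product: the equality of E(Z L_b)
    and E(Z R_b) carries it from the end of the left letters to the first right letter of the
    chi-order. After that every argument concerns one-sided words, with a kernel in the role of the
    cumulants. Moments over B and over D are treated together through a map G that is bimodular over
    a subring D0: the identity with D0 everything, or F with D0 = D. Predicates such as [ok] are
    needed because scalars can be moved through the product only for words in the chi-order whose
    elements commute with the scalars of the other side. *)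

Section Words.

Context (B : pzRingType) (T : eqType).
Implicit Types (w u v acc : seq (B * T)) (x y : T) (b c d : B).
Implicit Types (q : T -> seq (B * T) -> B) (N g : seq (B * T) -> B).

(* A word lists pairs (coefficient, letter), each coefficient standing before its
   letter. [openb q N x acc g w] sums over the ways to complete the block opened
   by [x] and joined so far by [acc] while reading [w]: [q] evaluates the block,
   [N] the gaps between its letters, and [g h] is the moment of the gap being read
   once [h] has been appended to it. *)
Fixpoint openb q N x acc g w : B :=
  if w is (b, y) :: w' then
    openb q N x (rcons acc (g [::] * b, y)) N w' +
    openb q N x acc (fun h => g ((b, y) :: h)) w'
  else q x acc * g [::].

(** The moment-cumulant recursion on the block of the first letter: partitions being non-crossing,
    this block cuts the rest into gaps that no other block straddles. [ok] limits the recursion to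
    the words under comparison. *)
Definition is_mom (ok : seq T -> Prop) q N : Prop :=
  N [::] = 1 /\
  forall b x w, ok (x :: unzip2 w) -> N ((b, x) :: w) = b * openb q N x [::] N w.

Definition hereditary (ok : seq T -> Prop) : Prop :=
  forall s s', subseq s' s -> ok s -> ok s'.

Fixpoint coefs_in (D : B -> Prop) w : Prop :=
  if w is (b, _) :: w' then D b /\ coefs_in D w' else True.

Lemma coefs_in_cat D u v : coefs_in D (u ++ v) <-> coefs_in D u /\ coefs_in D v.
Proof. by elim: u => [|[b x] u IH] /=; tauto. Qed.

Lemma coefs_inT w : coefs_in (fun=> True) w.
Proof. by elim: w => [|[b x] w IH]. Qed.

Definition submonoid (D : B -> Prop) : Prop :=
  D 1 /\ forall b c, D b -> D c -> D (b * c).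

Lemma submonoidT : submonoid (fun=> True).
Proof. by []. Qed.

(** The coefficients fed to [q] are gap moments times coefficients of the word. Gap functionals with
    values in [D] keep them in [D], so that the kernels need only agree there. *)
Lemma openb_ext D q q' N N' x acc g g' w :
  submonoid D ->
  (forall h, subseq (unzip2 h) (unzip2 w) -> coefs_in D h ->
     N h = N' h /\ D (N h)) ->
  (forall h, subseq (unzip2 h) (unzip2 w) -> coefs_in D h ->
     g h = g' h /\ D (g h)) ->
  (forall e, subseq (unzip2 e) (unzip2 w) -> coefs_in D e ->
     q x (acc ++ e) = q' x (acc ++ e)) ->
  coefs_in D w ->
  openb q N x acc g w = openb q' N' x acc g' w.
Proof.
move=> [D1 DM]; elim: w acc g g' => [|[b y] w IH] acc g g' HN Hg Hq /=.
  move=> _; have [] := Hg [::] isT I => -> _.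
  by have := Hq [::] isT I; rewrite cats0 => ->.
move=> [Db Dw]; have [e0 D0] : g [::] = g' [::] /\ D (g [::]) by apply: Hg.
have sub h : subseq h (unzip2 w) -> subseq h (y :: unzip2 w).
  by move=> /subseq_trans; apply; apply: subseq_cons.
congr (_ + _).
- rewrite -e0; apply: IH => // h hs hD.
  + by apply: HN => //; apply: sub.
  + by apply: HN => //; apply: sub.
  + rewrite -cats1 -catA /=; apply: Hq => /=; first by rewrite eqxx.
    by split=> //; apply: DM.
- apply: IH => // h hs hD.
  + by apply: HN => //; apply: sub.
  + by apply: Hg => //=; rewrite ?eqxx.
  + by apply: Hq => //; apply: sub.
Qed.

Lemma openb_eq q N x acc g g' w :
  (forall h, g h = g' h) -> openb q N x acc g w = openb q N x acc g' w.
Proof. by move=> gg; apply: (openb_ext submonoidT) => //; apply: coefs_inT. Qed.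

Lemma mom_uniq D ok q q' N N' : submonoid D -> hereditary ok ->
  is_mom ok q N -> is_mom ok q' N' ->
  (forall w, ok (unzip2 w) -> coefs_in D w -> D (N w)) ->
  (forall x e, ok (x :: unzip2 e) -> coefs_in D e -> q x e = q' x e) ->
  forall w, ok (unzip2 w) -> coefs_in D w -> N w = N' w.
Proof.
move=> DS okS [N0 NS] [N'0 N'S] ND qq w.
have [k] := ubnP (size w); elim: k w => // k IH [|[b x] w] /=; first by rewrite N0.
rewrite ltnS => lek okw [Db Dw]; rewrite NS // N'S //; congr (_ * _).
have sub h : subseq (unzip2 h) (unzip2 w) -> ok (unzip2 h).
  move=> hs; apply: okS okw; exact: subseq_trans hs (subseq_cons _ _).
have H h : subseq (unzip2 h) (unzip2 w) -> coefs_in D h -> N h = N' h /\ D (N h).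
  move=> hs hD; split; last by apply: ND => //; apply: sub.
  apply: IH => //; last exact: sub.
  by apply: leq_ltn_trans lek; have := size_subseq hs; rewrite !size_map.
apply: (openb_ext DS) => // e es eD; apply: qq => //=.
by apply: okS okw; rewrite /= eqxx.
Qed.

(** Only the term in which every letter joins the block has the full word as argument of the kernel,
    and its gaps are empty, hence contribute [N [::] = 1]. All other terms use shorter words, so the
    recursion can be inverted. *)
Lemma openb_top D q q' N N' x acc w :
  submonoid D -> N [::] = 1 ->
  (forall h, subseq (unzip2 h) (unzip2 w) -> coefs_in D h ->
     N h = N' h /\ D (N h)) ->
  (forall e, subseq (unzip2 e) (unzip2 w) -> coefs_in D e -> (size e < size w)%N ->
     q x (acc ++ e) = q' x (acc ++ e)) ->
  coefs_in D w ->
  openb q N x acc N w - q x (acc ++ w) = openb q' N' x acc N' w - q' x (acc ++ w).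
Proof.
move=> DS N1; elim: w acc => [|[b y] w IH] acc HN Hq /=.
  move=> _; have [-> _] := HN [::] isT I; rewrite cats0.
  have [] := HN [::] isT I; rewrite N1 => <- _.
  by rewrite !mulr1 !subrr.
move=> [Db Dw]; have [e0 D0] : N [::] = N' [::] /\ D (N [::]) by apply: HN.
have sub h : subseq h (unzip2 w) -> subseq h (y :: unzip2 w).
  by move=> /subseq_trans; apply; apply: subseq_cons.
rewrite -e0 N1 mul1r -cat_rcons addrAC [RHS]addrAC; congr (_ + _).
- apply: IH => // h hs hD => [|hlt]; first by apply: HN => //; apply: sub.
  by rewrite cat_rcons; apply: Hq => //=; rewrite eqxx.
- apply: (openb_ext DS) => // h hs hD.
  + by apply: HN => //; apply: sub.
  + by apply: HN => //=; rewrite ?eqxx.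
  + apply: Hq => //; first exact: sub.
    by have := size_subseq hs; rewrite !size_map.
Qed.

(** With leading coefficient 1, the recursion expresses the one-block term through moments and
    kernels of shorter words; induction on the length cancels the rest. *)
Lemma cum_uniq D ok q q' N N' : submonoid D -> hereditary ok ->
  is_mom ok q N -> is_mom ok q' N' ->
  (forall w, ok (unzip2 w) -> coefs_in D w -> N w = N' w /\ D (N w)) ->
  forall x w, ok (x :: unzip2 w) -> coefs_in D w -> q x w = q' x w.
Proof.
move=> DS okS [N0 NS] [N'0 N'S] NN x w.
have [k] := ubnP (size w); elim: k x w => // k IH x w.
rewrite ltnS => lek okw Dw.
have sub h : subseq (unzip2 h) (unzip2 w) -> ok (unzip2 h).
  move=> hs; apply: okS okw; exact: subseq_trans hs (subseq_cons _ _).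
have E : openb q N x [::] N w - q x ([::] ++ w) =
         openb q' N' x [::] N' w - q' x ([::] ++ w).
  apply: (openb_top DS) => // [h hs hD|e es eD elt].
    by apply: NN => //; apply: sub.
  apply: IH => //; first exact: leq_trans elt lek.
  by apply: okS okw; rewrite /= eqxx.
have [|e _] := NN ((1, x) :: w) okw; first by split=> //; case: DS.
by move: e; rewrite NS // N'S // !mul1r => e; move: E; rewrite e => /addrI/oppr_inj.
Qed.

(* [k] only bounds the recursion depth, here and in [cumn]. *)
Fixpoint momn q (k : nat) w : B :=
  if w is (b, x) :: w' then
    if k is k'.+1 then b * openb q (momn q k') x [::] (momn q k') w' else 0
  else 1.

Definition mom q w : B := momn q (size w) w.

Lemma momn_stable q k w : (size w <= k)%N -> momn q k w = mom q w.
Proof.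
rewrite /mom; have [m] := ubnP (size w); elim: m k w => // m IH [|k] [|[b x] w] //=.
rewrite !ltnS => lem lek; congr (_ * _); apply: (openb_ext submonoidT) => //;
  last exact: coefs_inT.
- move=> h /size_subseq; rewrite !size_map => hs _; split=> //.
  rewrite IH ?(leq_trans hs) //; last exact: leq_ltn_trans hs lem.
  by rewrite -(IH (size w)) //; apply: leq_ltn_trans hs lem.
- move=> h /size_subseq; rewrite !size_map => hs _; split=> //.
  rewrite IH ?(leq_trans hs) //; last exact: leq_ltn_trans hs lem.
  by rewrite -(IH (size w)) //; apply: leq_ltn_trans hs lem.
Qed.

Lemma mom_is_mom ok q : is_mom ok q (mom q).
Proof.
split=> // b x w _; rewrite {1}/mom /=; congr (_ * _).
by apply: (openb_ext submonoidT) => //; last (exact: coefs_inT);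
  move=> h /size_subseq; rewrite !size_map => hs _; rewrite momn_stable.
Qed.

(** When [w] has length [k'], the kernel [cumn N k'] vanishes on words as long as [w], so the sum
    that is subtracted lacks exactly its one-block term. *)
Fixpoint cumn N (k : nat) x w : B :=
  if k is k'.+1 then
    if (size w < k')%N then cumn N k' x w
    else if size w == k' then N ((1, x) :: w) - openb (cumn N k') N x [::] N w
    else 0
  else 0.

Definition cum N x w : B := cumn N (size w).+1 x w.

Lemma cumn_stable N k x w : (size w < k)%N -> cumn N k x w = cum N x w.
Proof.
elim: k => // k IH; rewrite ltnS leq_eqVlt => /orP[/eqP<-//|lt].
by rewrite [LHS]/= lt IH.
Qed.

Lemma cumn_big N k x w : (k <= size w)%N -> cumn N k x w = 0.
Proof. by case: k => //= k lek; rewrite ltnNge ltnW //= gtn_eqF. Qed.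

Lemma cum_is_mom ok N : N [::] = 1 ->
  (forall b x w, N ((b, x) :: w) = b * N ((1, x) :: w)) -> is_mom ok (cum N) N.
Proof.
move=> N1 NL; split=> // b x w _; rewrite NL; congr (_ * _).
have E : openb (cum N) N x [::] N w - cum N x ([::] ++ w) =
         openb (cumn N (size w)) N x [::] N w - cumn N (size w) x ([::] ++ w).
  apply: (openb_top submonoidT) => // [e _ _ elt|]; last exact: coefs_inT.
  by rewrite cumn_stable.
have C : cum N x w = N ((1, x) :: w) - openb (cumn N (size w)) N x [::] N w.
  by rewrite {1}/cum /= ltnn eqxx.
move/eqP: E; rewrite /= (@cumn_big N (size w)) // subr0 subr_eq C addrC subrK.
by move=> /eqP->.
Qed.

(** Differences instead of sums: one identity gives additivity and also vanishing at a zero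
    coefficient. *)
Definition kadd q := forall x u b b' y v,
  q x (u ++ (b - b', y) :: v) = q x (u ++ (b, y) :: v) - q x (u ++ (b', y) :: v).

Definition fadd g := forall u b b' y v,
  g (u ++ (b - b', y) :: v) = g (u ++ (b, y) :: v) - g (u ++ (b', y) :: v).

Lemma kadd0 q x u y v : kadd q -> q x (u ++ (0, y) :: v) = 0.
Proof. by move=> qA; have := qA x u 0 0 y v; rewrite !subrr. Qed.

Lemma openb_add_acc q N x u b b' y v g w : kadd q ->
  openb q N x (u ++ (b - b', y) :: v) g w =
  openb q N x (u ++ (b, y) :: v) g w - openb q N x (u ++ (b', y) :: v) g w.
Proof.
move=> qA; elim: w v g => [|[c z] w IH] v g /=; first by rewrite qA mulrBl.
by rewrite !rcons_cat /= !IH opprD addrACA.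
Qed.

Lemma openb_add_fun q N x acc g g' w : kadd q ->
  openb q N x acc (fun h => g h - g' h) w =
  openb q N x acc g w - openb q N x acc g' w.
Proof.
move=> qA; elim: w acc g g' => [|[c z] w IH] acc g g' /=; first by rewrite mulrBr.
rewrite mulrBl -cats1 openb_add_acc // !cats1.
by rewrite (IH acc (fun h => g ((c, z) :: h))) opprD addrACA.
Qed.

Lemma openb_add_word q N x acc g u b b' y v : kadd q -> fadd N -> fadd g ->
  openb q N x acc g (u ++ (b - b', y) :: v) =
  openb q N x acc g (u ++ (b, y) :: v) - openb q N x acc g (u ++ (b', y) :: v).
Proof.
move=> qA NA; elim: u acc g => [|[c z] u IH] acc g gA /=.
  rewrite mulrBr -cats1 openb_add_acc // !cats1.
  rewrite (@openb_eq q N x acc (fun h => g ((b - b', y) :: h))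
    (fun h => g ((b, y) :: h) - g ((b', y) :: h))).
    by rewrite openb_add_fun // opprD addrACA.
  by move=> h; apply: (gA [::]).
rewrite !IH //; first by rewrite opprD addrACA.
by move=> u' *; apply: (gA ((c, z) :: u')).
Qed.

Lemma cum_add N : fadd N -> kadd (cum N).
Proof.
move=> NA; have H k : kadd (cumn N k).
  elim: k => [|k IH] x u b b' y v /=; first by rewrite subr0.
  rewrite !size_cat /=; case: ltnP => _; first exact: IH.
  case: eqP => _; last by rewrite subr0.
  rewrite openb_add_word // -!cat_cons NA !cat_cons.
  by rewrite !opprD addrACA.
by move=> x u b b' y v; rewrite /cum H !size_cat.
Qed.

Lemma mom_add q : kadd q -> fadd (mom q).
Proof.
move=> qA; have H k : fadd (momn q k).
  elim: k => [|k IH] [|[c z] u] b b' y v /=; rewrite ?subr0 //.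
    by rewrite mulrBl.
  by rewrite openb_add_word // mulrBr.
by move=> u b b' y v; rewrite /mom H !size_cat.
Qed.

End Words.

(** * Scalars inside words *)

Section Scalars.

Context (B : pzRingType) (T : eqType).
Implicit Types (w u v acc r : seq (B * T)) (x y : T) (b c d : B).
Implicit Types (q : T -> seq (B * T) -> B) (N f g : seq (B * T) -> B).

(* The value of [f] on [d w]: when no letter follows, the scalar [d] comes out
   on the right. *)
Definition sc d f w : B :=
  if w is (b, x) :: w' then f ((d * b, x) :: w') else f [::] * d.

Lemma openb_sc q N x acc d g w :
  openb q N x acc (sc d g) w = sc d (openb q N x acc g) w.
Proof. by case: w => [|[b y] w] /=; rewrite ?mulrA. Qed.

Lemma sc_eq d f f' w : f =1 f' -> sc d f w = sc d f' w.
Proof. by move=> ff; case: w => [|[b x] w] /=; rewrite ff. Qed.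

Lemma sc_add d f f' w : sc d (fun h => f h + f' h) w = sc d f w + sc d f' w.
Proof. by case: w => [|[b x] w] //=; rewrite mulrDl. Qed.

Lemma sc_mull d b f w : sc d (fun h => b * f h) w = b * sc d f w.
Proof. by case: w => [|[c x] w] //=; rewrite mulrA. Qed.

Definition everything (s : seq T) : Prop := True.

Lemma sc_mom q N d w : is_mom everything q N -> sc d N w = d * N w.
Proof.
move=> [N1 NS]; case: w => [|[b x] w] /=; first by rewrite N1 mulr1 mul1r.
by rewrite !NS // mulrA.
Qed.

Definition dead q x acc : Prop := forall e, q x (acc ++ e) = 0.

Lemma dead_openb q N x acc g w : dead q x acc -> openb q N x acc g w = 0.
Proof.
elim: w acc g => [|[b y] w IH] acc g dd /=.
  by have := dd [::]; rewrite cats0 => ->; rewrite mul0r.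
rewrite !IH ?addr0 // => e; rewrite cat_rcons; exact: dd.
Qed.

(** A dead block is worth zero, so every letter of [r] must stay in the current gap. This is how
    vanishing kernels become factorisations. *)
Lemma openb_nojoin q N x acc g r w :
  (forall r1 b y r2, r = r1 ++ (b, y) :: r2 -> dead q x (rcons acc (g r1 * b, y))) ->
  openb q N x acc g (r ++ w) = openb q N x acc (fun h => g (r ++ h)) w.
Proof.
elim: r g => [|[b y] r IH] g dd //=.
rewrite dead_openb ?add0r; last exact: (dd [::] b y r).
by rewrite (IH (fun h => g ((b, y) :: h))) // => r1 c z r2 e; apply: (dd ((b, y) :: r1) c z r2); rewrite e.
Qed.

Lemma openb_nojoin0 q N x acc g r :
  (forall r1 b y r2, r = r1 ++ (b, y) :: r2 -> dead q x (rcons acc (g r1 * b, y))) ->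
  openb q N x acc g r = q x acc * g r.
Proof. by move=> dd; rewrite -[r in LHS]cats0 openb_nojoin //= cats0. Qed.

(** No block has letters both inside and outside [p], so the run [v] is a union of blocks and acts
    as the scalar [N v]. If [w1] is empty, the block of the first letter of [v] cannot reach [w2];
    otherwise the block of the first letter of [w1] cannot enter [v], and induction applies to the
    gap that holds [v]. *)
Lemma mom_split (p : pred T) q N w1 v w2 :
  is_mom everything q N ->
  (forall x acc, has p (x :: unzip2 acc) -> has (predC p) (x :: unzip2 acc) ->
     q x acc = 0) ->
  all (predC p) (unzip2 w1) -> all p (unzip2 v) -> all (predC p) (unzip2 w2) ->
  N (w1 ++ v ++ w2) = sc (N v) (fun h => N (w1 ++ h)) w2.
Proof.
move=> Nq sep; have [N1 NS] := Nq.
have [n] := ubnP (size w1 + size v + size w2).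
elim: n w1 v w2 => // n IH w1 v w2 lt pw1 pv pw2.
have dd x acc c y : p x != p y -> dead q x (rcons acc (c, y)).
  move=> xy e; apply: sep; rewrite cat_rcons /unzip2 map_cat /= has_cat /=;
    by move: xy; case: (p x); case: (p y); rewrite ?orbT.
case: w1 lt pw1 => [|[b x] w1] lt pw1.
  rewrite [LHS]/= [RHS](sc_mom _ _ Nq).
  case: v lt pv => [|[b x] v] lt pv; first by rewrite N1 mul1r.
  move: pv => /= /andP[px pv]; rewrite [LHS]NS // [in RHS]NS // -mulrA; congr (_ * _).
  (* [u0] is the part of the current gap already read; the bound on sizes keeps every gap short
     enough for the outer induction. *)
  have main u0 acc v' : all p (unzip2 u0) -> all p (unzip2 v') ->
    (size u0 + size v' <= size v)%N ->
    openb q N x acc (fun h => N (u0 ++ h)) (v' ++ w2) =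
    openb q N x acc (fun h => N (u0 ++ h)) v' * N w2.
    elim: v' u0 acc => [|[c y] v' IHv] u0 acc pu0 pv' le.
      rewrite [LHS]openb_nojoin0; last first.
        move=> r1 c y r2 /= e; apply: dd; rewrite px; move: pw2; rewrite e.
        by rewrite /unzip2 map_cat all_cat /= => /and3P[_ /negPf->].
      rewrite /= cats0 -mulrA; congr (_ * _).
      transitivity (sc (N u0) N w2); last exact: sc_mom Nq.
      apply: (IH [::] u0 w2) => //.
      by move: lt le; rewrite /=; lia.
    move: pv' => /= /andP[py pv']; rewrite mulrDl; congr (_ + _).
      by have := IHv [::] (rcons acc (N (u0 ++ [::]) * c, y)) isT pv'; apply; move: le => /=; lia.
    have E h : N (u0 ++ (c, y) :: h) = N (rcons u0 (c, y) ++ h) by rewrite cat_rcons.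
    rewrite !(openb_eq _ _ _ _ _ E) IHv //.
      by rewrite /unzip2 map_rcons all_rcons /= py.
    by move: le; rewrite size_rcons /=; lia.
  by have := main [::] [::] v isT pv; rewrite add0n; apply.
move: pw1 => /= /andP[px pw1]; rewrite NS //.
rewrite (sc_eq _ _ (f' := fun h => b * openb q N x [::] N (w1 ++ h))); last first.
  by move=> h; rewrite NS.
rewrite sc_mull; congr (_ * _).
have main u0 acc w' : all (predC p) (unzip2 u0) -> all (predC p) (unzip2 w') ->
    (size u0 + size w' <= size w1)%N ->
    openb q N x acc (fun h => N (u0 ++ h)) (w' ++ v ++ w2) =
    sc (N v) (fun h => openb q N x acc (fun h => N (u0 ++ h)) (w' ++ h)) w2.
  elim: w' u0 acc => [|[c y] w' IHw] u0 acc pu0 pw' le.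
    rewrite /= openb_nojoin; last first.
      move=> r1 c y r2 e; apply: dd; rewrite (negPf px); move: pv; rewrite e.
      by rewrite /unzip2 map_cat all_cat /= => /and3P[_ ->].
    rewrite -openb_sc; apply: (openb_ext (@submonoidT _)) => //; last exact: coefs_inT.
    move=> h hs _; split=> //; apply: IH => //.
      by move: lt le; have := size_subseq hs; rewrite /= !size_map; lia.
    apply/allP => z zh; apply: (allP pw2); exact: (mem_subseq hs).
  move: pw' => /= /andP[py pw']; rewrite sc_add; congr (_ + _).
    have := IHw [::] (rcons acc (N (u0 ++ [::]) * c, y)) isT pw' => /= ->//.
    by move: le => /=; lia.
  have E h : N (u0 ++ (c, y) :: h) = N (rcons u0 (c, y) ++ h) by rewrite cat_rcons.
  rewrite (openb_eq _ _ _ _ _ E) IHw //; last by move: le; rewrite size_rcons /=; lia.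
    by apply: sc_eq => h; apply: openb_eq => h'; rewrite E.
  by rewrite /unzip2 map_rcons all_rcons /= py.
by have := main [::] [::] w1 isT pw1; rewrite add0n; apply.
Qed.

(** A letter that forms only singleton blocks is a block by itself in whichever gap it falls, so it
    acts as the scalar [q y [::]], preceded by its coefficient. *)
Lemma mom_scalar (p : pred T) q N u b y v :
  is_mom everything q N ->
  (forall x acc, acc != [::] -> has p (x :: unzip2 acc) -> q x acc = 0) ->
  p y -> N (u ++ (b, y) :: v) = sc (b * q y [::]) (fun h => N (u ++ h)) v.
Proof.
move=> Nq sep py; have [N1 NS] := Nq.
have [n] := ubnP (size u + size v).
elim: n u v => // n IH [|[c x] u] v lt.
  rewrite /= NS // (sc_mom _ _ Nq) -mulrA; congr (_ * _).
  rewrite openb_nojoin0 //.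
  move=> r1 c z r2 _ e; apply: sep; last by rewrite /= py.
  by case: e.
rewrite /= NS // (sc_eq _ _ (f' := fun h => c * openb q N x [::] N (u ++ h))); last first.
  by move=> h; rewrite NS.
rewrite sc_mull; congr (_ * _).
have main u0 acc u' : (size u0 + size u' <= size u)%N ->
    openb q N x acc (fun h => N (u0 ++ h)) (u' ++ (b, y) :: v) =
    sc (b * q y [::]) (fun h => openb q N x acc (fun h => N (u0 ++ h)) (u' ++ h)) v.
  elim: u' u0 acc => [|[d z] u' IHu] u0 acc le.
    rewrite /= dead_openb ?add0r; last first.
      move=> e; rewrite cat_rcons; apply: sep; first by case: (acc).
      by rewrite /= /unzip2 map_cat has_cat /= py !orbT.
    rewrite -openb_sc; apply: (openb_ext (@submonoidT _)) => //; last exact: coefs_inT.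
    move=> h hs _; split=> //; apply: IH.
    by move: lt le; have := size_subseq hs; rewrite /= !size_map; lia.
  rewrite /= sc_add; congr (_ + _).
    have := IHu [::] (rcons acc (N (u0 ++ [::]) * d, z)) => /= ->//.
    by move: le => /=; lia.
  have E h : N (u0 ++ (d, z) :: h) = N (rcons u0 (d, z) ++ h) by rewrite cat_rcons.
  rewrite (openb_eq _ _ _ _ _ E) IHu //; last by move: le; rewrite size_rcons /=; lia.
  by apply: sc_eq => h; apply: openb_eq => h'; rewrite E.
by have := main [::] [::] u; rewrite add0n; apply.
Qed.

End Scalars.

Section SubringValued.

Context (B : pzRingType) (T : eqType) (D : B -> Prop).
Implicit Types (w u v acc e h : seq (B * T)) (x y : T) (b d : B).
Implicit Types (q : T -> seq (B * T) -> B) (N g : seq (B * T) -> B).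
Context (D1 : D 1) (DM : forall b b', D b -> D b' -> D (b * b')).
Context (DB : forall b b', D b -> D b' -> D (b - b')).

Lemma sub_in0 : D 0. Proof. by rewrite -(subrr (1 : B)); apply: DB. Qed.

Lemma sub_inD b b' : D b -> D b' -> D (b + b').
Proof.
move=> Db Dc; rewrite -[b']opprK; apply: DB => //.
by rewrite -sub0r; apply: DB => //; apply: sub_in0.
Qed.

Lemma openb_in q N x acc g w :
  (forall h, subseq (unzip2 h) (unzip2 w) -> coefs_in D h -> D (N h)) ->
  (forall h, subseq (unzip2 h) (unzip2 w) -> coefs_in D h -> D (g h)) ->
  (forall e, subseq (unzip2 e) (unzip2 w) -> coefs_in D e -> D (q x (acc ++ e))) ->
  coefs_in D w -> D (openb q N x acc g w).
Proof.
elim: w acc g => [|[b y] w IH] acc g HN Hg Hq /=.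
  by move=> _; apply: DM; [have := Hq [::] isT I; rewrite cats0|apply: Hg].
move=> [Db Dw]; have sub (s : seq T) : subseq s (unzip2 w) -> subseq s (y :: unzip2 w).
  by move=> /subseq_trans; apply; apply: subseq_cons.
apply: sub_inD; apply: IH => // h hs hD.
- by apply: HN => //; apply: sub.
- by apply: HN => //; apply: sub.
- rewrite -cats1 -catA /=; apply: Hq => /=; first by rewrite eqxx.
  by split=> //; apply: DM => //; apply: Hg => //; apply: sub0seq.
- by apply: HN => //; apply: sub.
- by apply: Hg => //=; rewrite ?eqxx.
- by apply: Hq => //; apply: sub.
Qed.

Lemma mom_in ok q N : hereditary ok -> is_mom ok q N ->
  (forall x e, ok (x :: unzip2 e) -> coefs_in D e -> D (q x e)) ->
  forall w, ok (unzip2 w) -> coefs_in D w -> D (N w).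
Proof.
move=> okS [N1 NS] Hq w; have [k] := ubnP (size w).
elim: k w => // k IH [|[b x] w] /=; first by rewrite N1.
rewrite ltnS => lek okw [Db Dw]; rewrite NS //; apply: DM => //.
have H h : subseq (unzip2 h) (unzip2 w) -> coefs_in D h -> D (N h).
  move=> hs hD; apply: IH => //.
    by apply: leq_ltn_trans lek; have := size_subseq hs; rewrite !size_map.
  by apply: okS okw; exact: subseq_trans hs (subseq_cons _ _).
apply: openb_in => // e es eD; apply: Hq => //=.
by apply: okS okw; rewrite /= eqxx.
Qed.

Lemma cum_in ok N : hereditary ok ->
  (forall w, ok (unzip2 w) -> coefs_in D w -> D (N w)) ->
  forall x w, ok (x :: unzip2 w) -> coefs_in D w -> D (cum N x w).
Proof.
move=> okS HN x w; rewrite /cum; move: (size w).+1 => k.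
elim: k x w => [|k IH] x w okw Dw /=; first exact: sub_in0.
case: ifP => _; first exact: IH.
case: ifP => _; last exact: sub_in0.
have H h : subseq (unzip2 h) (unzip2 w) -> coefs_in D h -> D (N h).
  by move=> hs; apply: HN; apply: okS okw; exact: subseq_trans hs (subseq_cons _ _).
apply: DB; first by apply: HN.
apply: openb_in => // e es eD; apply: IH => //=.
by apply: okS okw; rewrite /= eqxx.
Qed.

End SubringValued.

(** * Centred alternating words *)

Section Centering.

Context (B : pzRingType) (T : eqType) (col : T -> bool).
Implicit Types (w u v acc r : seq (B * T)) (x y : T) (b d : B) (c : bool).
Implicit Types (q : T -> seq (B * T) -> B) (N f g ctr : seq (B * T) -> B).
Implicit Types (rs : seq (seq (B * T))).

(* [cens ctr rs f v] is the value of [f] on the formal word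
   (r1 - ctr r1) ... (rm - ctr rm) v. *)
Definition cen ctr r f w : B := f (r ++ w) - sc (ctr r) f w.

Fixpoint cens ctr rs f : seq (B * T) -> B :=
  if rs is r :: rs' then cens ctr rs' (cen ctr r f) else f.

Definition mono c r := all (fun p : B * T => col p.2 == c) r.

(** With an empty tail these are the alternating products of freeness. The uncentred tail [v] serves
    the induction, where the last run is read only in part. *)
Fixpoint alt c rs v : bool :=
  if rs is r :: rs' then [&& r != [::], mono c r & alt (~~ c) rs' v] else mono c v.

Lemma cens_cat ctr rs1 rs2 f : cens ctr (rs1 ++ rs2) f = cens ctr rs2 (cens ctr rs1 f).
Proof. by elim: rs1 f => //= r rs1 IH f; rewrite IH. Qed.

Lemma cen_eq ctr r f f' : f =1 f' -> cen ctr r f =1 cen ctr r f'.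
Proof. by move=> ff w; rewrite /cen ff (sc_eq _ _ ff). Qed.

Lemma cens_eq ctr rs f f' : f =1 f' -> cens ctr rs f =1 cens ctr rs f'.
Proof. by elim: rs f f' => //= r rs IH f f' ff; apply: IH; apply: cen_eq. Qed.

Lemma cens_add ctr rs f f' v :
  cens ctr rs (fun w => f w + f' w) v = cens ctr rs f v + cens ctr rs f' v.
Proof.
elim: rs f f' => //= r rs IH f f'; rewrite -IH; apply: cens_eq => w.
by rewrite /cen sc_add opprD addrACA.
Qed.

Lemma cens_mull ctr rs b f v : cens ctr rs (fun w => b * f w) v = b * cens ctr rs f v.
Proof.
elim: rs f => //= r rs IH f; rewrite -IH; apply: cens_eq => w.
by rewrite /cen sc_mull mulrBr.
Qed.

Lemma cens_sub ctr rs f f' v :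
  cens ctr rs (fun w => f w - f' w) v = cens ctr rs f v - cens ctr rs f' v.
Proof.
rewrite cens_add; congr (_ + _); rewrite -mulN1r -cens_mull.
by apply: cens_eq => w; rewrite mulN1r.
Qed.

Lemma alt_prefix c rs1 r rs2 v : alt c (rs1 ++ r :: rs2) v -> alt c rs1 r.
Proof. by elim: rs1 c => [|r1 rs1 IH] c /= /and3P[// -> ->]; apply: IH. Qed.

Lemma mono_cat c u v : mono c (u ++ v) = mono c u && mono c v.
Proof. exact: all_cat. Qed.

Lemma alt_catl c rs u v : alt c rs (u ++ v) -> alt c rs u.
Proof.
elim: rs c => [|r rs IH] c /=; first by rewrite mono_cat => /andP[].
by move=> /and3P[-> ->]; apply: IH.
Qed.

Lemma alt_color c rs u b y v : alt c rs (u ++ (b, y) :: v) -> rs = [::] -> col y = c.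
Proof.
by move=> + e; rewrite e /= mono_cat /= => /and3P[_ /eqP].
Qed.

Context (D : B -> Prop) (F : B -> B).

(** Stated for a bare map and a predicate, so that the identity on all of [B] is an instance too and
    the [B]-valued and [D]-valued cumulants share one treatment. *)
Record cond_exp : Prop := CondExp {
  ce1 : D 1;
  ceM : forall b b', D b -> D b' -> D (b * b');
  ceB : forall b b', D b -> D b' -> D (b - b');
  ce_in : forall b, D (F b);
  ce_id : forall d, D d -> F d = d;
  ce_sub : forall b b', F (b - b') = F b - F b';
  ce_l : forall b d, D d -> F (d * b) = d * F b;
  ce_r : forall b d, D d -> F (b * d) = F b * d
}.

Context (FD : cond_exp).

Lemma ce0 : D 0. Proof. exact: sub_in0 (ce1 FD) (ceB FD). Qed.

Lemma ceF0 : F 0 = 0.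
Proof. by have := ce_sub FD 0 0; rewrite !subrr. Qed.

Lemma ce_submonoid : submonoid D.
Proof. by case: FD. Qed.

Context (q : T -> seq (B * T) -> B) (N : seq (B * T) -> B).
Context (Nq : is_mom (@everything T) q N) (qA : kadd q).
Context (q_mixed : forall x acc, ~~ all (fun y => col y == col x) (unzip2 acc) -> q x acc = 0).
Context (q_D : forall x acc, col x -> D (q x acc)).
Context (q_F : forall x u b y v, col x -> F b = 0 -> q x (u ++ (b, y) :: v) = 0).

Let ctr r := F (N r).

Lemma mom_D w : mono true w -> coefs_in D w -> D (N w).
Proof.
move=> mw; apply: (mom_in (ce1 FD) (ceM FD) (ceB FD) (ok := fun s => all col s)).
- by move=> s t st /allP h; apply/allP => y /(mem_subseq st)/h.
- by split=> [|b x w' _]; [case: Nq|apply: (proj2 Nq)].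
- by move=> x e /= /andP[cx _] _; apply: q_D.
- by rewrite all_map; apply: sub_all mw => p /eqP.
Qed.

Let sz rs := size (flatten rs).

(* By simultaneous induction on the length: a monochromatic word factors out of
   an alternating centred word that begins with the other colour, because no block
   can reach beyond a centred run; and centred words vanish under [F], even
   without [F] when the first run has colour [true]. *)
Let Q3 n := forall c u rs v, (size u + sz rs + size v < n)%N ->
  alt c rs v -> mono (~~ c) u -> coefs_in D u -> coefs_in D (flatten rs) ->
  coefs_in D v ->
  cens ctr rs (fun h => N (u ++ h)) v = N u * cens ctr rs N v.

Let Q0 n := forall c rs v, (sz rs + size v < n)%N -> rs != [::] ->
  alt c rs v -> coefs_in D (flatten rs) -> coefs_in D v ->
  if c then cens ctr rs N v = 0 else F (cens ctr rs N v) = 0.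

(** A letter joining the block of [x] must have the colour of [x], so the gap before it contains a
    centred run. By [Q3] the moment of the gap is [N u0] times a centred moment. If [c] holds, this
    is zero by [Q0]; otherwise the new coefficient is killed by [F], because [N u0] and [b] lie in
    [D], and [q_F] applies to the colour of [x]. *)
Lemma join_dead n c x acc u0 rs1 r1 b y r2 : Q3 n -> Q0 n ->
  col x = ~~ c -> (size u0 + sz rs1 + size r1 < n)%N ->
  alt c rs1 (r1 ++ (b, y) :: r2) ->
  mono (~~ c) u0 -> coefs_in D u0 -> coefs_in D (flatten rs1) ->
  coefs_in D (r1 ++ (b, y) :: r2) ->
  dead q x (rcons acc (cens ctr rs1 (fun h => N (u0 ++ h)) r1 * b, y)).
Proof.
move=> hQ3 hQ0 cx lt ha mu Du Drs /coefs_in_cat[Dr1 [Db _]] e; rewrite cat_rcons.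
have [cy|cy] := eqVneq (col y) (col x); last first.
  by apply: q_mixed; rewrite /unzip2 map_cat all_cat /= (negPf cy) andbF.
have rs1n : rs1 != [::].
  apply/eqP => rs0; have := alt_color ha rs0; rewrite cy cx.
  by case: (c).
have ha1 := alt_catl ha.
rewrite (hQ3 c) //; have := hQ0 c rs1 r1 _ rs1n ha1 Drs Dr1.
have -> : (sz rs1 + size r1 < n)%N by move: lt; lia.
move=> /(_ isT); case: (c) cx mu => /= cx mu z.
  by rewrite z mulr0 mul0r kadd0.
apply: q_F; first by rewrite cx.
by rewrite ce_r // ce_l // ?z ?mulr0 ?mul0r //; apply: mom_D.
Qed.

Lemma Q3_step n : Q3 n -> Q0 n -> Q3 n.+1.
Proof.
move=> hQ3 hQ0 c [|[b x] u] rs v lt ha mu Du Drs Dv.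
  by rewrite (proj1 Nq) mul1r; apply: cens_eq.
have [N1 NS] := Nq; move: mu Du => /= /andP[/eqP cx mu] [Db Du].
have Eu : (fun h => N (((b, x) :: u) ++ h)) =1 fun h => b * openb q N x [::] N (u ++ h).
  by move=> h; rewrite /= NS.
rewrite (cens_eq _ _ Eu).
rewrite cens_mull [in RHS]NS // -mulrA; congr (_ * _).
have main u' acc u0 : mono (~~ c) u' -> coefs_in D u' -> mono (~~ c) u0 ->
    coefs_in D u0 -> (size u0 + size u' <= size u)%N ->
    cens ctr rs (fun w => openb q N x acc (fun h => N (u0 ++ h)) (u' ++ w)) v =
    openb q N x acc (fun h => N (u0 ++ h)) u' * cens ctr rs N v.
  elim: u' acc u0 => [|[d y] u' IHu] acc u0 mu' Du' mu0 Du0 le; last first.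
    move: mu' Du' => /= /andP[cy mu'] [Dd Du']; rewrite cens_add mulrDl; congr (_ + _).
      by apply: (IHu _ [::]) => //; move: le => /=; lia.
    have E h : N (u0 ++ (d, y) :: h) = N (rcons u0 (d, y) ++ h) by rewrite cat_rcons.
    rewrite (openb_eq _ _ _ _ _ E) -IHu //.
    - by apply: cens_eq => w; rewrite (openb_eq _ _ _ _ _ E).
    - by rewrite -cats1 mono_cat mu0 /= cy.
    - by rewrite -cats1; apply/coefs_in_cat.
    - by move: le; rewrite size_rcons /=; lia.
  rewrite /= cats0.
  (* The runs [rs1] have already entered the current gap. Centring commutes with their entry because
     [sc] passes through [openb]. *)
  have NJ rs2 rs1 : rs = rs1 ++ rs2 ->
      cens ctr rs2 (openb q N x acc (cens ctr rs1 (fun h => N (u0 ++ h)))) v =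
      q x acc * cens ctr rs (fun h => N (u0 ++ h)) v.
    elim: rs2 rs1 => [|r rs2 IHr] rs1 e /=.
      rewrite cats0 in e; rewrite e openb_nojoin0 // => r1 b' y r2 ev.
      apply: (join_dead acc hQ3 hQ0 (c := c) (r2 := r2)) => //; rewrite -?e -?ev //.
      by move: lt le; rewrite ev /= !size_cat /=; lia.
    rewrite -(IHr (rcons rs1 r)); last by rewrite cat_rcons.
    apply: cens_eq => w; rewrite /cen openb_nojoin; last first.
      move=> r1 b' y r2 er.
      have har : alt c rs1 r by apply: (@alt_prefix _ _ _ rs2 v); rewrite -e.
      move: Drs; rewrite e flatten_cat /= => /coefs_in_cat[Drs1 /coefs_in_cat[Dr _]].
      apply: (join_dead acc hQ3 hQ0 (c := c) (r2 := r2)) => //; rewrite -?er //.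
      move: lt le; rewrite e /sz flatten_cat /= er !size_cat /=; lia.
    rewrite -openb_sc -openb_add_fun //; apply: openb_eq => h.
    by rewrite -cats1 cens_cat.
  rewrite (NJ rs [::]) // -mulrA; congr (_ * _); apply: (hQ3 c) => //.
  by move: lt le => /=; lia.
by have := main u [::] [::] mu Du isT I; apply; rewrite add0n.
Qed.

(** The first run factors out as [N r - F (N r)]. In colour [true] this is zero, [N r] being in [D].
    In colour [false] the remainder is either an uncentred tail of colour [true], whose [D]-valued
    moment can be taken out of [F], or begins with a centred run of colour [true] and vanishes by
    induction. *)
Lemma Q0_step n : Q3 n.+1 -> Q0 n -> Q0 n.+1.
Proof.
move=> hQ3 hQ0 c [//|r rs] v lt _ /= /and3P[rn mr ha] /coefs_in_cat[Dr Drs] Dv.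
have E : cens ctr rs (cen ctr r N) v = (N r - F (N r)) * cens ctr rs N v.
  rewrite mulrBl -(hQ3 (~~ c) r rs v) ?negbK //; last first.
    by move: lt; rewrite /sz /= size_cat; lia.
  rewrite -cens_mull -cens_sub; apply: cens_eq => w.
  by rewrite /cen (sc_mom _ _ Nq).
rewrite {}E; case: c mr ha => mr ha.
  by rewrite ce_id ?subrr ?mul0r //; apply: mom_D.
case: (eqVneq rs [::]) => [e|rsn].
  rewrite e /= in ha *; rewrite ce_r //; last exact: mom_D.
  by rewrite ce_sub // [F (F _)]ce_id ?subrr ?mul0r //; apply: ce_in.
have := hQ0 true rs v _ rsn ha Drs Dv; rewrite /= => ->; first by rewrite mulr0 ceF0.
move: lt; rewrite /sz /= size_cat; case: (r) rn => //= *; lia.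
Qed.

Lemma cens_mom_eq0 c rs :
  rs != [::] -> alt c rs [::] -> coefs_in D (flatten rs) -> F (cens ctr rs N [::]) = 0.
Proof.
have H n : Q3 n /\ Q0 n.
  elim: n => [|n [h3 h0]]; first by split.
  by have h3' := Q3_step h3 h0; split=> //; apply: Q0_step.
move=> rn ha Drs; have := (H (sz rs).+1).2 c rs [::] _ rn ha Drs I.
by rewrite /= addn0 ltnSn => /(_ isT); case: c ha => // _ ->; rewrite ceF0.
Qed.

End Centering.

Lemma cond_exp_id (B : pzRingType) : cond_exp (fun _ : B => True) id.
Proof. by split. Qed.

(** * Centred moments determine all moments *)

Section Uniqueness.

Context (B : pzRingType) (T : eqType) (col : T -> bool) (D : B -> Prop).
Implicit Types (w u v acc r h : seq (B * T)) (x y : T) (b d : B) (c : bool).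
Implicit Types (f g : seq (B * T) -> B) (rs : seq (seq (B * T))).

Lemma alternating_runs w : exists c rs,
  [/\ flatten rs = w, alt col c rs [::] & forall b x w', w = (b, x) :: w' -> c = col x].
Proof.
elim: w => [|[b x] w [c [rs [e ha hc]]]]; first by exists true, [::].
case: (eqVneq c (col x)) => [cx|cx].
  case: rs e ha => [|r rs] /= e ha; last first.
    exists c, (((b, x) :: r) :: rs); split; first by rewrite /= e.
      by move: ha => /= /and3P[_ -> ->]; rewrite cx eqxx.
    by move=> b' x' w' [_ <-].
  exists (col x), [:: [:: (b, x)]]; rewrite /= eqxx -e; split=> //.
  by move=> b' x' w' [_ <-].
exists (col x), ([:: (b, x)] :: rs); split; first by rewrite /= e.
  rewrite /= eqxx /=; move: cx ha; case: c {hc} => /=; by case: (col x).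
by move=> b' x' w' [_ <-].
Qed.

Context (DS : submonoid D).
Context (ctr : seq (B * T) -> B) (ctrD : forall r, D (ctr r)).

Lemma cens_ext rs v f f' : coefs_in D (flatten rs) -> coefs_in D v ->
  (forall h, coefs_in D h -> subseq (unzip2 h) (unzip2 (flatten rs ++ v)) -> f h = f' h) ->
  cens ctr rs f v = cens ctr rs f' v.
Proof.
elim: rs f f' => [|r rs IH] f f' /=; first by move=> _ Dv; apply.
move=> /coefs_in_cat[Dr Drs] Dv ff; apply: IH => // h Dh hs; rewrite /cen.
rewrite -catA /unzip2 map_cat in ff.
congr (_ - _).
  apply: ff; first by apply/coefs_in_cat.
  by rewrite /unzip2 map_cat; apply: cat_subseq (subseq_refl _) hs.
case: h Dh hs => [|[b x] h] /= Dh hs; first by rewrite ff ?sub0seq.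
rewrite ff //=; first by split; [apply: (proj2 DS) => //; apply Dh|apply Dh].
exact: subseq_trans hs (suffix_subseq _ _).
Qed.

(** When the centred factors are expanded, the term without any centre is [f] of the whole word;
    every other term has lost a non-empty run. *)
Lemma cens_ext_top rs v f f' : coefs_in D (flatten rs) -> coefs_in D v ->
  all (fun r => r != [::]) rs ->
  (forall h, coefs_in D h -> subseq (unzip2 h) (unzip2 (flatten rs ++ v)) ->
     (size h < size (flatten rs ++ v))%N -> f h = f' h) ->
  cens ctr rs f v - f (flatten rs ++ v) = cens ctr rs f' v - f' (flatten rs ++ v).
Proof.
elim: rs f f' => [|r rs IH] f f' /=; first by rewrite !subrr.
move=> /coefs_in_cat[Dr Drs] Dv /andP[rn rsn] ff.
rewrite -catA in ff *; rewrite /unzip2 map_cat size_cat in ff.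
rewrite !cens_sub addrAC [RHS]addrAC; congr (_ - _).
  apply: IH => // h Dh hs hlt; apply: ff.
  - by apply/coefs_in_cat.
  - by rewrite /unzip2 map_cat; apply: cat_subseq (subseq_refl _) hs.
  - by rewrite size_cat ltn_add2l.
apply: cens_ext => // h Dh hs.
have le : (size h <= size (flatten rs ++ v))%N.
  by have := size_subseq hs; rewrite !size_map.
have r0 : (0 < size r)%N by case: (r) rn.
case: h Dh hs le => [|[b x] h] /= Dh hs le.
  by rewrite ff //= ?sub0seq // ltn_addr.
rewrite ff //=; first by split; [apply: (proj2 DS) => //; apply Dh|apply Dh].
  exact: subseq_trans hs (suffix_subseq _ _).
by apply: leq_ltn_trans le _; rewrite -[X in (X < _)%N]add0n ltn_add2r.
Qed.

(* Expanding the centred runs of [w] expresses [f w] through shorter words. *)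
Lemma cens_determines (ok : seq T -> Prop) f f' : hereditary ok -> f [::] = f' [::] ->
  (forall c rs, rs != [::] -> alt col c rs [::] -> ok (unzip2 (flatten rs)) ->
     coefs_in D (flatten rs) -> cens ctr rs f [::] = cens ctr rs f' [::]) ->
  forall w, ok (unzip2 w) -> coefs_in D w -> f w = f' w.
Proof.
move=> okS f0 H w; have [n] := ubnP (size w); elim: n w => // n IH w lt okw Dw.
have [c [rs [e ha _]]] := alternating_runs w.
have rsn : all (fun r => r != [::]) rs.
  by elim: (rs) c ha {e} => //= r rs' IHr c /and3P[-> _ /IHr].
case: (eqVneq rs [::]) => [rs0|rsn0]; first by rewrite -e rs0.
have := cens_ext_top (rs := rs) (v := [::]) (f := f) (f' := f').
rewrite cats0 e => /(_ Dw I rsn) E.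
have : cens ctr rs f [::] = cens ctr rs f' [::] by apply: (H c); rewrite ?e.
move=> E'; move: E; rewrite E' => E; apply/oppr_inj/(addrI (cens ctr rs f' [::])).
apply: E => h Dh hs hlt; apply: IH => //; first exact: leq_trans hlt _.
exact: okS hs okw.
Qed.

End Uniqueness.

Section Expectation.

Context (B : pzRingType) (T : eqType) (D : B -> Prop) (F : B -> B).
Context (FD : cond_exp D F) (ctr : seq (B * T) -> B) (ctrD : forall r, D (ctr r)).

Lemma cens_expect rs (f f' : seq (B * T) -> B) v :
  coefs_in D (flatten rs) -> coefs_in D v ->
  (forall w, coefs_in D w -> f' w = F (f w)) ->
  cens ctr rs f' v = F (cens ctr rs f v).
Proof.
elim: rs f f' => [|r rs IH] f f' /=; first by move=> _ Dv; apply.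
move=> /coefs_in_cat[Dr Drs] Dv ff; apply: IH => // w Dw; rewrite /cen (ce_sub FD).
rewrite ff; last by apply/coefs_in_cat.
congr (_ - _); case: w Dw => [|[b x] w] /= Dw; first by rewrite ff // (ce_r FD).
by rewrite ff //=; split; [apply: (ceM FD) => //; apply Dw|apply Dw].
Qed.

End Expectation.

(** * Letters multiplied by scalars *)

(* Multiplying each letter [k] by scalars, [u k] before and [v k] after it. *)
Section Dressing.

Context (B : pzRingType) (T1 T2 : eqType) (phi : T1 -> T2) (u v : T1 -> B).
Implicit Types (w acc g h : seq (B * T1)).

(** [p] is the scalar left behind by the previous letter, waiting for the next coefficient; [trail]
    returns the one left behind by the last letter. *)
Fixpoint dress (p : B) w : seq (B * T2) :=
  if w is (b, k) :: w' then (p * b * u k, phi k) :: dress (v k) w' else [::].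

Fixpoint trail (p : B) w : B :=
  if w is (b, k) :: w' then trail (v k) w' else p.

Lemma dress_cat p w h : dress p (w ++ h) = dress p w ++ dress (trail p w) h.
Proof. by elim: w p => [|[b k] w IH] p //=; rewrite IH. Qed.

Lemma trail_cat p w h : trail p (w ++ h) = trail (trail p w) h.
Proof. by elim: w p => [|[b k] w IH] p //=. Qed.

Lemma unzip2_dress p w : unzip2 (dress p w) = map phi (unzip2 w).
Proof. by elim: w p => [|[b k] w IH] p //=; rewrite IH. Qed.

Context (ok1 : seq T1 -> Prop) (ok2 : seq T2 -> Prop).
Context (ok1S : hereditary ok1) (ok12 : forall s, ok1 s -> ok2 (map phi s)).
Context (q1 : T1 -> seq (B * T1) -> B) (N1 : seq (B * T1) -> B).
Context (q2 : T2 -> seq (B * T2) -> B) (N2 : seq (B * T2) -> B).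
Context (Nq1 : is_mom ok1 q1 N1) (Nq2 : is_mom ok2 q2 N2).
Context (N12 : forall w, ok1 (unzip2 w) -> N1 w = N2 (dress 1 w) * trail 1 w).

(** The right-hand side, taken as a kernel, satisfies the moment recursion of [N1]: in each block
    the scalars of the letters multiply the adjoining gap moments and coefficients. Uniqueness of
    the kernel concludes. *)
Lemma cum_dress k w : ok1 (k :: unzip2 w) ->
  q1 k w = u k * q2 (phi k) (dress (v k) w) * trail (v k) w.
Proof.
move=> okw.
pose q' k w := u k * q2 (phi k) (dress (v k) w) * trail (v k) w.
suff Nq' : is_mom ok1 q' N1.
  apply: (cum_uniq (@submonoidT _) ok1S Nq1 Nq') => //; exact: coefs_inT.
split=> [|b x {k okw}w okw]; first by case: Nq1.
have N2l p k h : ok1 (k :: unzip2 h) ->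
    forall b, N2 (dress p ((b, k) :: h)) = p * N2 (dress 1 ((b, k) :: h)).
  move=> okh b' /=; have okh2 := ok12 okh.
  by rewrite !(proj2 Nq2) /= ?unzip2_dress // !mul1r !mulrA.
have main acc g h : ok1 (unzip2 g ++ unzip2 h) ->
    openb q' N1 x acc (fun e => N1 (g ++ e)) h =
    u x * openb q2 N2 (phi x) (dress (v x) acc)
      (fun e => N2 (dress (trail (v x) acc) g ++ e))
      (dress (trail (v x) (acc ++ g)) h) * trail (v x) (acc ++ g ++ h).
  elim: h acc g => [|[d y] h IHh] acc g okh /=.
    rewrite !cats0 /q' -!mulrA; congr (_ * (_ * _)); rewrite N12; last first.
      by apply: ok1S okh; rewrite cats0.
    rewrite trail_cat; case: g okh => [|[e z] g] /=.
      by move=> _; rewrite (proj1 Nq2) // !mulr1 mul1r.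
    move=> okh; have := N2l (trail (v x) acc) z g _ e; rewrite /= => ->; last first.
      by apply: ok1S okh; rewrite /= eqxx prefix_subseq.
    by rewrite mulrA.
  rewrite mulrDr mulrDl; congr (_ + _).
    have := IHh (rcons acc (N1 (g ++ [::]) * d, y)) [::]; rewrite /= => ->; last first.
      by apply: ok1S okh; exact: subseq_trans (subseq_cons _ y) (suffix_subseq _ _).
    rewrite !cats0 -!cats1 !dress_cat !trail_cat /=.
    suff -> : trail (v x) acc * (N1 g * d) * u y =
      N2 (dress (trail (v x) acc) g) * (trail (trail (v x) acc) g * d * u y) by [].
    rewrite !mulrA; congr (_ * _ * _).
    case: g okh => [|[e z] g] /=; first by rewrite (proj1 Nq1) (proj1 Nq2) // mulr1 mul1r.
    move=> okh; have okg : ok1 (z :: unzip2 g).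
      by apply: ok1S okh; rewrite /= eqxx prefix_subseq.
    have := N12 (w := (e, z) :: g) okg => /= ->.
    have := N2l (trail (v x) acc) z g okg e => /= ->.
    by rewrite !mulrA.
  have E e : N1 (g ++ (d, y) :: e) = N1 (rcons g (d, y) ++ e) by rewrite cat_rcons.
  rewrite (openb_eq _ _ _ _ _ E) IHh; last by rewrite /unzip2 map_rcons cat_rcons.
  rewrite -!cats1 -!catA !cat1s; congr (_ * _ * _).
  rewrite !catA !trail_cat dress_cat /=; apply: openb_eq => e.
  by rewrite -catA.
have oks : ok1 (unzip2 w) by apply: ok1S okw; apply: subseq_cons.
have := main [::] [::] w oks; rewrite /= => ->.
rewrite N12 //= (proj2 Nq2) /= ?unzip2_dress; last exact: (ok12 okw).
by rewrite !mul1r !mulrA.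
Qed.

End Dressing.

Section Centers.

Context (B : pzRingType) (T : eqType).
Implicit Types (rs : seq (seq (B * T))) (f ctr : seq (B * T) -> B).

Lemma cens_ctr ctr ctr' rs f v : {in rs, ctr =1 ctr'} -> cens ctr rs f v = cens ctr' rs f v.
Proof.
elim: rs f => //= r rs IH f h; rewrite -IH; last first.
  by move=> s sr; apply: h; rewrite inE sr orbT.
by apply: cens_eq => w; rewrite /cen h ?mem_head.
Qed.

Lemma alt_mono (col : T -> bool) c rs v r : alt col c rs v -> r \in rs ->
  exists c', mono col c' r.
Proof.
elim: rs c => //= s rs IH c /and3P[_ ms ha]; rewrite inE => /orP[/eqP->|/(IH _ ha)//].
by exists c.
Qed.

Lemma unzip2_run rs (r : seq (B * T)) : r \in rs -> subseq (unzip2 r) (unzip2 (flatten rs)).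
Proof.
elim: rs => //= s rs IH; rewrite inE /unzip2 map_cat => /orP[/eqP->|/IH h].
  exact: prefix_subseq.
exact: subseq_trans h (suffix_subseq _ _).
Qed.

Lemma coefs_in_run (D : B -> Prop) rs (r : seq (B * T)) : r \in rs ->
  coefs_in D (flatten rs) -> coefs_in D r.
Proof.
elim: rs => //= s rs IH; rewrite inE => /orP[/eqP->|/IH h] /coefs_in_cat[] //.
Qed.

Definition mapc (F : B -> B) (w : seq (B * T)) := [seq (F p.1, p.2) | p <- w].

Lemma unzip2_mapc F w : unzip2 (mapc F w) = unzip2 w.
Proof. by rewrite /unzip2 -map_comp. Qed.

Lemma mapc_in (D : B -> Prop) F w : (forall b, D (F b)) -> coefs_in D (mapc F w).
Proof. by move=> FD; elim: w => // -[b x] w /= IH. Qed.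

Lemma mapc_id (D : B -> Prop) F w : (forall d, D d -> F d = d) -> coefs_in D w -> mapc F w = w.
Proof. by move=> Fi; elim: w => // -[b x] w IH /= [Db /IH->]; rewrite Fi. Qed.


Lemma kadd_mapc (q : T -> seq (B * T) -> B) F : kadd q ->
  (forall b b', F (b - b') = F b - F b') -> kadd (fun x acc => q x (mapc F acc)).
Proof.
by move=> qA FB x u b b' y v; rewrite /mapc !map_cat /= FB qA.
Qed.

End Centers.

(** * Bi-non-crossing partitions *)

Section FinitePartitions.

Context (I : finType).
Implicit Types (X Y V W S : {set I}) (pi sigma : {set {set I}}).

Lemma partition_iff pi S : partition pi S <->
  [/\ forall X, X \in pi -> X != finset.set0 /\ X \subset S,
      forall x, x \in S -> exists2 X, X \in pi & x \in X
    & forall X Y x, X \in pi -> Y \in pi -> x \in X -> x \in Y -> X = Y].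
Proof.
split=> [/and3P[/eqP cS tI n0]|[h1 h2 h3]].
  split.
  - move=> X Xpi; split; first by apply: contraNneq n0 => <-.
    by rewrite -cS; apply: finset.bigcup_sup.
  - by move=> x; rewrite -cS => /finset.bigcupP[X]; exists X.
  - move=> X Y x Xp Yp xX xY; apply/eqP; apply/negPn/negP => XY.
    have /trivIsetP/(_ _ _ Xp Yp XY)/pred0P/(_ x) := tI.
    by rewrite /= xX xY.
apply/and3P; split.
- rewrite finset.eqEsubset; apply/andP; split.
    by apply/finset.bigcupsP => X /h1[].
  by apply/fintype.subsetP => x /h2[X Xp xX]; apply/finset.bigcupP; exists X.
- apply/trivIsetP => X Y Xp Yp XY; apply/pred0P => x /=.
  by apply/negbTE/negP => /andP[xX xY]; case/eqP: XY; apply: (h3 _ _ x).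
- by apply/negP => /h1[/eqP].
Qed.

End FinitePartitions.

Section ChiOrder.

Context (n : nat) (chi : 'I_n -> bool).
Implicit Types (a b c d : 'I_n) (X Y V W S : {set 'I_n}) (pi : {set {set 'I_n}}).
Local Notation lt := (chi_lt chi).
Local Notation chis := (chi_seq chi).

Definition closed_under pi V : bool := finset.cover (restr pi V) == V.

Lemma mem_chi_seq a : a \in chis.
Proof. by rewrite mem_cat mem_rev mem_filter [X in _ || X]mem_filter mem_enum !andbT orbN. Qed.

Lemma chi_seq_uniq : uniq chis.
Proof.
rewrite cat_uniq rev_uniq !(filter_uniq _ (enum_uniq _)) andbT /=.
by apply/hasPn => a; rewrite mem_rev mem_filter => /andP[/negPf na _]; rewrite mem_filter na.
Qed.

Lemma lt_irr a : lt a a = false. Proof. exact: ltnn. Qed.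

Lemma lt_trans : transitive lt. Proof. by move=> a b c; apply: ltn_trans. Qed.

Lemma lt_total a b : a != b -> lt a b || lt b a.
Proof.
move=> ab; rewrite -neq_ltn; apply: contra ab => /eqP e.
by rewrite -(nth_index a (mem_chi_seq a)) e nth_index ?mem_chi_seq.
Qed.

Lemma lt_asym a b : lt a b -> lt b a -> False.
Proof. by move=> ab ba; have := lt_trans ab ba; rewrite lt_irr. Qed.

Lemma chi_seq_pairwise : pairwise lt chis.
Proof.
case e: chis => [|x0 s] //; rewrite -e.
apply/(pairwiseP x0) => i j; rewrite !inE => hi hj ij.
by rewrite /chi_lt !index_uniq // ?chi_seq_uniq.
Qed.

Lemma ncP pi : noncrossing chi pi <->
  forall X Y a b c d, X \in pi -> Y \in pi -> X != Y -> a \in X -> c \in X ->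
    b \in Y -> d \in Y -> lt a b -> lt b c -> lt c d -> False.
Proof.
split=> [/'forall_implyP h X Y a b c d Xp Yp XY aX cX bY dY ab bc cd|h].
  have /'forall_implyP/(_ Y Yp)/implyP/(_ XY)/negP := h X Xp; apply.
  apply/'exists_andP; exists a; split=> //; apply/'exists_andP; exists b; split=> //.
  apply/'exists_andP; exists c; split=> //; apply/'exists_andP; exists d; split=> //.
  by apply/and3P.
apply/'forall_implyP => X Xp; apply/'forall_implyP => Y Yp; apply/implyP => XY.
apply/negP => /'exists_andP[a [aX]] /'exists_andP[b [bY]] /'exists_andP[c [cX]].
by move=> /'exists_andP[d [dY]] /and3P[ab bc cd]; apply: (h X Y a b c d).
Qed.

(** Subsets are needed because the moment recursion removes intervals; the order remains that of the
    whole index set. For the full set this is [BNC]. *)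
Definition NC S : {set {set {set 'I_n}}} :=
  [set pi | partition pi S & noncrossing chi pi].

Lemma NC_iff pi S : pi \in NC S <-> partition pi S /\ noncrossing chi pi.
Proof. by rewrite finset.inE; split=> [/andP|[-> ->]]. Qed.

Lemma NC_block pi S X : pi \in NC S -> X \in pi -> X != finset.set0 /\ X \subset S.
Proof. by move=> /NC_iff[/partition_iff[h _ _] _]; apply: h. Qed.

Lemma NC_cover pi S x : pi \in NC S -> x \in S -> exists2 X, X \in pi & x \in X.
Proof. by move=> /NC_iff[/partition_iff[_ h _] _]; apply: h. Qed.

Lemma NC_inj pi S X Y x : pi \in NC S -> X \in pi -> Y \in pi -> x \in X -> x \in Y -> X = Y.
Proof. by move=> /NC_iff[/partition_iff[_ _ h] _]; apply: h. Qed.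

Lemma NC_cross pi S X Y a b c d : pi \in NC S -> X \in pi -> Y \in pi -> X != Y ->
  a \in X -> c \in X -> b \in Y -> d \in Y -> lt a b -> lt b c -> lt c d -> False.
Proof. by move=> /NC_iff[_ /ncP h]; apply: h. Qed.

Lemma restrP pi V X : X \in restr pi V <-> X \in pi /\ X \subset V.
Proof. by rewrite finset.inE; split=> [/andP|[-> ->]]. Qed.

Lemma closedP pi S V : pi \in NC S -> V \subset S ->
  closed_under pi V <-> forall X x, X \in pi -> x \in X -> x \in V -> X \subset V.
Proof.
move=> piS VS; split=> [/eqP e X x Xp xX xV|h].
  move: xV; rewrite -{1}e => /finset.bigcupP[Y /restrP[Yp YV] xY].
  by rewrite (NC_inj piS Xp Yp xX xY).
apply/eqP/finset.setP => x; apply/finset.bigcupP/idP => [[X /restrP[_ /fintype.subsetP]]|xV].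
  exact.
have [X Xp xX] := NC_cover piS (fintype.subsetP VS _ xV).
by exists X => //; apply/restrP; split=> //; apply: h xV.
Qed.

Lemma closedC pi S V : pi \in NC S -> V \subset S -> closed_under pi V ->
  closed_under pi (S :\: V).
Proof.
move=> piS VS cV; apply/(closedP piS); first exact: finset.subsetDl.
move=> X x Xp xX /finset.setDP[xS xV]; apply/fintype.subsetP => y yX.
have [_ /fintype.subsetP XS] := NC_block piS Xp.
apply/finset.setDP; split; first exact: XS.
apply/negP => yV; case/negP: xV.
exact: (fintype.subsetP (proj1 (closedP piS VS) cV X y Xp yX yV)).
Qed.

Lemma NC_restr pi S V : pi \in NC S -> V \subset S -> closed_under pi V ->
  restr pi V \in NC V.
Proof.
move=> piS VS cV; apply/NC_iff; split.
  apply/partition_iff; split.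
  - by move=> X /restrP[/(NC_block piS)[]].
  - move=> x xV; have [X Xp xX] := NC_cover piS (fintype.subsetP VS _ xV).
    exists X => //; apply/restrP; split=> //.
    exact: (proj1 (closedP piS VS) cV X x).
  - by move=> X Y x /restrP[Xp _] /restrP[Yp _]; apply: NC_inj piS Xp Yp.
apply/ncP => X Y a b c d /restrP[Xp _] /restrP[Yp _]; exact: NC_cross piS Xp Yp.
Qed.

(** A crossing between a block in the interval and one outside would place an outside element
    between two elements of [V]. *)
Lemma NC_union p1 p2 S V : V \subset S -> chi_interval chi S V ->
  p1 \in NC V -> p2 \in NC (S :\: V) ->
  [/\ p1 :|: p2 \in NC S, closed_under (p1 :|: p2) V,
      restr (p1 :|: p2) V = p1 & restr (p1 :|: p2) (S :\: V) = p2].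
Proof.
move=> VS /andP[_ /'forall_implyP int] h1 h2.
have intP a b c : a \in V -> b \in S -> c \in V -> lt a b -> lt b c -> b \in V.
  move=> aV bS cV ab bc; have /'forall_implyP/(_ b bS)/'forall_implyP/(_ c cV) := int a aV.
  by rewrite ab bc.
have s1 X : X \in p1 -> X \subset V by move=> /(NC_block h1)[].
have s2 X : X \in p2 -> X \subset S :\: V by move=> /(NC_block h2)[].
have dis X x : X \in p2 -> x \in X -> x \in V -> False.
  by move=> /s2/fintype.subsetP XW /XW/finset.setDP[_ /negP].
have un : p1 :|: p2 \in NC S.
  apply/NC_iff; split.
    apply/partition_iff; split.
    - move=> X /finset.setUP[/(NC_block h1)[X0 XV]|/(NC_block h2)[X0 XW]]; split=> //.
        exact: subset_trans XV VS.
      exact: subset_trans XW (finset.subsetDl _ _).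
    - move=> x xS; case: (boolP (x \in V)) => xV.
        have [X Xp xX] := NC_cover h1 xV; exists X => //; by rewrite finset.inE Xp.
      have xW : x \in S :\: V by apply/finset.setDP.
      by have [X Xp xX] := NC_cover h2 xW; exists X => //; rewrite finset.inE Xp orbT.
    - move=> X Y x /finset.setUP[Xp|Xp] /finset.setUP[Yp|Yp] xX xY.
      + exact: NC_inj h1 Xp Yp xX xY.
      + by case: (dis Y x Yp xY); apply: (fintype.subsetP (s1 X Xp)).
      + by case: (dis X x Xp xX); apply: (fintype.subsetP (s1 Y Yp)).
      + exact: NC_inj h2 Xp Yp xX xY.
  apply/ncP => X Y a b c d /finset.setUP[Xp|Xp] /finset.setUP[Yp|Yp] XY aX cX bY dY ab bc cd.
  - exact: NC_cross h1 Xp Yp XY aX cX bY dY ab bc cd.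
  - have /fintype.subsetP XV := s1 X Xp; apply: (dis Y b Yp bY).
    apply: intP (XV _ aX) _ (XV _ cX) ab bc.
    by have /fintype.subsetP/(_ _ bY)/finset.setDP[] := s2 Y Yp.
  - have /fintype.subsetP YV := s1 Y Yp; apply: (dis X c Xp cX).
    apply: intP (YV _ bY) _ (YV _ dY) bc cd.
    by have /fintype.subsetP/(_ _ cX)/finset.setDP[] := s2 X Xp.
  - exact: NC_cross h2 Xp Yp XY aX cX bY dY ab bc cd.
have cl : closed_under (p1 :|: p2) V.
  apply/(closedP un VS) => X x /finset.setUP[/s1 //|Xp] xX xV.
  by case: (dis X x Xp xX).
split=> //; apply/finset.setP => X; apply/idP/idP.
- move=> /restrP[/finset.setUP[//|Xp] /fintype.subsetP XV].
  have [/finset.set0Pn[x xX] _] := NC_block h2 Xp.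
  by case: (dis X x Xp xX); apply: XV.
- by move=> Xp; apply/restrP; rewrite finset.inE Xp; split=> //; apply: s1.
- move=> /restrP[/finset.setUP[Xp|//] /fintype.subsetP XW].
  have [/finset.set0Pn[x xX] _] := NC_block h1 Xp.
  have /finset.setDP[_ /negP] := XW x xX; case.
  exact: (fintype.subsetP (s1 X Xp)).
- by move=> Xp; apply/restrP; rewrite finset.inE Xp orbT; split=> //; apply: s2.
Qed.

Lemma NC_join pi S V : pi \in NC S -> V \subset S -> closed_under pi V ->
  restr pi V :|: restr pi (S :\: V) = pi.
Proof.
move=> piS VS cV; apply/finset.setP => X; apply/finset.setUP/idP.
  by case=> /restrP[].
move=> Xp; have [/finset.set0Pn[x xX] /fintype.subsetP XS] := NC_block piS Xp.
case: (boolP (x \in V)) => xV; [left|right]; apply/restrP; split=> //.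
  exact: (proj1 (closedP piS VS) cV X x).
have cW := closedC piS VS cV.
apply: (proj1 (closedP piS (finset.subsetDl _ _)) cW X x) => //.
by apply/finset.setDP; split=> //; apply: XS.
Qed.

Lemma big_NC_split (B : zmodType) S V (f : {set {set 'I_n}} -> {set {set 'I_n}} -> B) :
  V \subset S -> chi_interval chi S V ->
  \sum_(pi in NC S | closed_under pi V) f (restr pi V) (restr pi (S :\: V)) =
  \sum_(p1 in NC V) \sum_(p2 in NC (S :\: V)) f p1 p2.
Proof.
move=> VS int; rewrite pair_big /=.
rewrite (reindex_onto (fun p : {set {set 'I_n}} * {set {set 'I_n}} => p.1 :|: p.2)
  (fun pi => (restr pi V, restr pi (S :\: V)))) /=; last first.
  by move=> pi /andP[piS cV]; apply: NC_join.
have H p1 p2 : (p1 :|: p2 \in NC S) && closed_under (p1 :|: p2) V &&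
    ((restr (p1 :|: p2) V, restr (p1 :|: p2) (S :\: V)) == (p1, p2)) =
    (p1 \in NC V) && (p2 \in NC (S :\: V)).
  apply/idP/idP.
    move=> /andP[/andP[pS cV] /eqP[e1 e2]]; apply/andP; split.
      by rewrite -e1; apply: NC_restr pS VS cV.
    by rewrite -e2; apply: (NC_restr pS (finset.subsetDl _ _)); apply: (closedC pS VS cV).
  move=> /andP[h1 h2]; have [e1 e2 e3 e4] := NC_union VS int h1 h2.
  by rewrite e1 e2 e3 e4 eqxx.
under eq_bigl => p do rewrite H.
apply: eq_bigr => -[p1 p2] /= /andP[h1 h2].
by have [_ _ -> ->] := NC_union VS int h1 h2.
Qed.

End ChiOrder.

Lemma sub_morph_sum (U V : zmodType) (f : U -> V) (J : Type) (r : seq J) (P : pred J)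
    (G : J -> U) : (forall a b, f (a - b) = f a - f b) ->
  f (\sum_(i <- r | P i) G i) = \sum_(i <- r | P i) f (G i).
Proof.
move=> fB; have f0 : f 0 = 0 by rewrite -(subrr 0) fB !subrr.
have fN b : f (- b) = - f b by have := fB 0 b; rewrite f0 !sub0r.
apply: (big_morph f _ f0) => a b.
by rewrite -[in LHS](opprK b) fB fN opprK.
Qed.

Lemma vanish_openb (B : pzRingType) (T : eqType) (q : T -> seq (B * T) -> B) N x acc g w :
  (forall e, subseq (unzip2 e) (unzip2 w) -> q x (acc ++ e) = 0) ->
  openb q N x acc g w = 0.
Proof.
elim: w acc g => [|[b y] w IH] acc g q0 /=.
  by have := q0 [::] isT; rewrite cats0 => ->; rewrite mul0r.
rewrite !IH ?addr0 // => e es; last rewrite cat_rcons; apply: q0; last by rewrite /= eqxx.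
exact: subseq_trans es (subseq_cons _ _).
Qed.

(** * Moments as sums over non-crossing partitions *)

Section PartitionSums.

Context (n : nat) (chi : 'I_n -> bool) (B : pzRingType).
Implicit Types (a b c d : 'I_n) (X Y V W S : {set 'I_n}) (pi : {set {set 'I_n}}).
Implicit Types (w acc g h : seq (B * 'I_n)).
Local Notation lt := (chi_lt chi).
Local Notation NC := (NC chi).
Context (q : 'I_n -> seq (B * 'I_n) -> B) (qA : kadd q).

Definition letters w : {set 'I_n} := [set y in unzip2 w].

(** Allowing only the blocks of [pi] makes [mom (qpart q pi)] the single term of the moment-cumulant
    sum that belongs to [pi]. *)
Definition qpart pi (x : 'I_n) acc : B :=
  if x |: letters acc \in pi then q x acc else 0.

Lemma qpart_add pi : kadd (qpart pi).
Proof.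
move=> x u e e' y v; rewrite /qpart.
have -> : letters (u ++ (e - e', y) :: v) = letters (u ++ (e, y) :: v).
  by apply/setP => z; rewrite !inE /unzip2 !map_cat.
have -> : letters (u ++ (e', y) :: v) = letters (u ++ (e, y) :: v).
  by apply/setP => z; rewrite !inE /unzip2 !map_cat.
by case: ifP; rewrite ?subr0.
Qed.

Lemma qpart_restr pi V x acc : x \in V -> {subset unzip2 acc <= V} ->
  qpart pi x acc = qpart (restr pi V) x acc.
Proof.
move=> xV sV; rewrite /qpart.
suff -> : (x |: letters acc \in restr pi V) = (x |: letters acc \in pi) by [].
rewrite [LHS]inE andb_idr // => _; apply/subsetP => y; rewrite !inE => /orP[/eqP->//|].
exact: sV.
Qed.

Lemma mom_restr pi V w : {subset unzip2 w <= V} ->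
  mom (qpart pi) w = mom (qpart (restr pi V)) w.
Proof.
move=> sw; apply: (@mom_uniq _ _ (fun=> True) (fun s => {subset s <= V})
  (qpart pi) (qpart (restr pi V))) => //.
- by move=> s s' ss sV y ys; apply/sV/(mem_subseq ss).
- exact: mom_is_mom.
- exact: mom_is_mom.
- move=> x e xe _; apply: qpart_restr; first by apply: xe; rewrite inE eqxx.
  by move=> y ye; apply: xe; rewrite inE ye orbT.
- exact: coefs_inT.
Qed.

Lemma openb_restr pi V x acc w :
  x \in V -> {subset unzip2 acc <= V} -> {subset unzip2 w <= V} ->
  openb (qpart pi) (mom (qpart pi)) x acc (mom (qpart pi)) w =
  openb (qpart (restr pi V)) (mom (qpart (restr pi V))) x acc
    (mom (qpart (restr pi V))) w.
Proof.
move=> xV aV wV; apply: (openb_ext (@submonoidT _)) => //; last exact: coefs_inT.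
- move=> h hs _; split=> //; apply: mom_restr => y yh; exact/wV/(mem_subseq hs).
- move=> h hs _; split=> //; apply: mom_restr => y yh; exact/wV/(mem_subseq hs).
- move=> e es _; apply: qpart_restr => // y; rewrite /unzip2 map_cat mem_cat.
  by move=> /orP[/aV//|ye]; apply/wV/(mem_subseq es).
Qed.

Context (N : seq (B * 'I_n) -> B) (Nq : is_mom (@everything _) q N).

(* The gap [V] between the open block of [x] and the letter that joins it is a
   union of blocks of any non-crossing partition. *)
Lemma gap_closed pi S x acc g w e : pi \in NC S ->
  pairwise lt (x :: unzip2 acc ++ unzip2 g ++ unzip2 w) ->
  S = x |: letters acc :|: letters g :|: letters w ->
  subseq (unzip2 e) (unzip2 w) ->
  match w with [::] => True | (_, y) :: _ => y \in unzip2 e end ->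
  x |: letters (acc ++ e) \in pi -> closed_under pi (letters g).
Proof.
move=> piS pw eS es hy Xp.
have gS : letters g \subset S.
  by rewrite eS; apply/subsetP => z; rewrite !inE => ->; rewrite ?orbT.
move: pw => /= /andP[xlt]; rewrite pairwise_cat allrel_catr => /and3P[/andP[ag aw] _].
rewrite pairwise_cat => /and3P[gw _ ww].
apply/(closedP piS gS) => Y z Yp zY zg; apply/subsetP => t tY.
apply/negPn/negP => tg.
have [_ /subsetP YS] := NC_block piS Yp.
set X := x |: letters (acc ++ e) in Xp.
have zlt : lt x z.
  by apply: (allP xlt); rewrite !mem_cat; move: zg; rewrite inE => ->; rewrite orbT.
have znX : z \notin X.
  rewrite !inE /unzip2 map_cat mem_cat !negb_or; apply/and3P; split.
  - by apply/eqP => zx; move: zlt; rewrite zx lt_irr.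
  - apply/negP => za; move: zg; rewrite inE => zg.
    by have := allrelP ag z z za zg; rewrite lt_irr.
  - apply/negP => ze; move: zg; rewrite inE => zg.
    by have := allrelP gw z z zg (mem_subseq es ze); rewrite lt_irr.
have XY : X != Y by apply: contraNneq znX => ->.
have tnX : t \notin X.
  by apply: contraNN XY => tX; apply/eqP; apply: (NC_inj piS Xp Yp tX tY).
have tw : t \in unzip2 w.
  move: (YS t tY) tnX tg; rewrite eS !inE /unzip2 map_cat mem_cat !negb_or.
  by case: (t == x) => //=; case: (t \in map _ acc) => //=; case: (t \in map _ g).
case: w gw ww es hy xlt aw eS tw => [//|[b y] w] /= gw /andP[yw _] es hy xlt aw eS tw.
have yX : y \in X by rewrite !inE /unzip2 map_cat mem_cat hy !orbT.
have ty : t \in unzip2 w.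
  move: tw; rewrite inE => /orP[/eqP ty|//]; move: tnX; by rewrite ty yX.
have zy : lt z y by apply: (allrelP gw); [move: zg; rewrite inE|rewrite inE eqxx].
have yt : lt y t by apply: (allP yw).
have xX : x \in X by rewrite !inE eqxx.
exact: (NC_cross piS Xp Yp XY xX yX zY tY zlt zy yt).
Qed.

Lemma gap_interval S x acc g w :
  pairwise lt (x :: unzip2 acc ++ unzip2 g ++ unzip2 w) ->
  S = x |: letters acc :|: letters g :|: letters w ->
  chi_interval chi S (letters g).
Proof.
move=> /= /andP[xlt]; rewrite pairwise_cat allrel_catr => /and3P[/andP[ag aw] _].
rewrite pairwise_cat => /and3P[gw _ ww] ->; apply/andP; split.
  by apply/subsetP => z; rewrite !inE => ->; rewrite ?orbT.
apply/'forall_implyP => a ag'; apply/'forall_implyP => b bS.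
apply/'forall_implyP => c cg; apply/implyP => /andP[ab bc].
move: bS ag' cg; rewrite !inE -!orbA => /or4P[/eqP bx|ba|//|bw] ag' cg; first rewrite bx in ab.
- move=> {bc}; have := allP xlt a; rewrite !mem_cat ag' orbT => /(_ isT) xa.
  by case: (lt_asym ab xa).
- by case: (lt_asym ab (allrelP ag b a ba ag')).
- by case: (lt_asym bc (allrelP gw c b cg bw)).
Qed.

Lemma NC0 : NC set0 = [set set0].
Proof.
apply/setP => pi; rewrite !inE; apply/andP/eqP => [[h _]|->].
  apply/setP => X; rewrite inE; apply/negP => Xp.
  have /partition_iff[h1 _ _] := h.
  have [/set0Pn[x xX] /subsetP/(_ x xX)] := h1 X Xp.
  by rewrite inE.
split; first by apply/partition_iff; split=> [X|x|X Y x]; rewrite inE.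
by apply/ncP => X Y a b c d; rewrite inE.
Qed.

Lemma NC_top S pi : S != set0 -> S \in pi -> pi \in NC S -> pi = [set S].
Proof.
move=> S0 Sp piS; apply/setP => X; rewrite inE; apply/idP/eqP => [Xp|-> //].
have [/set0Pn[x xX] /subsetP XS] := NC_block piS Xp.
exact: NC_inj piS Xp Sp xX (XS x xX).
Qed.

Lemma top_NC S : S != set0 -> [set S] \in NC S.
Proof.
move=> S0; apply/NC_iff; split.
  apply/partition_iff; split=> [X|x xS|X Y x].
  - by rewrite inE => /eqP->.
  - by exists S; rewrite ?inE.
  - by rewrite !inE => /eqP-> /eqP->.
by apply/ncP => X Y a b c d; rewrite !inE => /eqP-> /eqP->; rewrite eqxx.
Qed.

Let Np pi := mom (qpart pi).

(** When the block takes its next letter, or the word ends, the gap just closed is an interval.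
    Partitions for which it is not a union of blocks contribute zero; the others split into a
    partition of the gap and one of the rest, and the sum over the former rebuilds the gap
    moment. *)
Lemma open_partition m x acc g w :
  (forall h, (size h <= m)%N -> pairwise lt (unzip2 h) ->
     N h = \sum_(pi in NC (letters h)) Np pi h) ->
  (size g + size w <= m)%N ->
  pairwise lt (x :: unzip2 acc ++ unzip2 g ++ unzip2 w) ->
  openb q N x acc (fun h => N (g ++ h)) w =
  \sum_(pi in NC (x |: letters acc :|: letters g :|: letters w))
     openb (qpart pi) (Np pi) x acc (fun h => Np pi (g ++ h)) w.
Proof.
move=> IH; have [k] := ubnP (size w); elim: k w acc g => // k IHw w acc g ltk le pw.
set S := _ :|: letters _.
have eS : S = x |: letters acc :|: letters g :|: letters w by [].
have int := gap_interval pw eS.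
have gS : letters g \subset S by case/andP: int.
have pg : pairwise lt (unzip2 g).
  move: pw => /= /andP[_]; rewrite pairwise_cat => /and3P[_ _].
  by rewrite pairwise_cat => /and3P[].
have Ng : N (g ++ [::]) = \sum_(pi in NC (letters g)) Np pi g.
  by rewrite cats0 IH // (leq_trans _ le) // leq_addr.
have uW : S :\: letters g = x |: letters acc :|: letters w.
  apply/setP => z; rewrite !inE; apply/andP/orP => [[zg]|].
    rewrite (negPf zg) orbF => /orP[/orP[->|->]|->]; by [left|left; rewrite orbT|right].
  move: pw => /= /andP[xlt]; rewrite pairwise_cat allrel_catr => /and3P[/andP[ag aw] _].
  rewrite pairwise_cat => /and3P[gw _ ww] zz; split.
    apply/negP => zg; case: zz => [/orP[/eqP zx|za]|zw].
    - have := allP xlt z; rewrite !mem_cat zg orbT => /(_ isT).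
      by rewrite zx lt_irr.
    - by have := allrelP ag z z za zg; rewrite lt_irr.
    - by have := allrelP gw z z zg zw; rewrite lt_irr.
  by case: zz => [/orP[->|->]|->]; rewrite ?orbT.
have sumV f : (forall pi, pi \in NC S -> ~~ closed_under pi (letters g) ->
     f (Np pi g) pi = 0 :> B) ->
   (forall pi, pi \in NC S -> closed_under pi (letters g) ->
     f (Np pi g) pi = f (Np (restr pi (letters g)) g) (restr pi (S :\: letters g))) ->
   \sum_(pi in NC S) f (Np pi g) pi =
   \sum_(p1 in NC (letters g)) \sum_(p2 in NC (S :\: letters g)) f (Np p1 g) p2.
  move=> h0 h1; rewrite -(big_NC_split (fun p1 p2 => f (Np p1 g) p2) gS int).
  rewrite (bigID (fun pi => closed_under pi (letters g))) /= [X in _ + X]big1 ?addr0.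
    by apply: eq_bigr => pi /andP[piS cV]; apply: h1.
  by move=> pi /andP[piS cV]; apply: h0.
have Npr pi : Np pi g = Np (restr pi (letters g)) g.
  by apply: mom_restr => z; rewrite inE.
case: w IHw ltk le pw @S eS int gS uW sumV => [|[b y] w] IHw ltk le pw S eS int gS uW sumV /=.
  rewrite Ng cats0 (sumV (fun e pi => qpart pi x acc * e)).
  - rewrite mulr_sumr; apply: eq_bigr => p1 _; rewrite -mulr_suml; congr (_ * _).
    have eW : S :\: letters g = x |: letters acc.
      by rewrite uW; apply/setP => z; rewrite !inE orbF.
    have W0 : S :\: letters g != set0.
      by rewrite eW; apply/set0Pn; exists x; rewrite !inE eqxx.
    rewrite (bigD1 [set S :\: letters g]) ?top_NC //= big1 ?addr0.
      by rewrite /qpart eW !inE eqxx.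
    move=> p2 /andP[p2S ne]; rewrite /qpart -eW; case: ifP => // Wp.
    by rewrite (NC_top W0 Wp p2S) eqxx in ne.
  - move=> pi piS ncl; rewrite /qpart; case: ifP; last by rewrite mul0r.
    move=> Xp; case/negP: ncl; apply: (gap_closed (e := [::]) piS pw eS) => //.
    by rewrite cats0.
  - move=> pi piS cl; rewrite -Npr; congr (_ * _); apply: qpart_restr.
      by rewrite uW !inE eqxx.
    by move=> z za; rewrite uW !inE za orbT.
rewrite big_split /=; congr (_ + _).
  rewrite Ng cats0.
  rewrite (sumV (fun e pi => openb (qpart pi) (Np pi) x (rcons acc (e * b, y)) (Np pi) w)).
  (* By additivity of the kernel, the sum over the partitions of the gap moves into the coefficient
     of [y], where it becomes [N g]. *)
  - have E p2 : \sum_(p1 in NC (letters g))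
        openb (qpart p2) (Np p2) x (rcons acc (Np p1 g * b, y)) (Np p2) w =
      openb (qpart p2) (Np p2) x (rcons acc (N g * b, y)) (Np p2) w.
      rewrite -(cats0 g) Ng cats0; symmetry.
      apply: (sub_morph_sum (f := fun e =>
        openb (qpart p2) (Np p2) x (rcons acc (e * b, y)) (Np p2) w)) => e e'.
      by rewrite mulrBl -!cats1 openb_add_acc //; apply: qpart_add.
    rewrite exchange_big /=; under [RHS]eq_bigr => p2 _ do rewrite E.
    rewrite -Ng cats0 (IHw _ _ [::]) //=; last 2 first.
    + by move: le => /=; lia.
    + move: pw => /=; rewrite /unzip2 map_rcons cat_rcons => /andP[xlt].
      rewrite !all_cat /= in xlt *; move: xlt => /and3P[-> _ ->].
      rewrite !pairwise_cat !allrel_catr => /and3P[/andP[_ ->] -> /and3P[_ _ ->]] //.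
    apply: eq_bigl => p2; congr (p2 \in NC _); rewrite uW.
    apply/setP => z; rewrite !inE /unzip2 map_rcons mem_rcons inE /=.
    by case: (z == x); case: (z == y); case: (z \in map _ acc); case: (z \in map _ w).
  - move=> pi piS ncl; apply: vanish_openb => e es; rewrite cat_rcons /qpart.
    case: ifP => // Xp; case/negP: ncl.
    apply: (gap_closed (e := (Np pi g * b, y) :: e) piS pw eS) => //=; first by rewrite eqxx.
    by rewrite inE eqxx.
  - move=> pi piS cl; rewrite -Npr; apply: openb_restr.
    + by rewrite uW !inE eqxx.
    + move=> z; rewrite uW /unzip2 map_rcons mem_rcons !inE.
      by case/orP => [->|->]; rewrite ?orbT.
    + by move=> z zw; rewrite uW !inE zw !orbT.
have E h : N (g ++ (b, y) :: h) = N (rcons g (b, y) ++ h) by rewrite cat_rcons.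
rewrite (openb_eq _ _ _ _ _ E) IHw //; last 2 first.
- by move: le; rewrite size_rcons /=; lia.
- by rewrite /unzip2 map_rcons cat_rcons.
have -> : x |: letters acc :|: letters (rcons g (b, y)) :|: letters w = S.
  apply/setP => z; rewrite !inE /unzip2 map_rcons mem_rcons inE /=.
  by case: (z == x); case: (z == y); case: (z \in map _ acc); case: (z \in map _ g).
by apply: eq_bigr => pi _; apply: openb_eq => h; rewrite cat_rcons.
Qed.

(** Links the recursion on the first block with sums over whole partitions, the form to which
    Moebius inversion applies. *)
Theorem mom_partitions w : pairwise lt (unzip2 w) ->
  N w = \sum_(pi in NC (letters w)) Np pi w.
Proof.
have [m] := ubnP (size w); elim: m w => // m IH [|[b x] w] ltm pw.
  have -> : letters [::] = set0 by apply/setP => z; rewrite !inE.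
  by rewrite NC0 big_set1 (proj1 Nq).
have IH' h : (size h <= size w)%N -> pairwise lt (unzip2 h) ->
     N h = \sum_(pi in NC (letters h)) Np pi h.
  by move=> le ph; apply: IH => //; move: ltm => /=; lia.
rewrite (proj2 Nq) // (open_partition (m := size w) (g := [::]) IH') //.
rewrite mulr_sumr; have -> : x |: letters [::] :|: letters [::] :|: letters w =
    letters ((b, x) :: w).
  by apply/setP => z; rewrite !inE !orbF.
by apply: eq_bigr => pi _; rewrite [RHS](proj2 (mom_is_mom (@everything _) (qpart pi))).
Qed.

End PartitionSums.

(** * Removing an interval from a partial moment *)

Section ScalarWords.

Context (B : pzRingType) (T : eqType).
Implicit Types (s t : seq T) (c : T -> B) (d : B) (N : seq (B * T) -> B).

(* The word in the letters [s] with the scalar [c k] after each letter [k];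
   the last scalar is [pend d s c]. *)
Fixpoint wdp d s c : seq (B * T) :=
  if s is k :: s' then (d, k) :: wdp (c k) s' c else [::].

Fixpoint pend d s c : B := if s is k :: s' then pend (c k) s' c else d.

Definition word_val N s c : B := N (wdp 1 s c) * pend 1 s c.

Lemma unzip2_wdp d s c : unzip2 (wdp d s c) = s.
Proof. by elim: s d => //= k s IH d; rewrite IH. Qed.

Lemma wdp_cat d s t c : wdp d (s ++ t) c = wdp d s c ++ wdp (pend d s c) t c.
Proof. by elim: s d => //= k s IH d; rewrite IH. Qed.

Lemma pend_cat d s t c : pend d (s ++ t) c = pend (pend d s c) t c.
Proof. by elim: s d => //= k s IH d; rewrite IH. Qed.

Lemma wdp_ext d s c c' : {in s, c =1 c'} -> wdp d s c = wdp d s c'.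
Proof.
elim: s d => //= k s IH d h; rewrite h ?inE ?eqxx // IH // => y ys.
by apply: h; rewrite inE ys orbT.
Qed.

Lemma pend_ext d s c c' : {in s, c =1 c'} -> pend d s c = pend d s c'.
Proof.
elim: s d => //= k s IH d h; rewrite h ?inE ?eqxx // IH // => y ys.
by apply: h; rewrite inE ys orbT.
Qed.

Lemma pend_const d d' s c : s != [::] -> pend d s c = pend d' s c.
Proof. by case: s. Qed.

Definition upd c k d : T -> B := fun k' => if k' == k then c k * d else c k'.

Context (q : T -> seq (B * T) -> B) (N : seq (B * T) -> B).
Context (Nq : is_mom (@everything T) q N).

Lemma mom_wdp d s c : s != [::] -> N (wdp d s c) = d * N (wdp 1 s c).
Proof. by case: s => // k s _; rewrite /= !(proj2 Nq) // mul1r. Qed.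

Lemma word_val_pend d s c : N (wdp d s c) * pend d s c = d * word_val N s c.
Proof.
case: (eqVneq s [::]) => [->|s0]; first by rewrite /word_val /= (proj1 Nq) !mulr1 mul1r.
by rewrite mom_wdp // -mulrA (pend_const d 1).
Qed.

Context (p : pred T) (sep : forall x acc, has p (x :: unzip2 acc) ->
  has (predC p) (x :: unzip2 acc) -> q x acc = 0).
Context (v : seq T) (c : T -> B) (v0 : v != [::]) (pv : all p v).

(** This and the next two lemmas match the three clauses of the recursive definition of moments: [p]
    selects the interval that is removed, and its value multiplies on the left, on the right, or
    goes in after the preceding letter [k]. *)
Lemma word_val_initial s : all (predC p) s -> word_val N (v ++ s) c = word_val N v c * word_val N s c.
Proof.
move=> ps; rewrite {1}/word_val wdp_cat pend_cat.
have := mom_split (w1 := [::]) (v := wdp 1 v c) (w2 := wdp (pend 1 v c) s c) Nq sep isT.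
rewrite !unzip2_wdp /= => -> //; rewrite (sc_mom _ _ Nq) -mulrA word_val_pend.
by rewrite mulrA.
Qed.

Lemma word_val_terminal s : all (predC p) s -> word_val N (s ++ v) c = word_val N s c * word_val N v c.
Proof.
move=> ps; rewrite {1}/word_val wdp_cat pend_cat.
have := mom_split (w1 := wdp 1 s c) (v := wdp (pend 1 s c) v c) (w2 := [::]) Nq sep.
by rewrite !unzip2_wdp !cats0 /= => -> //; rewrite cats0 -mulrA word_val_pend mulrA.
Qed.

Lemma word_val_middle s k t : all (predC p) (rcons s k) -> all (predC p) t ->
  t != [::] -> uniq (rcons s k ++ t) ->
  word_val N (rcons s k ++ v ++ t) c = word_val N (rcons s k ++ t) (upd c k (word_val N v c)).
Proof.
move=> ps pt t0 u; rewrite {1}/word_val [in LHS]wdp_cat wdp_cat pend_cat.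
have := mom_split (w1 := wdp 1 (rcons s k) c) (v := wdp (pend 1 (rcons s k) c) v c)
  (w2 := wdp (pend (pend 1 (rcons s k) c) v c) t c) Nq sep.
rewrite !unzip2_wdp => -> //.
set c' := upd _ _ _.
have uk x : x \in s -> x != k.
  move: u; rewrite cat_uniq rcons_uniq => /andP[/andP[/negP ks _] _] xs.
  by apply/eqP => e; apply: ks; rewrite -e.
have ut x : x \in t -> x != k.
  move: u; rewrite cat_uniq => /and3P[_ /hasPn h _] /h.
  by rewrite mem_rcons inE; case: eqP.
have cs : {in s, c =1 c'} by move=> x /uk /negPf xk; rewrite /c' /upd xk.
have ct : {in t, c =1 c'} by move=> x /ut /negPf xk; rewrite /c' /upd xk.
have -> : wdp 1 (rcons s k) c = wdp 1 (rcons s k) c'.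
  by rewrite -!cats1 !wdp_cat (wdp_ext _ cs) (pend_ext _ cs).
have pk (f : T -> B) : pend 1 (rcons s k) f = f k by rewrite -cats1 pend_cat.
rewrite pk mom_wdp // (pend_const _ 1 _ v0) pend_cat.
rewrite /word_val wdp_cat pend_cat pk (pend_ext _ ct) (wdp_ext _ ct).
rewrite (pend_const _ 1 c' t0) [in RHS](pend_const _ 1 c' t0); congr (_ * _).
have -> : c' k = c k * N (wdp 1 v c) * pend 1 v c.
  by rewrite /c' /upd eqxx /word_val mulrA.
by case: (t) t0.
Qed.

End ScalarWords.

Section Subsequences.

Context (n : nat) (chi : 'I_n -> bool).
Implicit Types (a b k : 'I_n) (S V : {set 'I_n}) (pi : {set {set 'I_n}}).
Local Notation lt := (chi_lt chi).

Definition seqS S : seq 'I_n := [seq k <- chi_seq chi | k \in S].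

Lemma mem_seqS S k : (k \in seqS S) = (k \in S).
Proof. by rewrite mem_filter mem_chi_seq andbT. Qed.

Lemma seqS_pairwise S : pairwise lt (seqS S).
Proof. exact: pairwise_filter (chi_seq_pairwise chi). Qed.

Lemma seqS_uniq S : uniq (seqS S).
Proof. exact: filter_uniq (chi_seq_uniq chi). Qed.

Lemma seqS0 S : (seqS S == [::]) = (S == set0).
Proof.
apply/eqP/eqP => [e|->]; first by apply/setP => k; rewrite -mem_seqS e !inE.
by rewrite /seqS (eq_filter (a2 := pred0)) ?filter_pred0 // => k; rewrite inE.
Qed.

Lemma pairwise_lt_eq s t : pairwise lt s -> pairwise lt t -> s =i t -> s = t.
Proof.
move=> /pairwise_sorted ps /pairwise_sorted pt; apply: irr_sorted_eq ps pt.
  exact: lt_trans.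
by move=> a; apply: lt_irr.
Qed.

Definition before S V : {set 'I_n} := [set k in S :\: V | [forall a in V, lt k a]].
Definition after S V : {set 'I_n} := [set k in S :\: V | [forall a in V, lt a k]].

Context (S V : {set 'I_n}) (VS : V \subset S) (V0 : V != set0).
Context (int : chi_interval chi S V).

Lemma before_or_after k : k \in S :\: V -> (k \in before S V) || (k \in after S V).
Proof.
move=> kW; have /setDP[kS kV] := kW.
have [a aV] := set0Pn _ V0.
have intP a' b c : a' \in V -> b \in S -> c \in V -> lt a' b -> lt b c -> b \in V.
  move=> a'V bS cV ab bc; have /andP[_ /'forall_implyP i] := int.
  have /'forall_implyP/(_ b bS)/'forall_implyP/(_ c cV) := i a' a'V.
  by rewrite ab bc.
have ne a' : a' \in V -> k != a' by apply: contraTneq => <-.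
have [ka|ak] := orP (lt_total chi (ne a aV)); apply/orP; [left|right].
  rewrite inE kW; apply/'forall_implyP => a' a'V.
  have [//|a'k] := orP (lt_total chi (ne a' a'V)).
  by case/negP: kV; apply: intP a'k ka.
rewrite inE kW; apply/'forall_implyP => a' a'V.
have [ka'|//] := orP (lt_total chi (ne a' a'V)).
by case/negP: kV; apply: intP ak ka'.
Qed.

Lemma before_lt k a : k \in before S V -> a \in V -> lt k a.
Proof. by rewrite inE => /andP[_ /'forall_implyP h] /h. Qed.

Lemma after_lt k a : k \in after S V -> a \in V -> lt a k.
Proof. by rewrite inE => /andP[_ /'forall_implyP h] /h. Qed.

Lemma before_D k : k \in before S V -> k \in S :\: V.
Proof. by rewrite inE => /andP[]. Qed.

Lemma after_D k : k \in after S V -> k \in S :\: V.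
Proof. by rewrite inE => /andP[]. Qed.

Lemma seqS_split :
  seqS S = seqS (before S V) ++ seqS V ++ seqS (after S V).
Proof.
have [a aV] := set0Pn _ V0.
apply: pairwise_lt_eq; first exact: seqS_pairwise.
  rewrite !pairwise_cat !seqS_pairwise allrel_catr !andbT /=; apply/andP; split.
  - apply/andP; split; apply/allrelP => x y; rewrite !mem_seqS => hx hy.
      exact: before_lt.
    exact: lt_trans (before_lt hx aV) (after_lt hy aV).
  - by apply/allrelP => x y; rewrite !mem_seqS => hx hy; apply: after_lt.
move=> k; rewrite !mem_cat !mem_seqS; apply/idP/or3P.
  move=> kS; case: (boolP (k \in V)) => kV; first by constructor 2.
  have /orP[] : (k \in before S V) || (k \in after S V).
    by apply: before_or_after; apply/setDP.
    by constructor 1.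
  by constructor 3.
by case=> [/before_D/setDP[]//|/(subsetP VS)//|/after_D/setDP[]].
Qed.

Lemma seqS_compl :
  seqS (S :\: V) = seqS (before S V) ++ seqS (after S V).
Proof.
have [a aV] := set0Pn _ V0.
apply: pairwise_lt_eq; first exact: seqS_pairwise.
  rewrite !pairwise_cat !seqS_pairwise !andbT; apply/allrelP => x y.
  by rewrite !mem_seqS => hx hy; apply: lt_trans (before_lt hx aV) (after_lt hy aV).
move=> k; rewrite !mem_cat !mem_seqS; apply/idP/orP => [/before_or_after/orP//|].
by case=> [/before_D|/after_D].
Qed.

Lemma initial_before : chi_initial chi S V = (seqS (before S V) == [::]).
Proof.
have [a aV] := set0Pn _ V0.
rewrite seqS0; apply/'forall_implyP/eqP => [h|h a' a'V].
  apply/setP => k; rewrite [in RHS]inE; apply/negP => kb.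
  have kW := before_D kb; have /'forall_implyP/(_ k kW) := h a aV.
  exact: lt_asym (before_lt kb aV).
apply/'forall_implyP => b /before_or_after; rewrite h in_set0 /= => hb.
exact: after_lt.
Qed.

Lemma terminal_after : chi_terminal chi S V = (seqS (after S V) == [::]).
Proof.
have [a aV] := set0Pn _ V0.
rewrite seqS0; apply/'forall_implyP/eqP => [h|h a' a'V].
  apply/setP => k; rewrite [in RHS]inE; apply/negP => kb.
  have kW := after_D kb; have /'forall_implyP/(_ k kW) := h a aV.
  move=> ka; exact: lt_asym ka (after_lt kb aV).
apply/'forall_implyP => b /before_or_after; rewrite h in_set0 orbF => hb.
exact: before_lt.
Qed.

Lemma pred_last s k : seqS (before S V) = rcons s k ->
  forall p, chi_pred chi S V p = (p == k).
Proof.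
move=> e p.
have pw : pairwise lt (rcons s k) by rewrite -e seqS_pairwise.
have kb : k \in before S V by rewrite -mem_seqS e mem_rcons inE eqxx.
apply/and3P/eqP => [[pW pb /'forall_implyP h]|->].
  have pB : p \in before S V by rewrite inE pW.
  have : p \in rcons s k by rewrite -e mem_seqS.
  rewrite mem_rcons inE => /orP[/eqP//|ps].
  have := h k (before_D kb); have -> : [forall a in V, lt k a].
    by apply/'forall_implyP => a; apply: before_lt.
  move=> /= /negP []; move: pw; rewrite pairwise_rcons => /andP[/allP h' _].
  exact: h'.
split; first exact: before_D.
  by apply/'forall_implyP => a; apply: before_lt.
apply/'forall_implyP => r rW; apply/implyP => rb; apply/negP => kr.
have : r \in rcons s k by rewrite -e mem_seqS inE rW.
rewrite mem_rcons inE => /orP[/eqP rk|rs]; first by rewrite rk lt_irr in kr.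
move: pw; rewrite pairwise_rcons => /andP[/allP h _].
exact: lt_asym kr (h r rs).
Qed.

End Subsequences.

(** Take the block [X] of the first element and some [e] outside it; [V] is the gap of [X] that
    contains [e]. A block leaving this gap would cross [X], since [X] contains the first element. *)
Lemma NC_splits n (chi : 'I_n -> bool) S sigma : S != set0 -> sigma \in NC chi S ->
  sigma != [set S] -> exists V, splits chi S sigma V.
Proof.
move=> S0 sS ne; have : seqS chi S != [::] by rewrite seqS0.
case es: (seqS chi S) => [//|f s] _.
have fS : f \in S by rewrite -(mem_seqS chi) es inE eqxx.
have fmin x : x \in S -> x != f -> chi_lt chi f x.
  move=> xS xf; have := seqS_pairwise chi S; rewrite es /= => /andP[/allP h _].
  apply: h; have : x \in f :: s by rewrite -es mem_seqS.
  by rewrite inE (negPf xf).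
have [X Xp fX] := NC_cover sS fS.
have [_ /subsetP XS] := NC_block sS Xp.
have [e /setDP[eS eX]] : exists e, e \in S :\: X.
  apply/set0Pn; rewrite setD_eq0; apply: contra ne => SX; apply/eqP.
  have XS' : X = S by apply/eqP; rewrite eqEsubset SX andbT; apply/subsetP.
  by apply: NC_top sS => //; rewrite -XS'.
pose V := [set y in S :\: X | [forall x in X, chi_lt chi x y == chi_lt chi x e]].
have VP y : y \in V <-> [/\ y \in S, y \notin X &
    forall x, x \in X -> chi_lt chi x y = chi_lt chi x e].
  rewrite !inE; split=> [/andP[/andP[yX yS] /'forall_implyP h]|[-> -> h]].
    by split=> // x /h/eqP.
  by apply/'forall_implyP => x /h->.
have eV : e \in V by apply/VP.
have VS : V \subset S by apply/subsetP => y /VP[].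
have fV : f \notin V by apply/negP => /VP[_]; rewrite fX.
exists V; apply/and4P; split.
- by apply/set0Pn; exists e.
- by apply/properP; split=> //; exists f.
- apply/andP; split=> //.
  apply/'forall_implyP => a /VP[aS aX ha]; apply/'forall_implyP => b bS.
  apply/'forall_implyP => c /VP[cS cX hc]; apply/implyP => /andP[ab bc].
  apply/VP; split=> // [|x xX].
    apply/negP => bX; have := hc b bX; rewrite bc -(ha b bX) => ba.
    exact: lt_asym ab (esym ba).
  apply/idP/idP => [xb|xe]; first by rewrite -(hc x xX); apply: lt_trans xb bc.
  by rewrite -(ha x xX) in xe; apply: lt_trans xe ab.
- apply/(closedP sS VS) => Y z Yp zY /VP[zS zX hz]; apply/subsetP => t tY.
  have [_ /subsetP YS] := NC_block sS Yp.
  have XY : X != Y by apply: contraNneq zX => ->.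
  have tX : t \notin X by apply: contraNN XY => tX; apply/eqP; apply: NC_inj sS Xp Yp tX tY.
  apply/VP; split=> //; first exact: YS.
  move=> x xX; rewrite -hz //.
  have xt : x != t by apply: contraNneq tX => <-.
  have xz : x != z by apply: contraNneq zX => <-.
  apply/idP/idP => h; apply/negPn/negP => h'.
    have zx : chi_lt chi z x by have := lt_total chi xz; rewrite (negPf h').
    apply: (NC_cross sS Xp Yp XY fX xX zY tY) => //; apply: fmin => //.
    by apply: contraNneq zX => ->.
  have tx : chi_lt chi t x by have := lt_total chi xt; rewrite (negPf h').
  apply: (NC_cross sS Xp Yp XY fX xX tY zY) => //; apply: fmin => //; first exact: YS.
  by apply: contraNneq tX => ->.
Qed.

(** * Moebius inversion *)

Section MobiusInversion.

Context (T : finType) (le : rel T) (P : {set T}).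
Context (le_refl : {in P, reflexive le}).
Context (le_anti : {in P &, antisymmetric le}) (le_trans : transitive le).
Local Notation mu := (mobius le P).

Let down y := #|[set z in P | le z y]|.

Lemma down_lt y z : y \in P -> z \in P -> le z y -> z != y -> (down z < down y)%N.
Proof.
move=> yP zP zy ne; apply: proper_card; apply/properP; split.
  by apply/subsetP => w; rewrite !inE => /andP[-> wz]; apply: le_trans wz zy.
exists y; first by rewrite inE yP le_refl.
rewrite inE yP /=; apply/negP => yz.
by case/eqP: ne; apply: le_anti => //; rewrite zy.
Qed.

(** Each recursive call passes to a strictly smaller second argument, so the number of elements
    below [y] is enough depth. *)
Lemma mobius_rec_stable x y m m' : y \in P -> (down y <= m)%N -> (down y <= m')%N ->
  mobius_rec le P m x y = mobius_rec le P m' x y.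
Proof.
elim: m m' y => [|m IH] [|m'] y yP //.
- rewrite leqn0 => /eqP d0; have : y \in [set z in P | le z y] by rewrite inE yP le_refl.
  by move/card0_eq: d0 => ->.
- move=> _; rewrite leqn0 => /eqP d0.
  have : y \in [set z in P | le z y] by rewrite inE yP le_refl.
  by move/card0_eq: d0 => ->.
move=> dm dm' /=; case: eqP => // _; case: ifP => // _; congr (- _).
apply: eq_bigr => z /andP[zP /and3P[_ zy ne]].
have lt := down_lt yP zP zy ne.
by apply: IH => //; rewrite -ltnS; apply: leq_trans lt _.
Qed.

Lemma down_max y : (down y <= #|T|)%N.
Proof. exact: max_card. Qed.

Lemma mobiusE x y : y \in P -> mu x y =
  if x == y then 1 else if le x y then
    - \sum_(z in P | [&& le x z, le z y & z != y]) mu x z else 0.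
Proof.
move=> yP; rewrite {1}/mobius (@mobius_rec_stable _ _ _ #|T|.+1) //; last 2 first.
- exact: down_max.
- exact: leq_trans (down_max y) _.
Qed.

Lemma mobius_suml x y : x \in P -> y \in P ->
  \sum_(z in P | le x z && le z y) mu x z = (x == y)%:R.
Proof.
move=> xP yP; have [<-|ne] := eqVneq x y.
  rewrite (bigD1 x) /=; last by rewrite xP le_refl.
  rewrite mobiusE // eqxx big1 ?addr0 // => z /andP[/andP[zP /andP[xz zx]] zne].
  by case/eqP: zne; apply: le_anti => //; rewrite zx.
case: (boolP (le x y)) => xy; last first.
  by rewrite big_pred0 // => z; apply/negbTE/negP => /and3P[_ xz zy];
    case/negP: xy; apply: le_trans xz zy.
rewrite (bigD1 y) /=; last by rewrite yP xy le_refl.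
rewrite mobiusE // (negPf ne) xy.
rewrite (eq_bigl (fun z => (z \in P) && [&& le x z, le z y & z != y])) ?addNr //.
by move=> z; rewrite !andbA.
Qed.

(** The recursion sums over the second argument and gives a left inverse of the zeta matrix; for
    square integer matrices a one-sided inverse is two-sided. *)
Lemma mobius_sumr x y : x \in P -> y \in P ->
  \sum_(z in P | le x z && le z y) mu z y = (x == y)%:R.
Proof.
move=> xP yP.
pose Z : 'M[int]_#|P| := \matrix_(i, j) (le (enum_val i) (enum_val j))%:R.
pose M : 'M[int]_#|P| := \matrix_(i, j) mu (enum_val i) (enum_val j).
have sumE (f : T -> int) : \sum_(z in P) f z = \sum_(i < #|P|) f (enum_val i).
  by rewrite big_enum_val.
have MZ : M *m Z = 1%:M.
  apply/matrixP => i j; rewrite !mxE.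
  rewrite (eq_bigr (fun k : 'I_#|P| => if le (enum_val i) (enum_val k) &&
    le (enum_val k) (enum_val j) then mu (enum_val i) (enum_val k) else 0)).
    rewrite -(sumE (fun z => if le (enum_val i) z && le z (enum_val j)
      then mu (enum_val i) z else 0)) -big_mkcondr /=.
    by rewrite mobius_suml ?enum_valP // (inj_eq enum_val_inj).
  move=> k _; rewrite !mxE; case: (boolP (le (enum_val i) (enum_val k))) => /= ik.
    by case: (le _ _); rewrite ?mulr1 ?mulr0.
  rewrite mobiusE ?enum_valP // (negPf ik); case: eqP => [e|_]; last by rewrite mul0r.
  by rewrite e le_refl ?enum_valP in ik.
have := mulmx1C MZ => /matrixP/(_ (enum_rank_in xP x) (enum_rank_in xP y)).
rewrite !mxE -(inj_eq enum_val_inj) !enum_rankK_in // => <-.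
under [RHS]eq_bigr => k _ do rewrite !mxE !enum_rankK_in //.
rewrite -(sumE (fun z => (le x z)%:R * mu z y)) big_mkcondr.
apply: eq_bigr => z zP; case: (boolP (le x z)) => /= xz; last by rewrite mul0r.
rewrite mul1r; case: (boolP (le z y)) => //= zy.
rewrite mobiusE // (negPf zy); case: eqP => // e.
by rewrite e le_refl in zy.
Qed.

Lemma mobius_inversion (B : zmodType) (f g : T -> B) y : y \in P ->
  (forall z, z \in P -> f z = \sum_(x in P | le x z) g x) ->
  \sum_(z in P | le z y) f z *~ mu z y = g y.
Proof.
move=> yP fE; transitivity (\sum_(x in P) g x *~ (x == y)%:R); last first.
  rewrite (bigD1 y) //= eqxx big1 ?addr0 // => x /andP[_ /negPf->] //.
transitivity (\sum_(z in P | le z y) \sum_(x in P | le x z) g x *~ mu z y).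
  by apply: eq_bigr => z /andP[zP _]; rewrite fE // mulrz_suml.
rewrite (exchange_big_dep (mem P)) /=; last by move=> z x _ /andP[].
apply: eq_bigr => x xP; rewrite -mobius_sumr // mulrz_sumr.
by apply: eq_bigl => z; rewrite xP /= -andbA; congr (_ && _); rewrite andbC.
Qed.

End MobiusInversion.

Lemma refinesP (T : finType) (pi sigma : {set {set T}}) : refines pi sigma <->
  forall X, X \in pi -> exists2 Y, Y \in sigma & X \subset Y.
Proof.
split=> [/'forall_implyP h X /h /'exists_andP[Y [Ys XY]]|h]; first by exists Y.
by apply/'forall_implyP => X /h[Y Ys XY]; apply/'exists_andP; exists Y.
Qed.

Lemma refines_refl (T : finType) : reflexive (@refines T).
Proof. by move=> pi; apply/refinesP => X; exists X. Qed.

Lemma refines_trans (T : finType) : transitive (@refines T).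
Proof.
move=> sigma pi tau /refinesP h1 /refinesP h2; apply/refinesP => X /h1[Y /h2[Z Zt YZ] XY].
by exists Z => //; apply: subset_trans XY YZ.
Qed.

Section Refinement.

Context (n : nat) (chi : 'I_n -> bool).
Implicit Types (S V X Y : {set 'I_n}) (pi sigma tau : {set {set 'I_n}}).

Lemma refines_anti S : {in NC chi S &, antisymmetric (@refines 'I_n)}.
Proof.
have H pi sigma : pi \in NC chi S -> refines pi sigma -> refines sigma pi ->
    pi \subset sigma.
  move=> piS /refinesP h1 /refinesP h2; apply/subsetP => X Xp.
  have [Y Ys XY] := h1 X Xp; have [X' Xp' YX'] := h2 Y Ys.
  have [/set0Pn[x xX] _] := NC_block piS Xp.
  have e : X = X' by apply: (NC_inj piS Xp Xp' xX); apply/(subsetP YX')/(subsetP XY).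
  have -> : X = Y by apply/eqP; rewrite eqEsubset XY (_ : Y \subset X) // e.
  by [].
move=> pi sigma piS sS /andP[ps sp]; apply/eqP; rewrite eqEsubset.
by rewrite (H pi sigma) // (H sigma pi).
Qed.

Lemma refines_closed pi sigma S V : pi \in NC chi S -> sigma \in NC chi S ->
  V \subset S -> closed_under sigma V -> refines pi sigma -> closed_under pi V.
Proof.
move=> piS sS VS /(closedP sS VS) cV /refinesP h; apply/(closedP piS VS).
move=> X x Xp xX xV; have [Y Ys XY] := h X Xp.
exact: subset_trans XY (cV Y x Ys (subsetP XY x xX) xV).
Qed.

Lemma refines_split pi sigma S V : pi \in NC chi S -> sigma \in NC chi S ->
  V \subset S -> closed_under sigma V -> closed_under pi V ->
  refines pi sigma = refines (restr pi V) (restr sigma V) &&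
    refines (restr pi (S :\: V)) (restr sigma (S :\: V)).
Proof.
move=> piS sS VS cs cp.
have WS : S :\: V \subset S by apply: subsetDl.
have half V' : V' \subset S -> closed_under sigma V' -> refines pi sigma ->
    refines (restr pi V') (restr sigma V').
  move=> V'S cs' /refinesP h; apply/refinesP => X /restrP[Xp XV].
  have [Y Ys XY] := h X Xp; exists Y => //; apply/restrP; split=> //.
  have [/set0Pn[x xX] _] := NC_block piS Xp.
  by apply: (proj1 (closedP sS V'S) cs' Y x Ys); [apply: (subsetP XY)|apply: (subsetP XV)].
apply/idP/andP => [r|[/refinesP h1 /refinesP h2]].
  by split; apply: half => //; apply: (closedC sS).
apply/refinesP => X Xp.
have : X \in restr pi V :|: restr pi (S :\: V) by rewrite (NC_join piS).
by move=> /setUP[/h1|/h2] [Y /restrP[Ys _] XY]; exists Y.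
Qed.

End Refinement.

(** * Agreement with the recursive moments and the cumulants *)

Section MomentSums.

Context (K : fieldType) (B A : algType K) (Sp : bb_space B A) (Ex : A -> B).
Context (n : nat) (chi : 'I_n -> bool) (Z : 'I_n -> A) (D0 : B -> Prop).
Context (D0_0 : D0 0) (D0_M : forall b b', D0 b -> D0 b' -> D0 (b * b')).
Context (Ex_D0 : forall a, D0 (Ex a)).
Implicit Types (S V X Y : {set 'I_n}) (pi sigma : {set {set 'I_n}}) (c : 'I_n -> B).

(* The scalar [c k] put just after the [k]th variable in the order of [chi]. *)
Definition insert_after c (k : 'I_n) : A :=
  if chi k then Z k * Lb Sp (c k) else Rb Sp (c k) * Z k.

Context (q : 'I_n -> seq (B * 'I_n) -> B) (N : seq (B * 'I_n) -> B).
Context (Nq : is_mom (@everything _) q N) (qA : kadd q).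
Context (HN : forall S c, S != set0 -> (forall k, D0 (c k)) ->
  Ex (\prod_(k in S) insert_after c k) = word_val N (seqS chi S) c).

Lemma moment_rec_D0 m S pi Z' : D0 (moment_rec Sp Ex chi m S pi Z').
Proof.
elim: m S pi Z' => //= m IH S pi Z'; case: ifP => // _.
by case: pickP => //= V _; case: ifP => _; [exact: D0_M|case: ifP => _ //; exact: D0_M].
Qed.

Let Np pi := mom (qpart q pi).

Lemma part_sep pi S V : pi \in NC chi S -> V \subset S -> closed_under pi V ->
  forall x acc, has (mem V) (x :: unzip2 acc) -> has (predC (mem V)) (x :: unzip2 acc) ->
  qpart q pi x acc = 0.
Proof.
move=> piS VS /(closedP piS VS) cV x acc /hasP[y yx yV] /hasP[z zx zV].
rewrite /qpart; case: ifP => // Xp; case/negP: zV.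
have mem t : t \in x :: unzip2 acc -> t \in x |: letters acc by rewrite !inE.
exact: (subsetP (cV _ y Xp (mem y yx) yV)) (mem z zx).
Qed.

Lemma word_val_restr pi V c : word_val (Np pi) (seqS chi V) c = word_val (Np (restr pi V)) (seqS chi V) c.
Proof.
congr (_ * _); apply: mom_restr => k; rewrite unzip2_wdp mem_seqS //.
Qed.

Lemma insert_at_after S V k c b : (forall p, chi_pred chi S V p = (p == k)) ->
  insert_at Sp chi S V b (insert_after c) = insert_after (upd c k b).
Proof.
move=> h; apply/boolp.funext => p; rewrite /insert_at h /insert_after /upd.
case: eqP => [->|//]; case: (chi k); first by rewrite rmorphM mulrA.
by rewrite RbM mulrA.
Qed.

Lemma letters_wdp S d c : letters (wdp d (seqS chi S) c) = S.
Proof. by apply/setP => k; rewrite inE unzip2_wdp mem_seqS. Qed.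

Lemma word_val_add pi s k b b' c : uniq s -> k \in s ->
  word_val (Np pi) s (upd c k (b - b')) = word_val (Np pi) s (upd c k b) - word_val (Np pi) s (upd c k b').
Proof.
move=> us ks; have NA : fadd (Np pi) by apply: mom_add; apply: qpart_add.
rewrite /word_val; elim: s us ks 1 (Np pi) NA => //= x s IH /andP[xs us] + d g gA.
rewrite inE eq_sym; have [e _|ne /= ks] := eqVneq x k; last first.
  have E e : upd c k e x = c x by rewrite /upd (negPf ne).
  by rewrite !E; apply: (IH us ks (c x) (fun h => g ((d, x) :: h))) => u *;
    apply: (gA ((d, x) :: u)).
subst x; have ee e : {in s, upd c k e =1 c}.
  by move=> y ys; rewrite /upd; case: eqP => // yk; rewrite -yk ys in xs.
rewrite !(wdp_ext _ (ee _)) !(pend_ext _ (ee _)) /upd eqxx mulrBr.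
case: (s) => [|y s'] /=; first by rewrite mulrBr.
by have := gA [:: (d, k)] (c k * b) (c k * b') y (wdp (c y) s' c) => /= ->; rewrite mulrBl.
Qed.

(** A union of blocks of [sigma] is a union of blocks of each refinement, so the splitting interval
    splits the sum as well. The sum does not mention that interval, which settles the independence
    of choices. Inserted scalars stay in [D0], as [HN] demands. *)
Lemma moment_rec_sum m S sigma c : (#|S| <= m)%N -> S != set0 -> sigma \in NC chi S ->
  (forall k, D0 (c k)) ->
  moment_rec Sp Ex chi m S sigma (insert_after c) =
  \sum_(pi in NC chi S | refines pi sigma) word_val (Np pi) (seqS chi S) c.
Proof.
elim: m S sigma c => [|m IH] S sigma c; first by rewrite leqn0 cards_eq0 => /eqP->; rewrite eqxx.
move=> cS S0 sS Dc /=; case: eqP => [->|/eqP ne].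
  rewrite HN // {1}/word_val (@mom_partitions _ chi _ _ qA _ Nq); last by rewrite unzip2_wdp seqS_pairwise.
  rewrite mulr_suml letters_wdp; apply: eq_big => pi //.
  rewrite andb_idr // => piS; apply/refinesP => X /(NC_block piS)[_ XS].
  by exists S; rewrite ?inE.
case: pickP => [V|none]; last by have [V] := NC_splits S0 sS ne; rewrite none.
move=> /and4P[V0 VpS int cV].
have VS := proper_sub VpS; have WS : S :\: V \subset S by apply: subsetDl.
have W0 : S :\: V != set0.
  by rewrite setD_eq0; move: VpS; rewrite properE => /andP[].
have cardV : (#|V| <= m)%N by rewrite -ltnS; apply: leq_trans (proper_card VpS) cS.
have cardW : (#|S :\: V| <= m)%N.
  rewrite -ltnS; apply: leq_trans cS; rewrite cardsD (setIidPr VS) ltn_subrL card_gt0 V0.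
  by rewrite card_gt0.
have sV := NC_restr sS VS cV; have sW := NC_restr sS WS (closedC sS VS cV).
have split_sum (f : {set {set 'I_n}} -> {set {set 'I_n}} -> B) :
  (forall pi, pi \in NC chi S -> closed_under pi V ->
     word_val (Np pi) (seqS chi S) c = f (restr pi V) (restr pi (S :\: V))) ->
  \sum_(pi in NC chi S | refines pi sigma) word_val (Np pi) (seqS chi S) c =
  \sum_(p1 in NC chi V | refines p1 (restr sigma V))
    \sum_(p2 in NC chi (S :\: V) | refines p2 (restr sigma (S :\: V))) f p1 p2.
  move=> hf; pose r V' p : bool := refines p (restr sigma V').
  rewrite [RHS]big_mkcondr /=.
  transitivity (\sum_(p1 in NC chi V) \sum_(p2 in NC chi (S :\: V))
     if r V p1 && r (S :\: V) p2 then f p1 p2 else 0).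
    rewrite -(big_NC_split (fun p1 p2 => if r V p1 && r (S :\: V) p2 then f p1 p2 else 0) VS int).
    rewrite -big_mkcondr /=; apply: eq_big => [pi|pi /andP[piS rp]].
      rewrite -andbA; case: (boolP (pi \in NC chi S)) => //= piS.
      case: (boolP (closed_under pi V)) => cp /=; first by rewrite (refines_split piS sS VS cV cp).
      by apply/negbTE/negP => /(refines_closed piS sS VS cV); apply/negP.
    by apply: hf => //; apply: (refines_closed piS sS VS cV rp).
  apply: eq_bigr => p1 _; rewrite -/(r V p1); case: (r V p1) => /=; first by rewrite [RHS]big_mkcondr.
  by rewrite big1.
have sp pi (piS : pi \in NC chi S) (cp : closed_under pi V) := part_sep piS VS cp.
have v0 : seqS chi V != [::] by rewrite seqS0.
have pv : all (mem V) (seqS chi V) by apply/allP => k; rewrite mem_seqS.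
have pb : all (predC (mem V)) (seqS chi (before chi S V)).
  by apply/allP => k; rewrite mem_seqS => /before_D/setDP[].
have pa : all (predC (mem V)) (seqS chi (after chi S V)).
  by apply/allP => k; rewrite mem_seqS => /after_D/setDP[].
have Nm pi := mom_is_mom (@everything _) (qpart q pi).
have eS := seqS_split VS V0 int; have eW := seqS_compl V0 int.
have eV := IH V _ c cardV V0 sV Dc.
rewrite (initial_before V0 int) (terminal_after V0 int).
case: eqP => [b0|/eqP b0].
  rewrite (split_sum (fun p1 p2 => word_val (Np p1) (seqS chi V) c *
    word_val (Np p2) (seqS chi (S :\: V)) c)).
    by rewrite eV IH // mulr_suml; apply: eq_bigr => p1 _; rewrite mulr_sumr.
  move=> pi piS cp; rewrite eS b0 /= (word_val_initial (Nm pi) (sp pi piS cp)) //.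
  by rewrite -!word_val_restr eW b0.
case: eqP => [a0|/eqP a0].
  rewrite (split_sum (fun p1 p2 => word_val (Np p2) (seqS chi (S :\: V)) c *
    word_val (Np p1) (seqS chi V) c)).
    rewrite eV IH // exchange_big /= mulr_suml; apply: eq_bigr => p1 _.
    by rewrite mulr_sumr.
  move=> pi piS cp; rewrite eS a0 cats0 (word_val_terminal (Nm pi) (sp pi piS cp)) //.
  by rewrite -!word_val_restr eW a0 cats0.
have [s [k ek]] : exists s k, seqS chi (before chi S V) = rcons s k.
  by case/lastP: (seqS chi (before chi S V)) b0 => // s k _; exists s, k.
have DV : D0 (moment_rec Sp Ex chi m V (restr sigma V) (insert_after c)) by apply: moment_rec_D0.
rewrite (insert_at_after _ _ (pred_last ek)) IH //; last first.
  by move=> p; rewrite /upd; case: eqP => _ //; apply: D0_M.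
rewrite (split_sum (fun p1 p2 => word_val (Np p2) (seqS chi (S :\: V))
   (upd c k (word_val (Np p1) (seqS chi V) c)))); last first.
  move=> pi piS cp; rewrite eS ek (word_val_middle (Nm pi) (sp pi piS cp)) //.
  - by rewrite -!word_val_restr eW ek.
  - by rewrite -ek.
  - by rewrite -ek -eW seqS_uniq.
rewrite exchange_big /= eV; apply: eq_bigr => p2 _.
apply: (sub_morph_sum (f := fun e => word_val (Np p2) (seqS chi (S :\: V)) (upd c k e))) => b b'.
apply: word_val_add; first exact: seqS_uniq.
by rewrite eW ek mem_cat mem_rcons inE eqxx.
Qed.

(** The only allowed block is the full set, so a completion that leaves a letter in a gap
    contributes zero and a single term survives. *)
Lemma word_val_top x s c : chi_seq chi = x :: s ->
  word_val (Np [set [set: 'I_n]]) (x :: s) c = q x (wdp (c x) s c) * pend (c x) s c.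
Proof.
move=> e; rewrite /word_val /Np [wdp _ _ _]/= (proj2 (mom_is_mom (@everything _) _)) // mul1r; congr (_ * _).
have us : uniq (x :: s) by rewrite -e chi_seq_uniq.
have ms y : y \in x :: s by rewrite -e mem_chi_seq.
have N1 : Np [set [set: 'I_n]] [::] = 1 by [].
have main acc w : uniq (x :: unzip2 (acc ++ w)) ->
   x |: letters (acc ++ w) = [set: 'I_n] ->
   openb (qpart q [set [set: 'I_n]]) (Np [set [set: 'I_n]]) x acc (Np [set [set: 'I_n]]) w =
   q x (acc ++ w).
  elim: w acc => [|[d y] w IHw] acc u h /=.
    by rewrite N1 mulr1 /qpart !cats0 in h *; rewrite h inE eqxx.
  rewrite N1 mul1r [X in _ + X]vanish_openb ?addr0; last first.
    move=> e' es; rewrite /qpart inE; case: eqP => // h'.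
    have : y \in [set: 'I_n] by rewrite inE.
    rewrite -h' !inE /unzip2 map_cat mem_cat.
    move: u => /=; rewrite /unzip2 map_cat cat_uniq mem_cat /= inE !negb_or.
    move=> /andP[/and3P[_ xy _] /and3P[_ /andP[ya _] /andP[yw _]]].
    rewrite eq_sym (negPf xy) (negPf ya) /= => /(mem_subseq es).
    by rewrite (negPf yw).
  by rewrite IHw ?cat_rcons.
rewrite main //=; first by rewrite unzip2_wdp.
by apply/setP => y; rewrite !inE unzip2_wdp; have := ms y; rewrite inE.
Qed.

Theorem cumulantE x s : chi_seq chi = x :: s -> D0 1 -> cumulant Sp Ex chi Z = q x (map (pair 1) s).
Proof.
move=> e D01.
have n0 : [set: 'I_n] != set0 by apply/set0Pn; exists x; rewrite inE.
have eT : seqS chi [set: 'I_n] = x :: s.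
  by rewrite -e; apply/all_filterP/allP => k _; rewrite inE.
have ZE : Z = insert_after (fun=> 1).
  apply/boolp.funext => k; rewrite /insert_after rmorph1 Rb1 mulr1 mul1r.
  by case: (chi k).
have top := top_NC chi n0.
rewrite /cumulant /cumulant_part.
have := mobius_inversion (le := @refines 'I_n) (P := NC chi [set: 'I_n])
  (f := fun sigma => moment Sp Ex chi sigma Z)
  (g := fun pi => word_val (Np pi) (seqS chi [set: 'I_n]) (fun=> 1)) _ _ _ top.
move=> ->.
- rewrite eT word_val_top //.
  have -> : pend 1 s (fun=> 1 : B) = 1 by elim: (s).
  by rewrite mulr1; congr (q x _); elim: (s) => //= y s' ->.
- by move=> pi _; apply: refines_refl.
- exact: refines_anti.
- exact: refines_trans.
- move=> sigma sS; rewrite /moment {1}ZE; apply: moment_rec_sum => //.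
  by rewrite cardsT card_ord.
Qed.

End MomentSums.

(* Imported only here because [classical_sets] shadows the names of [finset]. *)
From mathcomp Require Import boolp classical_sets.

(** * Expectations of words in the two-sided algebra *)

Section ClassList.

Context (T : Type) (key : T -> nat).

Lemma flatten_classes M (e : seq T) :
  pairwise (fun x y => key x <= key y)%N e -> all (fun x => key x < M)%N e ->
  flatten [seq [seq x <- e | key x == j] | j <- iota 0 M] = e.
Proof.
elim: e => [|x e IH]; first by move=> _ _ /=; elim: (iota 0 M).
move=> /= /andP[hx pe] /andP[xM eM]; rewrite -[in RHS](IH pe eM).
have -> : iota 0 M = iota 0 (key x) ++ key x :: iota (key x).+1 (M - (key x).+1).
  have M_eq : M = (key x + (M - (key x).+1).+1)%N by move: xM; lia.
  by rewrite {1}M_eq iotaD add0n.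
rewrite !map_cat !flatten_cat /= eqxx.
have -> : flatten [seq (if key x == j then x :: [seq x0 <- e | key x0 == j]
    else [seq x0 <- e | key x0 == j]) | j <- iota 0 (key x)] = [::].
  apply: size0nil; rewrite size_flatten /shape -map_comp sumnE big_map big1_seq //.
  move=> j /andP[_]; rewrite mem_iota add0n => /andP[_ jx] /=.
  rewrite gtn_eqF //; elim: (e) hx => //= y e' IH' /andP[xy h].
  by rewrite gtn_eqF ?IH' //; apply: leq_trans jx xy.
have -> : flatten [seq [seq x0 <- e | key x0 == j] | j <- iota 0 (key x)] = [::].
  apply: size0nil; rewrite size_flatten /shape -map_comp sumnE big_map big1_seq //.
  move=> j /andP[_]; rewrite mem_iota add0n => /andP[_ jx] /=.
  elim: (e) hx => //= y e' IH' /andP[xy h].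
  by rewrite gtn_eqF ?IH' //; apply: leq_trans jx xy.
rewrite /=; congr (_ :: (_ ++ flatten _)); apply/eq_in_map => j.
by rewrite mem_iota => /andP[jx _]; rewrite ltn_eqF.
Qed.

End ClassList.

Lemma prod_swap (A : pzRingType) (f g : nat -> A) (m t : nat) : (t.+1 < m)%N ->
  f t * f t.+1 = g t * g t.+1 ->
  (forall j, j != t -> j != t.+1 -> f j = g j) ->
  \prod_(0 <= j < m) f j = \prod_(0 <= j < m) g j.
Proof.
move=> tm e fg; have lt : (t < m)%N by apply: ltnW.
have split3 h : \prod_(0 <= j < m) h j =
    \prod_(0 <= j < t) h j * (h t * h t.+1 * \prod_(t.+2 <= j < m) h j) :> A.
  rewrite (@big_cat_nat _ _ _ t 0 m) //=; last exact: ltnW.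
  by rewrite [\prod_(t <= i < m) _]big_ltn // [\prod_(t.+1 <= i < m) _]big_ltn // -!mulrA.
rewrite !split3 e; congr (_ * (_ * _)).
  apply: eq_big_nat => j /andP[_ jt]; apply: fg; first by rewrite ltn_eqF.
  by rewrite ltn_eqF // ltnS ltnW.
apply: eq_big_nat => j /andP[tj _].
by apply: fg; rewrite gtn_eqF // ltnW.
Qed.

Lemma prod_pairs (A : pzRingType) (g : nat -> A) m :
  \prod_(0 <= j < m.*2) g j = \prod_(0 <= t < m) (g t.*2 * g t.*2.+1).
Proof.
by elim: m => [|m IH]; rewrite ?big_nil // doubleS !big_nat_recr //= IH mulrA.
Qed.

Section Letters.

Context (K : fieldType) (B A : algType K) (Sp : bb_space B A).

Local Notation L := (Lb Sp).
Local Notation R := (Rb Sp).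
Local Notation E := (expect Sp).

(* A letter is a time, a side, a colour and an element of the algebra. The colour
   is [true] for the pair of faces generated by the variables over D and [false]
   for the copy of B. *)
Definition letter : eqType := (nat * bool * bool * A)%type.
Implicit Types (x y : letter) (u v w : seq (B * letter)) (s : seq letter).

Definition tm x : nat := x.1.1.1.
Definition sd x : bool := x.1.1.2.
Definition col x : bool := x.1.2.
Definition el x : A := x.2.

Definition scal (s : bool) (b : B) : A := if s then L b else R b.

(** A coefficient precedes its letter in the order of chi. On the right side this order runs against
    the multiplication of the algebra, hence in [rprod] the reversed word and the scalar to the
    right of the element. *)
Definition lprod t w : A :=
  \prod_(p <- w | sd p.2 && (tm p.2 == t)) (L p.1 * el p.2).
Definition rprod t w : A :=
  \prod_(p <- rev w | ~~ sd p.2 && (tm p.2 == t)) (el p.2 * R p.1).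

(* The natural-order product of the word, whose letters are listed in the
   chi-order: increasing times for the left letters, then decreasing times for
   the right ones; at equal times the left letters come first. *)
Definition tprod m w : A := \prod_(0 <= t < m) (lprod t w * rprod t w).

Definition precedes x y : bool :=
  if sd x then sd y ==> (tm x <= tm y)%N else ~~ sd y && (tm y <= tm x)%N.

(** Elements commute with the scalars of all of [B] on the other side, also for cumulants over [D]:
    words carry coefficients from [B]. *)
Definition valid m x : Prop :=
  (tm x < m)%N /\ if sd x then left_alg Sp setT (el x) else right_alg Sp setT (el x).

Definition ok m s : Prop := pairwise precedes s /\ {in s, forall x, valid m x}.

Lemma ok_sub m : hereditary (ok m).
Proof.
move=> s s' ss [ps vs]; split; first exact: subseq_pairwise ss ps.
by move=> x /(mem_subseq ss); apply: vs.
Qed.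

Lemma lprod_cat t u v : lprod t (u ++ v) = lprod t u * lprod t v.
Proof. exact: big_cat. Qed.

Lemma rprod_cat t u v : rprod t (u ++ v) = rprod t v * rprod t u.
Proof. by rewrite /rprod rev_cat big_cat. Qed.

Lemma lprod1 t b x : lprod t [:: (b, x)] =
  if sd x && (tm x == t) then L b * el x else 1.
Proof. by rewrite /lprod big_mkcond big_seq1. Qed.

Lemma rprod1 t b x : rprod t [:: (b, x)] =
  if ~~ sd x && (tm x == t) then el x * R b else 1.
Proof. by rewrite /rprod big_mkcond big_seq1. Qed.

Lemma lprod_none t u : {in unzip2 u, forall x, sd x -> tm x != t} -> lprod t u = 1.
Proof.
move=> h; rewrite /lprod big1_seq // => -[b x] /= /andP[/andP[sx tx] xu].
by case/eqP: (h x (map_f snd xu) sx); apply/eqP.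
Qed.

Lemma rprod_none t u : {in unzip2 u, forall x, ~~ sd x -> tm x != t} -> rprod t u = 1.
Proof.
move=> h; rewrite /rprod big1_seq // => -[b x] /= /andP[/andP[sx tx]].
by rewrite mem_rev => xu; case/eqP: (h x (map_f snd xu) sx); apply/eqP.
Qed.

Lemma L1 : L 1 = 1. Proof. exact: rmorph1. Qed.

Lemma comm_lprod m t u b : {in unzip2 u, forall x, valid m x} ->
  R b * lprod t u = lprod t u * R b.
Proof.
move=> vu; rewrite /lprod big_seq_cond; apply: commr_prod => -[c x] /=.
move=> /andP[xu /andP[sx _]]; have [_] := vu x (map_f snd xu); rewrite sx => lx.
by rewrite /GRing.comm -mulrA lx // !mulrA LbRbC.
Qed.

Lemma comm_rprod m t u b : {in unzip2 u, forall x, valid m x} ->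
  L b * rprod t u = rprod t u * L b.
Proof.
move=> vu; rewrite /rprod big_seq_cond; apply: commr_prod => -[c x] /=.
rewrite mem_rev => /andP[xu /andP[sx _]]; have [_] := vu x (map_f snd xu).
rewrite (negPf sx) => rx.
by rewrite /GRing.comm -mulrA -LbRbC !mulrA rx.
Qed.

Lemma comm_tprod_right m t u b : {in unzip2 u, forall x, valid m x} ->
  {in unzip2 u, forall x, ~~ sd x} -> L b * tprod t u = tprod t u * L b.
Proof.
move=> vu nu; apply: commr_prod => j _; rewrite /GRing.comm.
by rewrite lprod_none ?mul1r ?(comm_rprod _ _ vu) // => x /nu/negPf->.
Qed.

Lemma comm_tprod_left m t u b : {in unzip2 u, forall x, valid m x} ->
  {in unzip2 u, forall x, sd x} -> R b * tprod t u = tprod t u * R b.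
Proof.
move=> vu nu; apply: commr_prod => j _; rewrite /GRing.comm.
by rewrite rprod_none ?mulr1 ?(comm_lprod _ _ vu) // => x /nu ->.
Qed.

(* A left scalar inserted between [u] and [v] may be moved in time past the
   right letters, and symmetrically. *)
Definition lslot m u b v t : A :=
  \prod_(0 <= j < m) (lprod j u * (if j == t then L b else 1) * lprod j v * rprod j (u ++ v)).
Definition rslot m u b v t : A :=
  \prod_(0 <= j < m) (lprod j (u ++ v) * rprod j v * (if j == t then R b else 1) * rprod j u).

Lemma lslot_move m u b v t t' : {in unzip2 (u ++ v), forall x, valid m x} ->
  (t <= t' < m)%N -> {in unzip2 u, forall x, sd x -> tm x <= t}%N ->
  {in unzip2 v, forall x, sd x -> t' <= tm x}%N ->
  lslot m u b v t = lslot m u b v t'.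
Proof.
move=> vuv; elim: t' => [|t' IH] /andP[tt' t'm] hu hv; first by move: tt'; rewrite leqn0 => /eqP->.
move: tt'; rewrite leq_eqVlt => /orP[/eqP->//|]; rewrite ltnS => tt'.
rewrite IH //; last 2 first.
- by rewrite tt' ltnW.
- by move=> x xv sx; apply: ltnW; apply: hv.
apply: (prod_swap (t := t')) => //; last first.
  by move=> j /negPf-> /negPf->.
rewrite !eqxx [t'.+1 == t']gtn_eqF // [t' == t'.+1]ltn_eqF //.
rewrite [lprod t'.+1 u]lprod_none; last first.
  by move=> x xu sx; rewrite ltn_eqF // ltnS (leq_trans (hu x xu sx)).
rewrite [lprod t' v]lprod_none; last first.
  by move=> x xv sx; rewrite gtn_eqF //; apply: hv.
rewrite !mulr1 !mul1r -!mulrA; congr (_ * _); rewrite !mulrA.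
by rewrite (comm_rprod _ _ vuv).
Qed.

Lemma rslot_move m u b v t t' : {in unzip2 (u ++ v), forall x, valid m x} ->
  (t <= t' < m)%N -> {in unzip2 v, forall x, ~~ sd x -> tm x <= t}%N ->
  {in unzip2 u, forall x, ~~ sd x -> t' <= tm x}%N ->
  rslot m u b v t = rslot m u b v t'.
Proof.
move=> vuv; elim: t' => [|t' IH] /andP[tt' t'm] hv hu; first by move: tt'; rewrite leqn0 => /eqP->.
move: tt'; rewrite leq_eqVlt => /orP[/eqP->//|]; rewrite ltnS => tt'.
rewrite IH //; last 2 first.
- by rewrite tt' ltnW.
- by move=> x xv sx; apply: ltnW; apply: hu.
apply: (prod_swap (t := t')) => //; last first.
  by move=> j /negPf-> /negPf->.
rewrite !eqxx [t'.+1 == t']gtn_eqF // [t' == t'.+1]ltn_eqF //.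
rewrite [rprod t'.+1 v]rprod_none; last first.
  by move=> x xu sx; rewrite ltn_eqF // ltnS (leq_trans (hv x xu sx)).
rewrite [rprod t' u]rprod_none; last first.
  by move=> x xv sx; rewrite gtn_eqF //; apply: hu.
rewrite !mulr1 -!mulrA; congr (_ * (_ * _)); rewrite !mulrA.
by rewrite (comm_lprod _ _ vuv).
Qed.

Definition NE m w : B := E (tprod m w).

Lemma expect_l b Z : E (L b * Z) = b * E Z.
Proof. by have := expect_bimod Sp b 1 Z; rewrite Rb1 !mulr1. Qed.

Lemma expect_r b Z : E (R b * Z) = E Z * b.
Proof. by have := expect_bimod Sp 1 b Z; rewrite L1 !mul1r. Qed.

Lemma unzip2_cat u v : unzip2 (u ++ v) = unzip2 u ++ unzip2 v.
Proof. exact: map_cat. Qed.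

Lemma rslot_head m u b c y v t : {in unzip2 (u ++ (c, y) :: v), forall x, valid m x} ->
  ~~ sd y -> (tm y <= t < m)%N ->
  {in unzip2 ((c, y) :: v), forall x, ~~ sd x -> tm x <= tm y}%N ->
  {in unzip2 u, forall x, ~~ sd x -> t <= tm x}%N ->
  rslot m u b ((c, y) :: v) t = tprod m (u ++ (b * c, y) :: v).
Proof.
move=> vv sy ty hv hu; rewrite -(rslot_move b vv ty hv hu).
apply: eq_bigr => j _; rewrite -!(cat1s _ v) !lprod_cat !rprod_cat !lprod1 !rprod1.
rewrite (negPf sy) /= !mul1r -!mulrA; congr (_ * (_ * (_ * _))).
rewrite [j == tm y]eq_sym; case: eqP => _; rewrite ?mul1r //.
by rewrite RbM !mulrA.
Qed.

Lemma rslot_nil m u b t : {in unzip2 u, forall x, valid m x} -> (t < m)%N ->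
  {in unzip2 u, forall x, ~~ sd x -> t <= tm x}%N ->
  rslot m u b [::] t = R b * tprod m u.
Proof.
move=> vu ht hu; rewrite -(rslot_move (t := 0%N) b) ?cats0 //.
case: m ht vu hu => // m _ vu hu; rewrite /rslot /tprod !big_nat_recl //= !mulrA.
rewrite (comm_lprod _ _ vu); congr (_ * _ * _).
  by rewrite cats0 /rprod /= big_nil mulr1.
by apply: eq_bigr => j _; rewrite cats0 /rprod /= big_nil !mulr1.
Qed.

Lemma lslot_end m u b v : {in unzip2 (u ++ v), forall x, valid m x} -> (0 < m)%N ->
  {in unzip2 v, forall x, ~~ sd x} ->
  lslot m u b v m.-1 = tprod m (u ++ v) * L b.
Proof.
case: m => // m vv _ nv; rewrite /lslot /tprod !big_nat_recr //= eqxx.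
have l1 j : lprod j v = 1 by apply: lprod_none => x /nv/negPf->.
rewrite -!mulrA; congr (_ * _).
  by apply: eq_big_nat => j /andP[_ jm]; rewrite ltn_eqF // lprod_cat l1 !mulr1.
by rewrite lprod_cat l1 mul1r mulr1 (comm_rprod _ _ vv).
Qed.

Lemma rslot_end m u b v : {in unzip2 (u ++ v), forall x, valid m x} -> (0 < m)%N ->
  {in unzip2 u, forall x, sd x} ->
  rslot m u b v m.-1 = tprod m (u ++ v) * R b.
Proof.
case: m => // m vv _ nu; rewrite /rslot /tprod !big_nat_recr //= eqxx.
have l1 j : rprod j u = 1 by apply: rprod_none => x /nu->.
rewrite -!mulrA; congr (_ * _).
  by apply: eq_big_nat => j /andP[_ jm]; rewrite ltn_eqF // rprod_cat l1 !(mulr1, mul1r).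
by rewrite rprod_cat l1 !(mulr1, mul1r).
Qed.

(** If a left letter follows, the scalar moves in time up to it and joins its coefficient. Otherwise
    it moves to the end of the product, where [expect_LR] turns it into a right scalar, which moves
    back to the latest right letter; if no letter follows at all, it leaves the expectation on the
    right. This is the turn of the chi-order. *)
Lemma expect_lslot m u b v t : ok m (unzip2 (u ++ v)) -> (t < m)%N ->
  {in unzip2 u, forall x, sd x} ->
  {in unzip2 u, forall x, sd x -> tm x <= t}%N ->
  {in unzip2 v, forall x, sd x -> t <= tm x}%N ->
  E (lslot m u b v t) = sc b (fun h => NE m (u ++ h)) v.
Proof.
move=> [pv vv] ht lu hu hv; have m0 : (0 < m)%N by apply: leq_ltn_trans ht.
have nolefts : {in unzip2 v, forall x, ~~ sd x} ->
    E (lslot m u b v t) = E (tprod m (u ++ v) * R b).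
  move=> nv; rewrite (lslot_move (t' := m.-1) b vv) //; last 2 first.
  - by rewrite -ltnS prednK // ht /= leqnn.
  - by move=> x /nv/negPf->.
  by rewrite lslot_end // expect_LR.
case: v pv vv hv nolefts => [|[c y] v] pv vv hv nolefts.
  rewrite nolefts // /NE !cats0 /=.
  by rewrite cats0 in vv *; rewrite -(comm_tprod_left _ _ vv) // expect_r.
have py z : z \in unzip2 v -> precedes y z.
  by move: pv; rewrite unzip2_cat pairwise_cat /= => /and4P[_ _ /allP h _] /h.
case: (boolP (sd y)) => sy.
  rewrite (lslot_move (t' := tm y) b vv) //; last 2 first.
  - rewrite hv ?inE ?eqxx //=; apply: (proj1 (vv y _)).
    by rewrite unzip2_cat mem_cat inE eqxx orbT.
  - move=> x; rewrite inE => /orP[/eqP-> //|/py]; by rewrite /precedes sy => /implyP.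
  congr (E _); apply: eq_bigr => j _; rewrite -!(cat1s _ v) !lprod_cat !rprod_cat !lprod1 !rprod1.
  rewrite sy /= !mulr1 !mulrA; congr (_ * _ * _ * _).
  rewrite [j == _]eq_sym; case: eqP => _; rewrite ?mulr1 //.
  by rewrite rmorphM !mulrA.
have nv : {in unzip2 ((c, y) :: v), forall x, ~~ sd x}.
  by move=> x; rewrite inE => /orP[/eqP->//|/py]; rewrite /precedes (negPf sy) => /andP[].
rewrite nolefts // -rslot_end //= /NE (rslot_head _ vv sy) //.
- rewrite -ltnS prednK // leqnn andbT; apply: (proj1 (vv y _)).
  by rewrite unzip2_cat mem_cat inE eqxx orbT.
- move=> x; rewrite inE => /orP[/eqP-> //|/py]; by rewrite /precedes (negPf sy) => /andP[].
- by move=> x /lu ->.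
Qed.

Lemma expect_rslot m u b v t : ok m (unzip2 (u ++ v)) -> (t < m)%N ->
  {in unzip2 v, forall x, ~~ sd x} ->
  {in unzip2 u, forall x, ~~ sd x -> t <= tm x}%N ->
  {in unzip2 v, forall x, ~~ sd x -> tm x <= t}%N ->
  E (rslot m u b v t) = sc b (fun h => NE m (u ++ h)) v.
Proof.
case: v => [|[c y] v] [pv vv] ht nv hu hv.
  by rewrite cats0 in vv; rewrite rslot_nil // expect_r /= /NE cats0.
have sy : ~~ sd y by apply: nv; rewrite inE eqxx.
have py z : z \in unzip2 v -> precedes y z.
  by move: pv; rewrite unzip2_cat pairwise_cat /= => /and4P[_ _ /allP h _] /h.
rewrite /= /NE (rslot_head _ vv sy) //.
- by rewrite ht andbT; apply: hv => //; rewrite inE eqxx.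
- move=> x; rewrite inE => /orP[/eqP-> //|/py]; by rewrite /precedes (negPf sy) => /andP[].
Qed.

(** A scalar letter with its coefficient is a slot at the time of that letter, and is therefore
    handed on to what follows. *)
Lemma NE_scalar m u b y v beta : ok m (unzip2 (u ++ (b, y) :: v)) ->
  el y = scal (sd y) beta ->
  NE m (u ++ (b, y) :: v) = sc (b * beta) (fun h => NE m (u ++ h)) v.
Proof.
move=> oky ey; have [py vy] := oky.
have okuv : ok m (unzip2 (u ++ v)).
  by apply: ok_sub oky; rewrite !unzip2_cat cat_subseq // subseq_cons.
have ym : (tm y < m)%N by apply: (proj1 (vy y _)); rewrite unzip2_cat mem_cat inE eqxx orbT.
move: py; rewrite unzip2_cat pairwise_cat allrel_consr => /and3P[/andP[/allP uy _] _].
move=> /andP[/allP yv _]; rewrite /scal in ey; case: (boolP (sd y)) ey => sy ey.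
  rewrite -(@expect_lslot m u (b * beta) v (tm y)) //.
  - congr (E _); apply: eq_bigr => j _; rewrite -(cat1s _ v) !lprod_cat !rprod_cat lprod1 rprod1.
    rewrite sy /= mulr1 !mulrA ey -rmorphM [j == _]eq_sym.
    by case: eqP.
  - by move=> x /uy; rewrite /precedes sy; case: (sd x).
  - by move=> x /uy; rewrite /precedes sy; case: (sd x).
  - by move=> x /yv; rewrite /precedes sy; case: (sd x).
rewrite -(@expect_rslot m u (b * beta) v (tm y)) //.
- congr (E _); apply: eq_bigr => j _; rewrite -(cat1s _ v) !lprod_cat !rprod_cat lprod1 rprod1.
  rewrite (negPf sy) /= mul1r !mulrA ey -RbM [j == _]eq_sym.
  by case: eqP.
- by move=> x /yv; rewrite /precedes (negPf sy) => /andP[].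
- by move=> x /uy; rewrite /precedes (negPf sy); case: (sd x).
- by move=> x /yv; rewrite /precedes (negPf sy) => /andP[].
Qed.

(** Before a left letter the scalar moves back to time 0. If the first letter is a right one, all
    are: the scalar goes to the end of the product as [R b], is exchanged there for [L b], and
    commutes with all letters to the front. *)
Lemma NE_lead m b x w : ok m (x :: unzip2 w) -> NE m ((b, x) :: w) = b * NE m ((1, x) :: w).
Proof.
move=> okx; have [px vx] := okx.
have xm : (tm x < m)%N by apply: (proj1 (vx x _)); rewrite inE eqxx.
have vx' : {in unzip2 ([::] ++ ((1, x) :: w)), forall x, valid m x} by [].
have m0 : (0 < m)%N by apply: leq_ltn_trans xm.
move: px => /= /andP[/allP px _].
case: (boolP (sd x)) => sx.
  have := expect_lslot (u := [::]) (v := (1, x) :: w) b okx xm.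
  rewrite /= mulr1 => <- //; last first.
    move=> y; rewrite inE => /orP[/eqP->//|/px]; by rewrite /precedes sx => /implyP.
  rewrite -(lslot_move (t := 0%N) b vx') //.
    rewrite /NE -expect_l; congr (E _); case: m m0 {xm okx vx vx'} => // m _.
    rewrite /lslot /tprod !big_nat_recl //= !mulrA; congr (_ * _).
      by rewrite {1}/lprod big_nil mul1r.
    by apply: eq_bigr => j _; rewrite {1}/lprod big_nil !mul1r.
  move=> y; rewrite inE => /orP[/eqP->//|/px]; by rewrite /precedes sx => /implyP.
have nx : {in unzip2 ((1, x) :: w), forall x, ~~ sd x}.
  by move=> y; rewrite inE => /orP[/eqP->//|/px]; rewrite /precedes (negPf sx) => /andP[].
have := expect_rslot (u := [::]) (v := (1, x) :: w) (t := m.-1) b okx.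
rewrite /= mulr1 => <- //; last 2 first.
- by rewrite prednK.
- by move=> y yw _; rewrite -ltnS prednK //; apply: (proj1 (vx y _)).
rewrite rslot_end // -expect_LR -(comm_tprod_right _ _ vx') //.
by rewrite expect_l.
Qed.

Lemma NE_nil m : NE m [::] = 1.
Proof.
rewrite /NE /tprod big1 ?expect1 // => t _.
by rewrite /lprod /rprod /= !big_nil mulr1.
Qed.

End Letters.

Arguments precedes {K A} x y.
Arguments sd {K A} x.
Arguments tm {K A} x.
Arguments el {K A} x.

(** * Letters that are products, and cumulants of indexed families *)

Section Dressed.

Context (K : fieldType) (B A : algType K) (Sp : bb_space B A).

Local Notation L := (Lb Sp).
Local Notation R := (Rb Sp).
Local Notation E := (expect Sp).
Local Notation letter := (letter A).
Local Notation NE := (NE Sp).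
Local Notation ok := (ok Sp).
Local Notation scal := (scal Sp).
Implicit Types (x y : letter) (u v w : seq (B * letter)) (s : seq letter) (l : seq A).

Definition setel x (a : A) : letter := (x.1, a).

(** The factors are listed in the order of chi, which reverses the multiplication on the right
    side. *)
Definition prodl (s : bool) l : A :=
  if s then \prod_(a <- l) a else \prod_(a <- rev l) a.

Definition expand (b : B) x l : seq (B * letter) :=
  if l is a :: l' then (b, setel x a) :: [seq (1, setel x a) | a <- l'] else [::].

Lemma lprod_expand t b x l : l != [::] -> lprod Sp t (expand b x l) =
  lprod Sp t [:: (b, setel x (prodl (sd x) l))].
Proof.
case: l => // a l _; rewrite lprod1 /= -cat1s lprod_cat lprod1.
rewrite /lprod big_map /= /setel /sd /tm /=.
case: ifP => [/andP[sx tx]|h]; last first.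
  by rewrite big_pred0 ?mul1r // => c; rewrite h.
rewrite sx /el /= /prodl big_cons mulrA; congr (_ * _).
by apply: eq_bigr => c _; rewrite rmorph1 mul1r.
Qed.

Lemma rprod_expand t b x l : l != [::] -> rprod Sp t (expand b x l) =
  rprod Sp t [:: (b, setel x (prodl (sd x) l))].
Proof.
case: l => // a l _; rewrite rprod1 /= -cat1s rprod_cat rprod1.
rewrite /rprod -map_rev big_map /= /setel /sd /tm /=.
case: ifP => [/andP[sx tx]|h]; last first.
  by rewrite big_pred0 ?mulr1 // => c; rewrite h.
rewrite /el /= /prodl (negPf sx) rev_cons -cats1 big_cat big_seq1 /= mulrA.
by congr (_ * _ * _); apply: eq_bigr => c _; rewrite Rb1 mulr1.
Qed.

Lemma NE_expand m u b x l v : l != [::] ->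
  NE m (u ++ (b, setel x (prodl (sd x) l)) :: v) = NE m (u ++ expand b x l ++ v).
Proof.
move=> l0; congr (E _); apply: eq_bigr => t _.
rewrite -(cat1s _ v) !lprod_cat !rprod_cat.
by rewrite lprod_expand // rprod_expand.
Qed.

Lemma okP m s1 x s2 : ok m (s1 ++ x :: s2) <->
  [/\ ok m s1, ok m s2, valid Sp m x, allrel precedes s1 s2 &
      all (precedes^~ x) s1 /\ all (precedes x) s2].
Proof.
rewrite /ok pairwise_cat /= allrel_consr; split.
  case=> /and3P[/andP[h1 h2] h3 /andP[h4 h5]] h6; split=> //.
  - by split=> // y ys; apply: h6; rewrite mem_cat ys.
  - by split=> // y ys; apply: h6; rewrite mem_cat inE ys !orbT.
  - by apply: h6; rewrite mem_cat inE eqxx orbT.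
case=> -[h1 h2] [h3 h4] h5 h6 [h7 h8]; split; first by rewrite h7 h6 h1 h8 h3.
by move=> y; rewrite mem_cat inE => /or3P[/h2|/eqP->|/h4].
Qed.

Lemma precedes_shape x y z : x.1.1 = y.1.1 -> precedes x z = precedes y z.
Proof. by rewrite /precedes /sd /tm => ->. Qed.

Lemma precedes_shaper x y z : x.1.1 = y.1.1 -> precedes z x = precedes z y.
Proof. by rewrite /precedes /sd /tm => ->. Qed.

Lemma precedes_refl x y : x.1.1 = y.1.1 -> precedes x y.
Proof.
by move=> e; rewrite (precedes_shape _ e) /precedes; case: (sd y); rewrite /= leqnn.
Qed.

Lemma ok_replace m s1 x t s2 : ok m (s1 ++ x :: s2) ->
  {in t, forall y, y.1.1 = x.1.1 /\ valid Sp m y} -> ok m (s1 ++ t ++ s2).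
Proof.
move=> /okP[o1 o2 vx h12 [h1 h2]]; elim: t => [|y t IH] ht /=.
  split; first by rewrite pairwise_cat h12 (proj1 o1) (proj1 o2).
  by move=> y; rewrite mem_cat => /orP[/(proj2 o1)|/(proj2 o2)].
have [ey vy] := ht y (mem_head _ _).
have ht' : {in t, forall y, y.1.1 = x.1.1 /\ valid Sp m y}.
  by move=> z zt; apply: ht; rewrite inE zt orbT.
have [pw va] := IH ht'; have pt : all (precedes y) (t ++ s2).
  rewrite all_cat; apply/andP; split.
    by apply/allP => z /ht'[ez _]; apply: precedes_refl; rewrite ez.
  by rewrite -(eq_all (a1 := precedes x)) // => z; apply: precedes_shape.
apply/okP; move: pw; rewrite pairwise_cat => /and3P[a1 a2 a3]; split=> //; split=> //.
  by move=> z zs; apply: va; rewrite mem_cat zs orbT.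
by rewrite -(eq_all (a1 := precedes^~ x)) // => z; apply: precedes_shaper.
Qed.

Lemma valid_scal m x b : (tm x < m)%N -> valid Sp m (setel x (scal (sd x) b)).
Proof.
move=> xm; split=> //; rewrite /sd /= -/(sd x) /scal /el /=; case: (sd x) => d _ /=.
  by rewrite LbRbC.
by rewrite -LbRbC.
Qed.

Section DressedWord.

Context (T1 : eqType) (phi : T1 -> letter) (up vp : T1 -> B).

Definition dressed (k : T1) : letter :=
  let x := phi k in
  setel x (prodl (sd x) [:: scal (sd x) (up k); el x; scal (sd x) (vp k)]).

(** A dressed letter is split into three letters at the same time: a scalar, the element and a
    scalar. The two scalars are then absorbed by [NE_scalar]. *)
Lemma NE_dress m u p (w : seq (B * T1)) : ok m (unzip2 u ++ map phi (unzip2 w)) ->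
  sc p (fun h => NE m (u ++ h)) [seq (q.1, dressed q.2) | q <- w] =
  NE m (u ++ dress phi up vp p w) * trail vp p w.
Proof.
elim: w u p => [|[b k] w IH] u p /=; first by rewrite cats0.
set x := phi k => okx.
have vx : valid Sp m x by apply: (proj2 okx); rewrite mem_cat inE eqxx orbT.
have eta a : setel x a = (x.1, a) by [].
have ex : setel x (el x) = x by rewrite /setel /el; case: (x).
have letters_w : unzip2 [seq (q.1, dressed q.2) | q <- w] = map dressed (unzip2 w).
  by rewrite /unzip2 -!map_comp.
have okd (t w' : seq letter) : {in t, forall y : letter, y.1.1 = x.1.1 /\ valid Sp m y} ->
  (forall s, ok m (s ++ map phi (unzip2 w)) -> ok m (s ++ w')) ->
  ok m (unzip2 u ++ t ++ w').
  move=> ht hw; rewrite catA; apply: hw; rewrite -catA; exact: ok_replace okx ht.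
have okw s : ok m (s ++ map phi (unzip2 w)) -> ok m (s ++ map dressed (unzip2 w)).
  elim: (unzip2 w) s => //= k' w' IHw s oks.
  have := IHw (rcons s (dressed k')); rewrite !cat_rcons; apply.
  have vk : valid Sp m (phi k') by apply: (proj2 oks); rewrite mem_cat inE eqxx orbT.
  apply: (ok_replace (t := [:: dressed k']) oks) => y; rewrite inE => /eqP->; split=> //.
  split; first by case: vk.
  case: vk => _; rewrite /dressed /sd /= -/(sd _) /el /= /prodl.
  case: (sd (phi k')) => h d _; rewrite !big_cons !big_nil mulr1 /scal /= -!mulrA.
    by rewrite LbRbC (mulrA _ (R d)) h // -!mulrA mulrA LbRbC -mulrA.
  by rewrite -LbRbC (mulrA _ (L d)) h // -!mulrA mulrA -LbRbC -mulrA.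
have sc_ok b' : valid Sp m (setel x (scal (sd x) b')).
  by apply: valid_scal; case: vx.
rewrite /dressed -/x NE_expand //=.
rewrite (NE_scalar (beta := up k)) //; last first.
  rewrite unzip2_cat /= letters_w.
  apply: (okd [:: _; _; _] _ _ okw) => y; rewrite !inE => /or3P[]/eqP->; split=> //; by [exact: sc_ok|rewrite ex].
rewrite /= ex mulr1 -cat_rcons (NE_scalar (beta := vp k)) //; last first.
  rewrite unzip2_cat /= /unzip2 map_rcons cat_rcons -/(unzip2 _) -/(unzip2 _) letters_w.
  apply: (okd [:: _; _] _ _ okw) => y; rewrite !inE => /orP[]/eqP->; split=> //; exact: sc_ok.
rewrite mul1r IH ?cat_rcons //.
by rewrite /unzip2 map_rcons cat_rcons.
Qed.

End DressedWord.

Section CumulantOfWord.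

Context (D0 : B -> Prop) (G : B -> B) (GD : cond_exp D0 G).

Lemma prod_sub m (f f1 f2 : nat -> A) t : (t < m)%N ->
  (forall j, j != t -> f j = f1 j /\ f j = f2 j) -> f t = f1 t - f2 t ->
  \prod_(0 <= j < m) f j = \prod_(0 <= j < m) f1 j - \prod_(0 <= j < m) f2 j.
Proof.
move=> ht h e; have split2 g : \prod_(0 <= j < m) g j =
    \prod_(0 <= j < t) g j * (g t * \prod_(t.+1 <= j < m) g j) :> A.
  rewrite (@big_cat_nat _ _ _ t 0 m) //=; last exact: ltnW.
  by rewrite [\prod_(t <= i < m) _]big_ltn.
rewrite !split2 e mulrBl mulrBr; congr (_ * (_ * _) - _ * (_ * _));
  apply: eq_big_nat => j /andP[h1 h2];
  by have [] := h j _; rewrite ?(ltn_eqF h2) ?(gtn_eqF h1).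
Qed.

Lemma NE_sub m u b b' y v : (tm y < m)%N ->
  NE m (u ++ (b - b', y) :: v) = NE m (u ++ (b, y) :: v) - NE m (u ++ (b', y) :: v).
Proof.
move=> ym; rewrite /NE -raddfB; congr (E _); apply: (prod_sub ym) => [j jy|].
  by rewrite -!(cat1s _ v) !lprod_cat !rprod_cat !lprod1 !rprod1 [_ == j]eq_sym (negPf jy) !andbF.
rewrite -!(cat1s _ v) !lprod_cat !rprod_cat !lprod1 !rprod1 eqxx !andbT.
case: (sd y) => /=; first by rewrite raddfB !(mulrBl, mulrBr).
by rewrite raddfB !(mulrBl, mulrBr).
Qed.

(* Moments of words for the expectation [G \o E]; the leading coefficient is
   pulled out so that it need not lie in [D0]. *)
Definition Nx m w : B :=
  if w is (b, x) :: w' then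
    if all (fun y => tm y < m)%N (x :: unzip2 w') then b * G (NE m ((1, x) :: w')) else 0
  else 1.

(** The product ignores a letter whose time is not below [m], which would spoil additivity in its
    coefficient; the test on times in [Nx] gives such words the value zero. *)
Lemma Nx_add m : fadd (Nx m).
Proof.
case=> [|[c x] u] b b' y v /=.
  by case: ifP => _; rewrite ?subr0 // mulrBl.
rewrite /unzip2 !map_cat /=; case: ifP => h; last by rewrite subr0.
rewrite -mulrBr -(ce_sub GD) -!cat_cons NE_sub //.
by move: h; rewrite all_cat /= => /and4P[].
Qed.

Lemma ok_time m s : ok m s -> all (fun y => tm y < m)%N s.
Proof. by case=> _ v; apply/allP => y /v[]. Qed.

Lemma Nx_ok m b x w : ok m (x :: unzip2 w) -> Nx m ((b, x) :: w) = b * G (NE m ((1, x) :: w)).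
Proof. by move=> /ok_time h; rewrite /Nx h. Qed.

Lemma Nx_is_mom okp m : is_mom okp (cum (Nx m)) (Nx m).
Proof. by apply: cum_is_mom => // b x w /=; case: ifP; rewrite ?mulr0 // mul1r. Qed.

Section Indexed.

Context (n : nat) (phi : 'I_n -> letter) (m : nat).
Context (phi_lt : forall i j : 'I_n, (i < j)%N ->
  ((tm (phi i)).*2 + ~~ sd (phi i) <= (tm (phi j)).*2 + ~~ sd (phi j))%N).
Context (phi_valid : forall i, valid Sp m (phi i)).

Let chi (k : 'I_n) := sd (phi k).

Lemma enum_ord_pairwise : pairwise (fun i j : 'I_n => i < j)%N (enum 'I_n).
Proof.
by have := iota_ltn_sorted 0 n; rewrite -val_enum_ord (sorted_pairwise ltn_trans) pairwise_map.
Qed.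

(** The key of a letter, twice its time plus one on the right side, numbers the factors of [tprod]
    from left to right. As it grows weakly along the indices, the chi-order of the indices lists the
    letters as words require. *)
Lemma chi_seq_ok : ok m (map phi (chi_seq chi)).
Proof.
split; last by move=> x /mapP[k _ ->]; apply: phi_valid.
have key (i j : 'I_n) : (i < j)%N -> chi i = chi j -> (tm (phi i) <= tm (phi j))%N.
  by rewrite /chi => /phi_lt h cij; move: h; rewrite cij leq_add2r leq_double.
rewrite pairwise_map /chi_seq pairwise_cat; apply/and3P; split.
- apply/allrelP => i j; rewrite mem_filter => /andP[ci _].
  rewrite mem_rev mem_filter => /andP[cj _].
  by rewrite /= /precedes -/(chi i) -/(chi j) ci (negPf cj).
- have h : pairwise (fun i j : 'I_n => i < j)%N [seq k <- enum 'I_n | chi k].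
    exact: pairwise_filter enum_ord_pairwise.
  apply: (sub_in_pairwise (P := chi)) h; last exact: filter_all.
  move=> i j ci cj ij /=; rewrite /precedes -/(chi i) -/(chi j) (ci : chi i).
  by rewrite (cj : chi j) /=; apply: key => //; rewrite (ci : chi i) (cj : chi j).
- have h : pairwise (fun i j : 'I_n => j < i)%N (rev [seq k <- enum 'I_n | ~~ chi k]).
    rewrite -sorted_pairwise; last by move=> a b c ba cb; apply: ltn_trans cb ba.
    rewrite rev_sorted; apply: pairwise_sorted.
    exact: pairwise_filter enum_ord_pairwise.
  apply: (sub_in_pairwise (P := predC chi)) h; last by rewrite all_rev filter_all.
  move=> i j ci cj ij /=; rewrite /precedes -/(chi i) -/(chi j).
  rewrite (negPf (ci : ~~ chi i)) (cj : ~~ chi j) /=; apply: key => //.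
  by rewrite (negPf (ci : ~~ chi i)) (negPf (cj : ~~ chi j)).
Qed.

(** The indices are grouped by key: class [2t] holds the left factors at time [t], class [2t + 1]
    the right ones. *)
Lemma prod_indexed (S : {set 'I_n}) (f : 'I_n -> A) :
  \prod_(k in S) f k = \prod_(0 <= t < m)
    (\prod_(k <- seqS chi S | chi k && (tm (phi k) == t)) f k *
     \prod_(k <- rev (seqS chi S) | ~~ chi k && (tm (phi k) == t)) f k).
Proof.
pose key k := ((tm (phi k)).*2 + ~~ chi k)%N.
have ie : index_enum _ = enum 'I_n by rewrite enumT [index_enum _]unlock.
pose e := [seq k <- enum 'I_n | k \in S].
rewrite -big_filter ie -/e -[e](@flatten_classes _ key m.*2); last 2 first.
- apply: pairwise_filter; apply: sub_pairwise enum_ord_pairwise; exact: phi_lt.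
- apply/allP => k _; rewrite /key; have [+ _] := phi_valid k.
  by case: (chi k) => /=; lia.
rewrite big_flatten big_map -{1}(subn0 m.*2) -/(index_iota 0 m.*2) prod_pairs.
have fil p : [seq k <- seqS chi S | chi k && p k] = [seq k <- e | chi k && p k].
  rewrite /seqS /chi_seq !filter_cat !filter_rev -!filter_predI.
  rewrite [X in rev X](eq_filter (a2 := pred0)) ?filter_pred0 ?cats0.
    by apply: eq_filter => k /=; case: (chi k); rewrite ?andbT ?andbF.
  by move=> k /=; case: (chi k); rewrite ?andbT ?andbF.
have filr p : [seq k <- rev (seqS chi S) | ~~ chi k && p k] = [seq k <- e | ~~ chi k && p k].
  rewrite filter_rev /seqS /chi_seq !filter_cat !filter_rev rev_cat revK -!filter_predI.
  rewrite [X in _ ++ rev X](eq_filter (a2 := pred0)) ?filter_pred0 ?cats0.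
    by apply: eq_filter => k /=; case: (chi k); rewrite ?andbT ?andbF.
  by move=> k /=; case: (chi k); rewrite ?andbT ?andbF.
apply: eq_bigr => t _; congr (_ * _).
  rewrite -[RHS]big_filter fil; congr (\prod_(k <- _) _); apply: eq_filter => k.
  by rewrite /key; case: (chi k) => /=; lia.
rewrite -[RHS]big_filter filr; congr (\prod_(k <- _) _); apply: eq_filter => k.
by rewrite /key; case: (chi k) => /=; lia.
Qed.

Definition Nidx (w : seq (B * 'I_n)) : B := Nx m [seq (p.1, phi p.2) | p <- w].

Lemma Nidx_add : fadd Nidx.
Proof. by move=> u b b' y v; rewrite /Nidx !map_cat /=; apply: Nx_add. Qed.

Lemma Nidx_is_mom okp : is_mom okp (cum Nidx) Nidx.
Proof.
by apply: cum_is_mom => // b x w; rewrite /Nidx /=; case: ifP; rewrite ?mulr0 // mul1r.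
Qed.

Lemma seqS_ok (S : {set 'I_n}) : ok m (map phi (seqS chi S)).
Proof. by apply: ok_sub chi_seq_ok; apply: map_subseq; apply: filter_subseq. Qed.

(** Inserting scalars after letters is a dressing whose scalars in front are 1. The scalar trailing
    the last letter has to pass through [G], hence the condition that the [c k] lie in [D0]. *)
Lemma Nidx_insert (S : {set 'I_n}) (c : 'I_n -> B) : S != finset.set0 ->
  (forall k, D0 (c k)) ->
  G (E (\prod_(k in S) insert_after Sp chi (fun k => el (phi k)) c k)) =
  word_val Nidx (seqS chi S) c.
Proof.
move=> S0 Dc; have := seqS_ok S; have : seqS chi S != [::] by rewrite seqS0.
rewrite prod_indexed; move: (seqS chi S) => s s0 oks.
pose w := [seq ((1 : B), k) | k <- s].
have ew : unzip2 w = s by rewrite /w /unzip2 -map_comp map_id.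
pose vp k : B := c k; pose up (k : 'I_n) : B := 1.
have -> : \prod_(0 <= t < m)
     (\prod_(k <- s | chi k && (tm (phi k) == t)) insert_after Sp chi (fun k => el (phi k)) c k *
      \prod_(k <- rev s | ~~ chi k && (tm (phi k) == t)) insert_after Sp chi (fun k => el (phi k)) c k)
   = tprod Sp m [seq (p.1, dressed phi up vp p.2) | p <- w].
  apply: eq_bigr => t _; rewrite /lprod /rprod -!map_rev !big_map; congr (_ * _).
    apply: eq_bigr => k /andP[ck _]; rewrite rmorph1 mul1r /insert_after ck.
    by rewrite /el /= /prodl -/(chi k) ck !big_cons big_nil /scal /up rmorph1 mul1r mulr1.
  apply: eq_bigr => k /andP[ck _]; rewrite Rb1 mulr1 /insert_after (negPf ck).
  rewrite /el /= /prodl -/(chi k) (negPf ck) !big_cons big_nil /scal /up Rb1 !mulr1.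
  by [].
have := @NE_dress _ phi up vp m [::] 1 w; rewrite ew => /(_ oks).
have -> : sc 1 (fun h => NE m ([::] ++ h)) [seq (q.1, dressed phi up vp q.2) | q <- w] =
   NE m [seq (q.1, dressed phi up vp q.2) | q <- w].
  by rewrite /w; case: (s) s0 => //= k s' _; rewrite mul1r.
rewrite /NE => ->.
have wE p : dress phi up vp p w = [seq (q.1, phi q.2) | q <- wdp p s c].
  by rewrite /w; elim: (s) p => //= k s' IH p; rewrite !mulr1 IH.
have tE p : trail vp p w = pend p s c.
  by rewrite /w; elim: (s) p => //= k s' IH p; rewrite IH.
have Dp p : D0 p -> D0 (pend p s c) by elim: (s) p => //= k s' IH p _; apply: IH.
rewrite (ce_r GD); last by rewrite tE; apply: Dp; apply: (ce1 GD).
rewrite /word_val tE wE /Nidx; case: (s) s0 oks => // k s' _ oks /=.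
rewrite ifT ?mul1r //; move: (ok_time oks) => /=.
by rewrite /unzip2 -map_comp (map_comp phi snd) -/(unzip2 _) unzip2_wdp.
Qed.

Lemma cumulant_indexed k (s : seq 'I_n) : chi_seq chi = k :: s ->
  cumulant Sp (fun a => G (E a)) chi (fun k => el (phi k)) =
  cum Nidx k [seq ((1 : B), k) | k <- s].
Proof.
move=> e; have D1 := ce1 GD; have DG := ce_in GD.
apply: (@cumulantE _ _ _ Sp (fun a => G (E a)) _ _ _ D0 (ce0 GD) (ceM GD) _ _ Nidx) => //.
- exact: Nidx_is_mom.
- by apply: cum_add; apply: Nidx_add.
- exact: Nidx_insert.
Qed.

End Indexed.

(** The dressing is absorbed into coefficients, so a cumulant of multiplied elements becomes a word
    cumulant of the bare letters. The scalars at both ends pass through [G], hence lie in [D0]. *)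
Theorem cumulant_dressed n (phi : 'I_n -> letter) m (up vp : 'I_n -> B) k (s : seq 'I_n) :
  (forall i j : 'I_n, (i < j)%N ->
    ((tm (phi i)).*2 + ~~ sd (phi i) <= (tm (phi j)).*2 + ~~ sd (phi j))%N) ->
  (forall i, valid Sp m (phi i)) ->
  (forall i, D0 (up i)) -> (forall i, D0 (vp i)) ->
  chi_seq (fun k => sd (phi k)) = k :: s ->
  let w := [seq ((1 : B), k) | k <- s] in
  cumulant Sp (fun a => G (E a)) (fun k => sd (phi k)) (fun k => el (dressed phi up vp k)) =
  up k * cum (Nx m) (phi k) (dress phi up vp (vp k) w) * trail vp (vp k) w.
Proof.
move=> lt va Du Dv e w.
have vd i : valid Sp m (dressed phi up vp i).
  have [vt ve] := va i; split=> //; move: ve.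
  rewrite /dressed /sd /= -/(sd _) /el /= /prodl.
  case: (sd (phi i)) => h d _; rewrite !big_cons !big_nil mulr1 /scal /= -!mulrA.
    by rewrite LbRbC (mulrA _ (R d)) h // -!mulrA mulrA LbRbC -mulrA.
  by rewrite -LbRbC (mulrA _ (L d)) h // -!mulrA mulrA -LbRbC -mulrA.
rewrite (cumulant_indexed (phi := dressed phi up vp) (m := m) _ vd e) //.
apply: (@cum_dress _ _ _ phi up vp (fun t : seq 'I_n => ok m (map phi t)) (ok m) _ _ _ (Nidx (dressed phi up vp) m) _ (Nx m)).
- by move=> s1 s2 ss; apply: ok_sub; apply: map_subseq.
- by [].
- exact: Nidx_is_mom.
- exact: Nx_is_mom.
- case=> [|[b x] w'] okw; first by rewrite /= mulr1.
  have okt : all (fun y : letter => tm y < m)%N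
     [seq dressed phi up vp i | i <- x :: unzip2 w'].
    by apply/allP => y /mapP[i _ ->]; case: (vd i).
  rewrite /Nidx /= ifT; last first.
    by move: okt; rewrite /= /unzip2 -!map_comp.
  have := @NE_dress _ phi up vp m [::] 1 ((1, x) :: w') okw.
  rewrite /= !mul1r => ->; rewrite (NE_lead (up x)); last by rewrite unzip2_dress.
  rewrite ifT; last by move: (ok_time okw); rewrite /= unzip2_dress.
  have Dt p : D0 p -> D0 (trail vp p w') by elim: (w') p => //= -[b' k'] w'' IH p _; apply: IH.
  rewrite (ce_r GD); last exact: Dt.
  by rewrite (ce_l GD) ?mulrA; last exact: Du.
- by rewrite /w /unzip2 -map_comp map_id -e; apply: chi_seq_ok.
Qed.

End CumulantOfWord.

(** To serve as arguments of a cumulant, the letters need a natural order: they are sorted by key,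
    starting from [sl ++ rev sr]. The sort is stable, so filtering by side gives back each half. *)
Lemma retime s : pairwise precedes s -> exists n (phi : 'I_n -> letter),
  (forall i j : 'I_n, (i < j)%N ->
    ((tm (phi i)).*2 + ~~ sd (phi i) <= (tm (phi j)).*2 + ~~ sd (phi j))%N) /\
  map phi (chi_seq (fun k => sd (phi k))) = s.
Proof.
move=> ps; pose key x := ((tm x).*2 + ~~ sd x)%N.
pose le x y := (key x <= key y)%N.
have le_tr : transitive le by move=> a b c; apply: leq_trans.
have le_tot : total le by move=> a b; apply: leq_total.
pose sl := [seq x <- s | sd x]; pose sr := [seq x <- s | ~~ sd x].
have es : s = sl ++ sr.
  rewrite /sl /sr; elim: s ps {sl sr} => //= x s IH /andP[/allP px ps].
  case: ifP => sx /=; first by rewrite -IH.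
  rewrite (eq_in_filter (a2 := pred0)) ?filter_pred0 /=; last first.
    by move=> y /px; rewrite /precedes sx => /andP[/negPf].
  congr (_ :: _); rewrite (eq_in_filter (a2 := predT)) ?filter_predT //.
  by move=> y /px; rewrite /precedes sx => /andP[].
have [l lE] : {l | l = sort le (sl ++ rev sr)} by exists (sort le (sl ++ rev sr)).
have psl : pairwise le sl.
  have := pairwise_filter sd ps; apply: (sub_in_pairwise (P := sd)); last exact: filter_all.
  move=> x y sx sy; rewrite /precedes /le /key (sx : sd x) (sy : sd y) /=.
  by rewrite !addn0 leq_double.
have psr : pairwise le (rev sr).
  rewrite -sorted_pairwise // rev_sorted; apply: pairwise_sorted.
  have := pairwise_filter (predC sd) ps; apply: (sub_in_pairwise (P := predC sd)); last exact: filter_all.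
  move=> x y sx sy; rewrite /precedes /le /key (negPf (sx : ~~ sd x)) (sy : ~~ sd y) /=.
  by rewrite leq_add2r leq_double.
exists (size l), (tnth (in_tuple l)); split.
  move=> i j ij; have : pairwise le l by rewrite lE -sorted_pairwise //; apply: sort_sorted.
  have x0 : letter := tnth (in_tuple l) i.
  by rewrite !(tnth_nth x0) => /(pairwiseP x0) h; apply: h => //; rewrite inE ltn_ord.
have fs p : [seq x <- l | p x] = sort le ([seq x <- sl | p x] ++ rev [seq x <- sr | p x]).
  by rewrite lE (filter_sort le_tot le_tr) filter_cat filter_rev.
have f1 : [seq x <- sl | ~~ sd x] = [::].
  rewrite -filter_predI (eq_filter (a2 := pred0)) ?filter_pred0 // => x /=.
  by rewrite andNb.
have f2 : [seq x <- sr | sd x] = [::].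
  rewrite -filter_predI (eq_filter (a2 := pred0)) ?filter_pred0 // => x /=.
  by rewrite andbN.
have fm p : [seq tnth (in_tuple l) i | i <- enum 'I_(size l) & p (tnth (in_tuple l) i)] =
    [seq x <- l | p x].
  have el : [seq tnth (in_tuple l) i | i <- enum 'I_(size l)] = l := map_tnth_enum (in_tuple l).
  by transitivity (filter p [seq tnth (in_tuple l) i | i <- enum 'I_(size l)]); [rewrite filter_map|rewrite el].
rewrite /chi_seq map_cat map_rev (fm sd) (fm (fun x => ~~ sd x)) !fs f1 f2.
by rewrite !filter_id cats0 cat0s !sorted_sort ?sorted_pairwise // revK -es.
Qed.

End Dressed.

(** * The coefficients of kappa *)

Section NaturalOrder.

Context (n : nat) (chi : 'I_n -> bool).
Implicit Types (p q k : 'I_n).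

Lemma chi_ltP p q : chi_lt chi p q ->
  if chi p then chi q ==> (p < q)%N else ~~ chi q && (q < p)%N.
Proof.
pose phi k : nat * bool := (k : nat, chi k).
pose r p q := if chi p then chi q ==> (p < q)%N else ~~ chi q && (q < p)%N.
have en : pairwise (fun i j : 'I_n => i < j)%N (enum 'I_n) by apply: enum_ord_pairwise.
have pr : pairwise r (chi_seq chi).
  rewrite /chi_seq pairwise_cat; apply/and3P; split.
  - apply/allrelP => i j; rewrite mem_filter => /andP[ci _].
    by rewrite mem_rev mem_filter => /andP[cj _]; rewrite /r ci (negPf cj).
  - apply: (sub_in_pairwise (P := chi)) (pairwise_filter chi en); last exact: filter_all.
    by move=> i j ci cj ij; rewrite /r (ci : chi i) (cj : chi j).
  - have h : pairwise (fun i j : 'I_n => j < i)%N (rev [seq k <- enum 'I_n | ~~ chi k]).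
      rewrite -sorted_pairwise; last by move=> a b c ba cb; apply: ltn_trans cb ba.
      by rewrite rev_sorted; apply: pairwise_sorted; apply: pairwise_filter en.
    apply: (sub_in_pairwise (P := predC chi)) h; last by rewrite all_rev filter_all.
    by move=> i j ci cj ij; rewrite /r (negPf (ci : ~~ chi i)) (cj : ~~ chi j).
rewrite /chi_lt => pq.
have ip : (index p (chi_seq chi) < size (chi_seq chi))%N by rewrite index_mem mem_chi_seq.
have iq : (index q (chi_seq chi) < size (chi_seq chi))%N by rewrite index_mem mem_chi_seq.
move/(pairwiseP p): pr => /(_ _ _ ip iq pq).
by rewrite !nth_index ?mem_chi_seq.
Qed.

Definition adj p q : bool := index q (chi_seq chi) == (index p (chi_seq chi)).+1.

Lemma adj_lt p q : adj p q -> chi_lt chi p q.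
Proof. by rewrite /adj /chi_lt => /eqP->. Qed.

Lemma adj_between p q k : adj p q -> chi_lt chi p k -> chi_lt chi k q -> False.
Proof. by rewrite /adj /chi_lt => /eqP-> h1 h2; have := leq_trans h2 h1; rewrite ltnn. Qed.

Lemma adj_inj p q q' : adj p q -> adj p q' -> q = q'.
Proof.
rewrite /adj => /eqP e /eqP e'.
by rewrite -(nth_index q (mem_chi_seq chi q)) e -e' nth_index ?mem_chi_seq.
Qed.

Lemma chi_lt_total p q : p != q -> chi_lt chi p q || chi_lt chi q p.
Proof. exact: lt_total. Qed.

(* The chi-predecessor of [q] (and [q] itself when it is the first element). *)
Definition prev q : 'I_n := nth q (chi_seq chi) (index q (chi_seq chi)).-1.

Lemma adj_prev x s q : chi_seq chi = x :: s -> q \in s -> adj (prev q) q.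
Proof.
move=> e qs; rewrite /adj /prev.
have u : uniq (x :: s) by rewrite -e chi_seq_uniq.
have qx : q != x by apply: contraTneq qs => ->; case/andP: u.
have iq : (0 < index q (chi_seq chi))%N by rewrite e /= eq_sym (negPf qx).
have lt : (index q (chi_seq chi) < size (chi_seq chi))%N by rewrite index_mem mem_chi_seq.
by rewrite index_uniq ?chi_seq_uniq ?prednK // ltnW.
Qed.

Lemma path_adj x s : chi_seq chi = x :: s -> path adj x s.
Proof.
move=> e; apply/(pathP x) => i si; rewrite /adj -e -[nth x s i]/(nth x (x :: s) i.+1).
by rewrite -e !index_uniq ?chi_seq_uniq // e //= ltnS ltnW.
Qed.

Lemma adj_prevE p q : adj p q -> prev q = p.
Proof.
by rewrite /adj /prev => /eqP->; rewrite nth_index ?mem_chi_seq.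
Qed.

Lemma trail_last (B : pzRingType) (vp : 'I_n -> B) x s : forall d, trail vp (vp x) [seq (d, k) | k <- s] = vp (last x s).
Proof. by elim: s x => //= y s IH x d; rewrite IH. Qed.

End NaturalOrder.

Section Kappa.

Context (K : fieldType) (B A : algType K) (Sp : bb_space B A).
Context (I J : Type) (ZI : I -> A) (ZJ : J -> A).
Context (n : nat) (omega : 'I_n.+1 -> I + J).
Local Notation chi := (chi_of omega).
Implicit Types (p q k : 'I_n.+1) (b : n.-tuple B).

(* [inner k]: a coefficient is attached to the variable [k], and it is the
   coefficient of index [coef_index k]. *)
Definition inner k : bool :=
  (k != ord0) && (if first_change omega is Some k0 then k != k0 else true).

Definition coef_index k : nat :=
  if first_change omega is Some k0 then if (k < k0)%N then k.-1 else k.-2 else k.-1.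

(** The index of the coefficient between [q] and its chi-predecessor. Between left variables it is
    attached to [q]; between right ones to the predecessor, whose [R] comes after it in the order of
    chi; at the turn it is the last coefficient, put at the end of the product. *)
Definition slot q : nat :=
  if chi (prev chi q) then if chi q then coef_index q else n.-1
  else coef_index (prev chi q).

Lemma first_changeP : match first_change omega with
  | Some k0 => [/\ chi k0 != chi ord0, forall j : 'I_n.+1, (j < k0)%N -> chi j = chi ord0 & (0 < k0)%N]
  | None => forall k, chi k = chi ord0 end.
Proof.
rewrite /first_change; case: pickP => [k0 /andP[ck /'forall_implyP h]|none].
  split=> // [j /h/eqP //|]; rewrite lt0n; apply: contraNneq ck => k0E.
  by have -> : k0 = ord0 by apply/val_inj.
suff H m : forall k, (k < m)%N -> chi k = chi ord0.
  by move=> k; apply: (H k.+1).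
elim: m => // m IH k km; have := none k.
case: (chi k =P chi ord0) => //= _; case/'forall_implyP => j jk.
by apply/eqP; apply: IH; apply: leq_trans jk _.
Qed.

(** A scalar multiplied from the left comes, in the order of chi, before a left variable but after a
    right one; the extra scalar at the end of the product behaves the other way round. *)
Let upd_b b : 'I_n.+1 -> B := fun k =>
  if chi k then if inner k then b`_(coef_index k) else 1
  else if (k == ord_max) && (first_change omega != None) then b`_n.-1 else 1.
Let vpd_b b : 'I_n.+1 -> B := fun k =>
  if chi k then if (k == ord_max) && (first_change omega != None) then b`_n.-1 else 1
  else if inner k then b`_(coef_index k) else 1.

Lemma not_first p q : chi p = chi q -> (p < q)%N -> inner q.
Proof.
have := first_changeP; rewrite /inner => fc e pq; apply/andP; split.
  by apply: contraTneq pq => ->.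
case: (first_change omega) fc => [k0 [c0 ck _]|//].
by apply: contraNneq c0 => qk; rewrite -qk -e; apply/eqP/ck; rewrite -qk.
Qed.

Lemma adj_inner p q : adj chi p q -> chi p = chi q ->
  inner (if chi q then q else p) /\ (if chi q then p else q) != ord_max.
Proof.
move=> a e; have := chi_ltP (adj_lt a); rewrite e; case: ifP => cq; rewrite cq /= => pq.
  split; first exact: not_first e pq.
  by apply: contraTneq pq => ->; rewrite -leqNgt leq_ord.
split; first exact: not_first (esym e) pq.
by apply: contraTneq pq => ->; rewrite -leqNgt leq_ord.
Qed.

(** The order turns once, from left to right. The last index is the latest of its side, so it stands
    at the turn. *)
Lemma adj_change p q : adj chi p q -> chi p != chi q ->
  [/\ chi p, ~~ chi q, first_change omega != None & (p == ord_max) (+) (q == ord_max)].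
Proof.
move=> a ne; have := chi_ltP (adj_lt a).
have [cp cq] : chi p /\ ~~ chi q.
  by have := chi_ltP (adj_lt a); move: ne; case: (chi p); case: (chi q).
move=> _; split=> //.
  have := first_changeP; case: (first_change omega) => // h.
  by case/eqP: ne; rewrite !h.
have pq : p != q by apply: contraNneq ne => ->.
case: (eqVneq p ord_max) => [pm|pm] /=; first by rewrite -pm eq_sym (negPf pq).
case: (eqVneq q ord_max) => [//|qm] /=.
have ltm k : k != ord_max -> (k < @ord_max n)%N.
  by move=> km; have := leq_ord k; rewrite leq_eqVlt => /orP[/eqP e|//]; case/eqP: km; apply/val_inj.
exfalso; case cm : (chi ord_max).
  apply: (adj_between (k := ord_max) a).
    have [//|h] := orP (chi_lt_total chi pm); have := chi_ltP h.
    by rewrite cm cp /= ltnNge leq_ord.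
  have ne' : @ord_max n != q by rewrite eq_sym.
  have [//|h] := orP (chi_lt_total chi ne'); have := chi_ltP h.
  by rewrite (negPf cq) cm.
apply: (adj_between (k := ord_max) a).
  have [//|h] := orP (chi_lt_total chi pm); have := chi_ltP h.
  by rewrite cm cp.
have ne' : @ord_max n != q by rewrite eq_sym.
have [//|h] := orP (chi_lt_total chi ne'); have := chi_ltP h.
by rewrite (negPf cq) cm /= => /ltnW; rewrite leqNgt ltm.
Qed.

Lemma coef_index_inj p q : inner p -> inner q -> coef_index p = coef_index q -> p = q.
Proof.
have := first_changeP; rewrite /inner /coef_index.
case: (first_change omega) => [k0 [_ _ k0_0]|_] /andP[p0 pk] /andP[q0 qk] e; apply/val_inj => /=.
  move: e p0 q0 pk qk; rewrite -!val_eqE /=.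
  by case: ltnP => h1; case: ltnP => h2; lia.
by move: e p0 q0; rewrite -!val_eqE /=; lia.
Qed.

Lemma coef_index_lt p : inner p ->
  (coef_index p < if first_change omega is Some _ then n.-1 else n)%N.
Proof.
have := first_changeP; rewrite /inner /coef_index.
have pn := leq_ord p; case: (first_change omega) => [k0 [_ _ k0_0]|_] /andP[p0 pk].
  have kn := leq_ord k0.
  by move: p0 pk; rewrite -!val_eqE /=; case: ifP => h1; lia.
by move: p0; rewrite -!val_eqE /=; lia.
Qed.

Lemma n_gt0 : first_change omega != None -> (0 < n)%N.
Proof.
have := first_changeP; case: (first_change omega) => // k0 [_ _ k0_0] _.
exact: leq_trans k0_0 (leq_ord k0).
Qed.

Lemma slot_adj p q : adj chi p q ->
  slot q = if chi p then if chi q then coef_index q else n.-1 else coef_index p.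
Proof. by move=> a; rewrite /slot (adj_prevE a). Qed.

Lemma slot_lt x s q : chi_seq chi = x :: s -> q \in s -> (slot q < n)%N.
Proof.
move=> e /(adj_prev e) a; rewrite (slot_adj a); move: (prev chi q) a => p a.
have cl k : inner k -> (coef_index k < n)%N.
  move/coef_index_lt; case: (first_change omega) => [_|//] h.
  exact: leq_trans h (leq_pred _).
case: (eqVneq (chi p) (chi q)) => [epq|ne].
  by have [+ _] := adj_inner a epq; rewrite epq; case: (chi q) => /cl.
by have [-> /negPf-> /n_gt0 n0 _] := adj_change a ne; rewrite prednK.
Qed.

(** When both sides occur, the coefficients attached to inner variables have distinct indices below
    [n.-1], and [n.-1] is left for the unique turn. Hence the coefficients of a word can be
    prescribed freely. *)
Lemma slot_inj x s : chi_seq chi = x :: s -> {in s &, injective slot}.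
Proof.
move=> e q q' /(adj_prev e) a /(adj_prev e) a'.
move: (prev chi q) (prev chi q') a a' => p p' a a'.
rewrite (slot_adj a) (slot_adj a').
have big k : first_change omega != None -> inner k -> coef_index k <> n.-1.
  move=> fc /coef_index_lt; case: (first_change omega) fc => // k0 _ h e'.
  by rewrite e' ltnn in h.
case: (eqVneq (chi p) (chi q)) => [epq|ne]; case: (eqVneq (chi p') (chi q')) => [epq'|ne'].
- have [i1 _] := adj_inner a epq; have [i2 _] := adj_inner a' epq'.
  rewrite epq epq'; case cq : (chi q) i1 => i1; case cq' : (chi q') i2 => i2 h.
  + exact: coef_index_inj h.
  + have e' := coef_index_inj i1 i2 h; move: cq; by rewrite e' epq' cq'.
  + have e' := coef_index_inj i1 i2 h; move: cq'; by rewrite -e' epq cq.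
  + have e' := coef_index_inj i1 i2 h; move: a'; rewrite -e' => a'.
    exact: adj_inj a a'.
- have [i1 _] := adj_inner a epq; have [-> /negPf-> fc _] := adj_change a' ne'.
  by rewrite epq; case: (chi q) i1 => i1 /(big _ fc i1).
- have [i1 _] := adj_inner a' epq'; have [-> /negPf-> fc _] := adj_change a ne.
  by rewrite epq'; case: (chi q') i1 => i1 /esym/(big _ fc i1).
have [cp cq _ _] := adj_change a ne; have [cp' cq' _ _] := adj_change a' ne' => _.
have pp : p = p'.
  have half r r' t t' : adj chi r t -> adj chi r' t' -> chi r -> chi r' -> ~~ chi t -> ~~ chi t' ->
      chi_lt chi r r' -> False.
    move=> ar ar' cr cr' ct ct' h; apply: (adj_between ar h).
    have ne2 : r' != t by apply: contraNneq ct => <-.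
    have [//|h'] := orP (chi_lt_total chi ne2); have := chi_ltP h'.
    by rewrite (negPf ct) cr'.
  apply/eqP/negPn/negP => npp; have [h|h] := orP (chi_lt_total chi npp).
    exact: (half p p' q q').
  exact: (half p' p q' q).
by move: a'; rewrite -pp => a'; apply: adj_inj a a'.
Qed.

Lemma kappa_argsE b k : kappa_args Sp ZI ZJ omega b k =
  prodl (chi k) [:: scal Sp (chi k) (upd_b b k); var ZI ZJ (omega k);
                    scal Sp (chi k) (vpd_b b k)].
Proof.
have := first_changeP; rewrite /kappa_args /upd_b /vpd_b /inner /coef_index /Cb /prodl /scal.
have L1 : Lb Sp 1 = 1 by apply: rmorph1.
case: (first_change omega) => [k0 [_ _ k0_0]|_].
  rewrite andbT; have [->|k0'] := eqVneq k ord0.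
    rewrite /=; case: (chi ord0); case: (_ == ord_max); rewrite /= !big_cons big_nil ?L1 ?Rb1 ?mul1r ?mulr1 //.
  rewrite /=; have [ek|ek] := eqVneq k k0.
    rewrite ek ltnn; case: (chi k0); case: (_ == ord_max); rewrite /= !big_cons big_nil ?L1 ?Rb1 ?mul1r ?mulr1 //.
  by case: (k < k0)%N; case: (chi k); case: (_ == ord_max);
    rewrite /= !big_cons big_nil ?L1 ?Rb1 ?mul1r ?mulr1 ?mulrA.
rewrite andbF andbT; have [->|k0'] := eqVneq k ord0 => /=.
  by case: (chi ord0); rewrite /= !big_cons big_nil ?L1 ?Rb1 ?mul1r ?mulr1.
by case: (chi k); rewrite /= !big_cons big_nil ?L1 ?Rb1 ?mul1r ?mulr1.
Qed.

Lemma adj_coef b p q : adj chi p q -> vpd_b b p * upd_b b q = b`_(slot q).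
Proof.
move=> a; rewrite (slot_adj a) /vpd_b /upd_b.
case: (eqVneq (chi p) (chi q)) => [epq|ne].
  have [] := adj_inner a epq; rewrite epq; case: (chi q) => i /negPf nm; rewrite i nm /=.
    by rewrite mul1r.
  by rewrite mulr1.
have [cp /negPf cq fc mx] := adj_change a ne; rewrite cp cq fc !andbT.
by move: mx; case: eqP => _; case: eqP => _ //= _; rewrite ?mul1r ?mulr1.
Qed.

(** A left first variable has the smallest left index, which is 0 or the first change, and neither
    carries a coefficient. If the first variable is a right one, there is no left one and hence no
    first change. *)
Lemma first_coef b x s : chi_seq chi = x :: s -> upd_b b x = 1.
Proof.
move=> e; have xmin k : k != x -> chi_lt chi x k.
  move=> kx; have := chi_seq_pairwise chi; rewrite e /= => /andP[/allP h _]; apply: h.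
  by have := mem_chi_seq chi k; rewrite e inE (negPf kx).
have xl k : chi x -> chi k -> k != x -> (x < k)%N.
  by move=> cx ck /xmin /chi_ltP; rewrite cx ck.
rewrite /upd_b; case cx : (chi x).
  case: ifP => // ix; exfalso; move: ix; rewrite /inner => /andP[x0 xk].
  have x0' : ord0 != x by rewrite eq_sym.
  have := first_changeP; case: (first_change omega) xk => [k0 xk [c0 ck k0_0]|_ h].
    have xk' : k0 != x by rewrite eq_sym.
    case c0E : (chi ord0); first by have := xl ord0 cx c0E x0'.
    have ck0 : chi k0 by move: c0; rewrite c0E; case: (chi k0).
    by have := ck x (xl k0 cx ck0 xk'); rewrite cx c0E.
  by have := xl ord0; rewrite -(h x) cx => /(_ isT isT x0').
case: ifP => // /andP[_ fc]; exfalso.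
have right k : chi k = false.
  have [->//|/xmin/chi_ltP] := eqVneq k x.
  by rewrite cx => /andP[/negPf].
have := first_changeP; case: (first_change omega) fc => // k0 _ [+ _ _].
by rewrite !right.
Qed.

Lemma last_coef b x s : chi_seq chi = x :: s -> vpd_b b (last x s) = 1.
Proof.
move=> e; set y := last x s.
have ymax k : k != y -> chi_lt chi k y.
  move=> ky; have := chi_seq_pairwise chi; rewrite e lastI pairwise_rcons => /andP[/allP h _].
  apply: h; have := mem_chi_seq chi k; rewrite e lastI mem_rcons inE.
  by rewrite (negPf ky).
have yl k : ~~ chi y -> ~~ chi k -> k != y -> (y < k)%N.
  by move=> cy ck /ymax /chi_ltP; rewrite (negPf ck) => /andP[].
rewrite /vpd_b; case cy : (chi y); last first.
  case: ifP => // iy; exfalso; move: iy; rewrite /inner => /andP[y0 yk].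
  have y0' : ord0 != y by rewrite eq_sym.
  have := first_changeP; case: (first_change omega) yk => [k0 yk [c0 ck k0_0]|_ h].
    have yk' : k0 != y by rewrite eq_sym.
    case c0E : (chi ord0); last by have := yl ord0; rewrite cy c0E => /(_ isT isT y0').
    have ck0 : ~~ chi k0 by move: c0; rewrite c0E; case: (chi k0).
    by have := ck y (yl k0 (negbT cy) ck0 yk'); rewrite cy c0E.
  by have := yl ord0; rewrite -(h y) cy => /(_ isT isT y0').
case: ifP => // /andP[_ fc]; exfalso.
have left k : chi k.
  have [->//|/ymax/chi_ltP] := eqVneq k y; case: (chi k) => //.
  by rewrite cy.
have := first_changeP; case: (first_change omega) fc => // k0 _ [+ _ _].
by rewrite !left.
Qed.

Context (D0 : B -> Prop) (G : B -> B) (GD : cond_exp D0 G).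

Theorem kappa_cum (phi : 'I_n.+1 -> letter A) m x s b :
  (forall i j : 'I_n.+1, (i < j)%N ->
    ((tm (phi i)).*2 + ~~ sd (phi i) <= (tm (phi j)).*2 + ~~ sd (phi j))%N) ->
  (forall i, valid Sp m (phi i)) ->
  (forall k, sd (phi k) = chi k) -> (forall k, el (phi k) = var ZI ZJ (omega k)) ->
  (forall j, D0 (b`_j)) -> chi_seq chi = x :: s ->
  kappa Sp ZI ZJ omega (fun a => G (expect Sp a)) b =
  cum (Nx Sp G m) (phi x) [seq (b`_(slot q), phi q) | q <- s].
Proof.
move=> lt va sdE elE Db e.
have chiE : chi = (fun k => sd (phi k)) by apply/funext => k; rewrite sdE.
have argsE : kappa_args Sp ZI ZJ omega b = (fun k => el (dressed Sp phi (upd_b b) (vpd_b b) k)).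
  by apply/funext => k; rewrite kappa_argsE /dressed /el /= -/(el _) elE -sdE.
have D1 := ce1 GD.
have Du k : D0 (upd_b b k) by rewrite /upd_b; case: ifP => _; case: ifP.
have Dv k : D0 (vpd_b b k) by rewrite /vpd_b; case: ifP => _; case: ifP.
have e' := e; rewrite chiE in e'.
have := cumulant_dressed GD lt va Du Dv e'.
rewrite /= /kappa argsE -chiE => ->.
rewrite (first_coef b e) mul1r trail_last (last_coef b e) mulr1; congr (cum _ _ _).
have := path_adj e; elim: (s) (x) => //= y s' IH x' /andP[a pa].
by rewrite mulr1 adj_coef // IH.
Qed.

Lemma coefs_exist x s (c : 'I_n.+1 -> B) : chi_seq chi = x :: s ->
  exists b, forall q, q \in s -> b`_(slot q) = c q.
Proof.
move=> e; exists [tuple if [pick q | (q \in s) && (slot q == j)] is Some q then c q else 0 | j < n].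
move=> q qs; rewrite -[nth _ _ _](tnth_nth 0 _ (Ordinal (slot_lt e qs))) tnth_mktuple /=.
case: pickP => [q' /andP[q's /eqP h]|/(_ q)]; last by rewrite qs eqxx.
by rewrite (slot_inj e q's qs h).
Qed.

End Kappa.

Arguments col {K A} x.

(** * Words in the variables *)

Section Variables.

Context (K : fieldType) (B A : algType K) (Sp : bb_space B A).
Context (D : B -> Prop) (F : B -> B) (FD : cond_exp D F).
Context (I J : Type) (ZI : I -> A) (ZJ : J -> A).
Context (ZIl : forall i, left_alg Sp setT (ZI i)) (ZJr : forall j, right_alg Sp setT (ZJ j)).
Local Notation letter := (letter A).
Implicit Types (x y : letter) (acc w : seq (B * letter)).

Definition cumB m := cum (Nx Sp id m).
Definition cumD m := cum (Nx Sp F m).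

Definition isvar x : bool :=
  col x && `[< exists v : I + J, side v = sd x /\ el x = var ZI ZJ v >].

Lemma nth_mapF n (b : n.-tuple B) j : (map_tuple F b)`_j = F b`_j.
Proof.
have [h|h] := ltnP j (size b); first by rewrite (nth_map 0).
by rewrite !nth_default ?(ceF0 FD) // size_map.
Qed.

Lemma kappa_word n (omega : 'I_n.+1 -> I + J) (phi : 'I_n.+1 -> letter) m (x : 'I_n.+1) s (b : n.-tuple B) :
  (forall i j : 'I_n.+1, (i < j)%N ->
    ((tm (phi i)).*2 + ~~ sd (phi i) <= (tm (phi j)).*2 + ~~ sd (phi j))%N) ->
  (forall i, valid Sp m (phi i)) ->
  (forall k, sd (phi k) = chi_of omega k) ->
  (forall k, el (phi k) = var ZI ZJ (omega k)) ->
  chi_seq (chi_of omega) = x :: s ->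
  let acc := [seq (b`_(slot omega q), phi q) | q <- s] in
  [/\ kappa Sp ZI ZJ omega (expect Sp) b = cumB m (phi x) acc,
      kappa Sp ZI ZJ omega (expect Sp) (map_tuple F b) = cumB m (phi x) (mapc F acc)
    & kappa Sp ZI ZJ omega (F \o expect Sp) (map_tuple F b) = cumD m (phi x) (mapc F acc)].
Proof.
move=> lt va sdE elE e acc.
have mE : mapc F acc = [seq ((map_tuple F b)`_(slot omega q), phi q) | q <- s].
  by rewrite /mapc -map_comp; apply: eq_map => q /=; rewrite nth_mapF.
rewrite mE; split.
- exact: (kappa_cum (cond_exp_id B) lt va).
- exact: (kappa_cum (cond_exp_id B) lt va).
- by apply: (kappa_cum FD lt va) => // j; rewrite nth_mapF; apply: (ce_in FD).
Qed.

Lemma var_valid m x v : (tm x < m)%N -> side v = sd x -> el x = var ZI ZJ v -> valid Sp m x.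
Proof. by move=> xm; case: v => i /= sx ex; split=> //; rewrite -sx ex. Qed.

Lemma kappa_to_word n (omega : 'I_n.+1 -> I + J) (b : n.-tuple B) : exists m x acc,
  [/\ ok Sp m (x :: unzip2 acc), all isvar (x :: unzip2 acc) &
  [/\ kappa Sp ZI ZJ omega (expect Sp) b = cumB m x acc,
      kappa Sp ZI ZJ omega (expect Sp) (map_tuple F b) = cumB m x (mapc F acc)
    & kappa Sp ZI ZJ omega (F \o expect Sp) (map_tuple F b) = cumD m x (mapc F acc)]].
Proof.
pose phi (k : 'I_n.+1) : letter := (nat_of_ord k, chi_of omega k, true, var ZI ZJ (omega k)).
have lt (i j : 'I_n.+1) : (i < j)%N ->
    ((tm (phi i)).*2 + ~~ sd (phi i) <= (tm (phi j)).*2 + ~~ sd (phi j))%N.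
  by rewrite /tm /sd /=; case: (chi_of _ i); case: (chi_of _ j) => /=; lia.
have va k : valid Sp n.+1 (phi k) by apply: (@var_valid _ _ (omega k)) => //; apply: ltn_ord.
case e : (chi_seq (chi_of omega)) => [|x s].
  by have := mem_chi_seq (chi_of omega) ord0; rewrite e.
have eu : phi x :: unzip2 [seq (b`_(slot omega q), phi q) | q <- s] =
    map phi (chi_seq (chi_of omega)) by rewrite e /= /unzip2 -map_comp.
exists n.+1, (phi x), [seq (b`_(slot omega q), phi q) | q <- s]; split.
- by rewrite eu; apply: chi_seq_ok.
- rewrite eu; apply/allP => y /mapP[k _ ->] /=; apply/asboolP.
  by exists (omega k).
- exact: kappa_word.
Qed.

Lemma index_tags (T : eqType) (U : Type) (phi : T -> U) (s : seq T) (acc : seq (B * U)) :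
  uniq s -> map phi s = unzip2 acc -> exists c : T -> B, acc = [seq (c q, phi q) | q <- s].
Proof.
elim: s acc => [|t s IH] [|[b y] acc] //=; first by exists (fun=> 0).
move=> /andP[ts us] [<- /(IH _ us)[c ->]].
exists (fun q => if q == t then b else c q); rewrite eqxx; congr (_ :: _).
by apply/eq_in_map => q qs; case: eqP => // qt; rewrite -qt qs in ts.
Qed.

Lemma word_indexed m x acc : ok Sp m (x :: unzip2 acc) ->
  exists n (phi : 'I_n.+1 -> letter) (x0 : 'I_n.+1) (s : seq 'I_n.+1) (c : 'I_n.+1 -> B),
  [/\ forall i j : 'I_n.+1, (i < j)%N ->
        ((tm (phi i)).*2 + ~~ sd (phi i) <= (tm (phi j)).*2 + ~~ sd (phi j))%N,
      forall k, phi k \in x :: unzip2 acc,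
      chi_seq (fun k => sd (phi k)) = x0 :: s, uniq (x0 :: s) &
      phi x0 = x /\ acc = [seq (c q, phi q) | q <- s]].
Proof.
move=> [/retime[[|n] [phi [lt e]]] _].
  by case: (chi_seq _) (mem_chi_seq (fun k => sd (phi k))) e => // -[].
case e' : (chi_seq _) e => [//|x0 s] /= [ex es].
have us : uniq (x0 :: s) by rewrite -e'; apply: chi_seq_uniq.
have [c ec] := index_tags (proj2 (andP us)) es.
exists n, phi, x0, s, c; split=> // k.
by rewrite -ex -es -map_cons; apply: map_f; rewrite -e' mem_chi_seq.
Qed.

Lemma word_to_kappa m x acc : ok Sp m (x :: unzip2 acc) -> all isvar (x :: unzip2 acc) ->
  exists n (omega : 'I_n.+1 -> I + J) (b : n.-tuple B),
  [/\ kappa Sp ZI ZJ omega (expect Sp) b = cumB m x acc,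
      kappa Sp ZI ZJ omega (expect Sp) (map_tuple F b) = cumB m x (mapc F acc)
    & kappa Sp ZI ZJ omega (F \o expect Sp) (map_tuple F b) = cumD m x (mapc F acc)].
Proof.
move=> okx zx; have [n [phi [x0 [s [c [lt mphi e us [ex ea]]]]]]] := word_indexed okx.
have /choice[omega omegaE] k : exists v : I + J, side v = sd (phi k) /\ el (phi k) = var ZI ZJ v.
  by have /andP[_ /asboolP] := allP zx _ (mphi k).
have chiE : chi_of omega = (fun k => sd (phi k)).
  by apply/funext => k; rewrite /chi_of; case: (omegaE k).
rewrite -chiE in e; have [b bE] := coefs_exist c e.
have -> : acc = [seq (b`_(slot omega q), phi q) | q <- s].
  by rewrite ea; apply/eq_in_map => q qs; rewrite bE.
exists n, omega, b; rewrite -ex; apply: kappa_word => //.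
- by move=> i; apply: (proj2 okx).
- by move=> k; rewrite chiE.
- by move=> k; case: (omegaE k).
Qed.

Definition over (P : pred letter) m s := ok Sp m s /\ all P s.

Lemma over_sub P m : hereditary (over P m).
Proof.
move=> s s' ss [os zs]; split; first exact: ok_sub os.
by apply/allP => y /(mem_subseq ss); apply/allP.
Qed.

Local Notation var_word := (over isvar).

(** The starred condition of the statement, read on words in the order of chi. *)
Definition F_invariant := forall m x acc, var_word m (x :: unzip2 acc) ->
  cumB m x acc = F (cumB m x (mapc F acc)).

Definition F_reduced := forall m x acc, var_word m (x :: unzip2 acc) ->
  cumB m x acc = cumD m x (mapc F acc).

Lemma kappa_invariantE :
  (forall (n : nat) (omega : 'I_n.+1 -> I + J) (b : n.-tuple B),
      kappa Sp ZI ZJ omega (expect Sp) b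
      = F (kappa Sp ZI ZJ omega (expect Sp) (map_tuple F b))) <-> F_invariant.
Proof.
split=> h => [m x acc [o z]|n omega b].
  have [n [omega [b [<- <- _]]]] := word_to_kappa o z; exact: h.
have [m [x [acc [o z [-> -> _]]]]] := kappa_to_word omega b; exact: h.
Qed.

Lemma kappa_reducedE :
  (forall (n : nat) (omega : 'I_n.+1 -> I + J) (b : n.-tuple B),
      kappa Sp ZI ZJ omega (expect Sp) b
      = kappa Sp ZI ZJ omega (F \o expect Sp) (map_tuple F b)) <-> F_reduced.
Proof.
split=> h => [m x acc [o z]|n omega b].
  have [n [omega [b [<- _ <-]]]] := word_to_kappa o z; exact: h.
have [m [x [acc [o z [-> _ ->]]]]] := kappa_to_word omega b; exact: h.
Qed.

Lemma NxB_NE m w : ok Sp m (unzip2 w) -> Nx Sp id m w = NE Sp m w.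
Proof.
case: w => [|[b x] w] okw; first by rewrite NE_nil.
by rewrite Nx_ok // [RHS]NE_lead.
Qed.

Lemma NxD_NxB m w : ok Sp m (unzip2 w) -> coefs_in D w -> Nx Sp F m w = F (Nx Sp id m w).
Proof.
case: w => [|[b x] w] okw Dw; first by rewrite /= (ce_id FD (ce1 FD)).
by rewrite !Nx_ok // (ce_l FD) //; case: Dw.
Qed.

Lemma NxD_in m w : ok Sp m (unzip2 w) -> coefs_in D w -> D (Nx Sp F m w).
Proof. by move=> okw Dw; rewrite NxD_NxB //; exact: (ce_in FD). Qed.

Lemma cumD_in m x acc : ok Sp m (x :: unzip2 acc) -> coefs_in D acc -> D (cumD m x acc).
Proof.
have [? ? ? _ _ _ _ _] := FD.
apply: (@cum_in _ _ D) => //; [exact: (@ok_sub _ _ _ Sp m)|exact: NxD_in].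
Qed.

Lemma cumB_add m : kadd (cumB m).
Proof. by apply: cum_add; apply: (Nx_add Sp (cond_exp_id B)). Qed.

Lemma cumD_add m : kadd (cumD m).
Proof. by apply: cum_add; apply: (Nx_add Sp FD). Qed.

(** For the implication from right to left: the reduced form is [D]-valued and sees the coefficients
    only through [F], which is the identity on [D]. *)
Theorem invariant_reduced : F_invariant <-> F_reduced.
Proof.
have [D1 DM DB _ _ _ _ _] := FD; split=> h m x acc zx; last first.
  have zx' : var_word m (x :: unzip2 (mapc F acc)) by rewrite unzip2_mapc.
  have Dm := mapc_in acc (ce_in FD).
  rewrite h // h // (mapc_id (ce_id FD) Dm) (ce_id FD) //.
  by apply: cumD_in Dm; case: zx'.
have Bin y e : var_word m (y :: unzip2 e) -> coefs_in D e -> D (cumB m y e).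
  by move=> ze De; rewrite h //; exact: (ce_in FD).
have NBin w : var_word m (unzip2 w) -> coefs_in D w -> D (Nx Sp id m w).
  by apply: (mom_in D1 DM DB (@over_sub isvar m) (Nx_is_mom _ _ _ _)).
have zx' : var_word m (x :: unzip2 (mapc F acc)) by rewrite unzip2_mapc.
have Dm := mapc_in acc (ce_in FD).
rewrite h // (ce_id FD); last exact: Bin.
apply: (cum_uniq (ce_submonoid FD) (@over_sub isvar m) (Nx_is_mom _ _ _ _) (Nx_is_mom _ _ _ _)) => // w zw Dw.
have [ow _] := zw; have DN := NBin w zw Dw.
by rewrite NxD_NxB // (ce_id FD).
Qed.

End Variables.

Arguments over_sub {K B A Sp} P m.

(** * Freeness over D through centred words *)

Section Kernels.

Context (K : fieldType) (B A : algType K) (Sp : bb_space B A).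
Context (D : B -> Prop) (F : B -> B) (FD : cond_exp D F).
Local Notation letter := (letter A).
Local Notation over := (over Sp).
Local Notation cumD := (cumD Sp F).
Local Notation ND := (Nx Sp F).
Local Notation NB := (Nx Sp id).
Implicit Types (x y : letter) (acc w u v : seq (B * letter)) (P : pred letter).

Definition unmixed x acc := all (fun y => col y == col x) (unzip2 acc).

(** The model of a bi-free pair: [D]-cumulants of single colours, zero on mixed words. Passing the
    coefficients through [F] makes the kernel [D]-valued and blind to coefficients killed by [F], as
    the centring lemma requires for arbitrary coefficients in [B]. *)
Definition mono_kernel P m x acc : B :=
  if `[< over P m (x :: unzip2 acc) >] && unmixed x acc
  then cumD m x (mapc F acc) else 0.

Local Notation free_mom P m := (mom (mono_kernel P m)).

Lemma mono_kernel_add P m : kadd (mono_kernel P m).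
Proof.
move=> x u b b' y v; rewrite /mono_kernel /unmixed /unzip2 !map_cat /=.
case: ifP => _; last by rewrite subr0.
by have := kadd_mapc (cumD_add Sp FD m) (ce_sub FD) x u b b' y v.
Qed.

Lemma mono_kernel_in P m x acc : D (mono_kernel P m x acc).
Proof.
rewrite /mono_kernel; case: ifP => [/andP[/asboolP[ox _] _]|_]; last exact: (ce0 FD).
by apply: (cumD_in FD); [rewrite unzip2_mapc|apply: mapc_in; apply: (ce_in FD)].
Qed.

Lemma free_mom_in P m w : coefs_in D w -> D (free_mom P m w).
Proof.
move=> Dw; apply: (mom_in (ce1 FD) (ceM FD) (ceB FD) _ (mom_is_mom (@everything _) _)) => //.
by move=> x e _ _; apply: mono_kernel_in.
Qed.

Lemma free_mom_centered P m c rs :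
  rs != [::] -> alt col c rs [::] -> coefs_in D (flatten rs) ->
  cens (fun r => F (free_mom P m r)) rs (free_mom P m) [::] = 0.
Proof.
move=> rn ha Drs.
have NF w : coefs_in D w -> free_mom P m w = F (free_mom P m w).
  by move=> Dw; rewrite (ce_id FD) //; apply: free_mom_in.
rewrite (cens_expect FD (fun r => ce_in FD (free_mom P m r)) Drs (v := [::]) I NF).
apply: (cens_mom_eq0 FD (mom_is_mom (@everything _) _) (mono_kernel_add P m) _ _ _ rn ha Drs).
- by move=> x acc h; rewrite /mono_kernel /unmixed (negPf h) andbF.
- by move=> x acc _; apply: mono_kernel_in.
- move=> x u b y v _ Fb; rewrite /mono_kernel; case: ifP => // _.
  by rewrite /mapc map_cat /= Fb kadd0 //; apply: (cumD_add Sp FD).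
Qed.

Lemma free_momE P m (okp : seq letter -> Prop) : hereditary okp ->
  (forall s, okp s -> over P m s) ->
  (forall x acc, okp (x :: unzip2 acc) -> coefs_in D acc -> ~~ unmixed x acc ->
     cumD m x acc = 0) ->
  forall w, okp (unzip2 w) -> coefs_in D w -> free_mom P m w = ND m w.
Proof.
move=> okS okP mix w okw Dw.
apply: (mom_uniq (ce_submonoid FD) okS (mom_is_mom _ _) (Nx_is_mom _ _ _ _)) => //.
  by move=> w' _; apply: free_mom_in.
move=> x e oke De; rewrite /mono_kernel; case: ifP => [_|].
  by rewrite (mapc_id (ce_id FD) De).
have /asboolT -> /= := okP _ oke => /negbT h.
by apply/esym/mix.
Qed.

Lemma free_mom_mono P m c w : over P m (unzip2 w) -> mono col c w -> coefs_in D w ->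
  free_mom P m w = ND m w.
Proof.
move=> ow mw; pose okp s := over P m s /\ all (fun y => col y == c) s.
apply: (@free_momE P m okp); last 1 first.
- by split=> //; rewrite all_map.
- move=> s s' ss [os cs]; split; first exact: over_sub os.
  by apply/allP => y /(mem_subseq ss) /(allP cs).
- by move=> s [].
- move=> x acc [_ /= /andP[/eqP cx h]] _ /negP[]; rewrite /unmixed cx; exact: h.
Qed.

(** The model also has vanishing centred moments, with the same centres on monochromatic words, and
    these data determine every moment. *)
Lemma centered_free P m (f ctr : seq (B * letter) -> B) : f [::] = 1 ->
  (forall r, D (ctr r)) ->
  (forall c r, over P m (unzip2 r) -> mono col c r -> coefs_in D r -> ctr r = ND m r) ->
  (forall c rs, rs != [::] -> alt col c rs [::] -> over P m (unzip2 (flatten rs)) ->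
     coefs_in D (flatten rs) -> cens ctr rs f [::] = 0) ->
  forall w, over P m (unzip2 w) -> coefs_in D w -> f w = free_mom P m w.
Proof.
move=> f1 ctrD ctrE fc; apply: (cens_determines (col := col) (ce_submonoid FD) ctrD (over_sub P m)) => //.
move=> c rs rn ha ors Drs; rewrite (fc c rs) //.
rewrite (cens_ctr (ctr' := fun r => F (free_mom P m r))) ?(free_mom_centered _ _ rn ha) //.
move=> r rrs; have [c' mr] := alt_mono ha rrs.
have or : over P m (unzip2 r) by apply: over_sub ors; apply: unzip2_run.
have Dr := coefs_in_run rrs Drs.
by rewrite (ctrE c') // -(free_mom_mono or mr) // (ce_id FD) //; apply: free_mom_in.
Qed.

End Kernels.

Lemma subalgebraP (K : pzRingType) (A : algType K) (S : set A) : subalgebra S <->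
  [/\ S 1, forall k a b, S a -> S b -> S (k *: a + b) & forall a b, S a -> S b -> S (a * b)].
Proof.
split=> -[h1 hl hm]; split=> //.
- by move: h1; rewrite inE.
- by move=> k a b ha hb; have := hl k a b; rewrite !inE; apply.
- by move=> a b ha hb; have := hm a b; rewrite !inE; apply.
- by rewrite inE.
- by move=> k a b; rewrite !inE; apply: hl.
- by move=> a b; rewrite !inE; apply: hm.
Qed.

Section Faces.

Context (K : fieldType) (B A : algType K) (Sp : bb_space B A).
Context (D : set B) (F : B -> B) (FD : cond_exp D F).
Context (X : bool -> bool -> set A).
Local Notation letter := (letter A).
Local Notation over := (over Sp).
Local Notation cumD := (cumD Sp F).
Implicit Types (x y : letter) (acc : seq (B * letter)).

Definition in_face x : bool := `[< X (col x) (sd x) (el x) >].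

Definition mixed_vanish := forall m x acc, over in_face m (x :: unzip2 acc) ->
  coefs_in D acc -> ~~ unmixed x acc -> cumD m x acc = 0.

Lemma dress_left (T1 T2 : eqType) (phi : T1 -> T2) (up : T1 -> B) (s : seq T1) :
  dress phi up (fun=> 1) 1 [seq (1, q) | q <- s] = [seq (up q, phi q) | q <- s].
Proof. by elim: s => //= q s ->; rewrite !mul1r. Qed.

Lemma trail_left (T1 : eqType) (s : seq T1) : trail (fun=> 1 : B) 1 [seq (1, q) | q <- s] = 1.
Proof. by elim: s. Qed.

Lemma coefs_in_map (T1 T2 : eqType) (phi : T1 -> T2) (c : T1 -> B) s :
  coefs_in D [seq (c q, phi q) | q <- s] -> forall q, q \in s -> D (c q).
Proof.
elim: s => //= t s IH [Dt Ds] q; rewrite inE => /orP[/eqP->//|]; exact: IH.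
Qed.

Lemma cumulant_left n (phi : 'I_n -> letter) m (up : 'I_n -> B) (k : 'I_n) s :
  (forall i j : 'I_n, (i < j)%N ->
    ((tm (phi i)).*2 + ~~ sd (phi i) <= (tm (phi j)).*2 + ~~ sd (phi j))%N) ->
  (forall i, valid Sp m (phi i)) -> (forall i, D (up i)) ->
  chi_seq (fun k => sd (phi k)) = k :: s ->
  cumulant Sp (F \o expect Sp) (fun k => sd (phi k))
    (fun k => prodl (sd (phi k)) [:: scal Sp (sd (phi k)) (up k); el (phi k)]) =
  up k * cumD m (phi k) [seq (up q, phi q) | q <- s].
Proof.
move=> lt va Du e.
have := cumulant_dressed FD lt va Du (vp := fun=> 1) (fun=> ce1 FD) e.
rewrite /= dress_left trail_left mulr1 => <-; congr (cumulant _ _ _ _); apply/funext => i.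
rewrite /dressed /el /= -/(el _) /prodl.
by case: (sd (phi i)); rewrite !big_cons big_nil /scal ?Rb1 ?rmorph1 !mulr1 ?mul1r.
Qed.

Lemma prodl_scal_face s c (d : B) a : pair_of_faces Sp D (X c) -> D d -> X c s a ->
  X c s (prodl s [:: scal Sp s d; a]).
Proof.
move=> [/subalgebraP[_ _ Mt] /subalgebraP[_ _ Mf] [Lt _] [Rf _]] Dd.
rewrite /prodl /scal; case: s => Xa; rewrite !big_cons big_nil mulr1.
  by apply: Mt => //; apply: Lt; exists d.
by apply: Mf => //; apply: Rf; exists d.
Qed.

(** Bi-freeness speaks of tuples without coefficients. Coefficients in [D] are multiplied into the
    letters, which stay in their faces because these contain the scalars of [D]. *)
Lemma bifree_mixed : bifree Sp D (F \o expect Sp) X -> mixed_vanish.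
Proof.
move=> [faces bf] m x acc [okx fx] Dacc mx.
have [n [phi [x0 [s [c [lt mphi e us [ex ea]]]]]]] := word_indexed okx.
have va k : valid Sp m (phi k) by apply: (proj2 okx).
have Dc : forall q, q \in s -> D (c q) by move: Dacc; rewrite ea => /coefs_in_map.
(* The first letter [x0] is not in [s]; its value 1 removes the factor in front of the cumulant. *)
pose up q := if q \in s then c q else 1.
have Du i : D (up i) by rewrite /up; case: ifP => [/Dc//|_]; apply: (ce1 FD).
have := cumulant_left lt va Du e.
have -> : up x0 = 1 by move: us => /= /andP[/negPf h _]; rewrite /up h.
have -> : [seq (up q, phi q) | q <- s] = acc.
  by rewrite ea; apply/eq_in_map => q qs; rewrite /up qs.
rewrite mul1r ex => <-; apply: (bf _ _ (fun k => col (phi k))).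
  move: mx; rewrite /unmixed ea -ex => /allPn[y].
  rewrite /unzip2 -map_comp => /mapP[q qs ->] /= /eqP h.
  by exists q, x0.
move=> k; apply: prodl_scal_face => //.
by have /asboolP := allP fx _ (mphi k).
Qed.

Lemma mixed_bifree : (forall c, pair_of_faces Sp D (X c)) ->
  (forall c, (X c true `<=` left_alg Sp setT)%classic /\ (X c false `<=` right_alg Sp setT)%classic) ->
  mixed_vanish -> bifree Sp D (F \o expect Sp) X.
Proof.
move=> faces Xlr mv; split=> // n chi eps Z [i [j ij]] XZ.
pose phi (k : 'I_n) : letter := (nat_of_ord k, chi k, eps k, Z k).
have lt (k l : 'I_n) : (k < l)%N ->
    ((tm (phi k)).*2 + ~~ sd (phi k) <= (tm (phi l)).*2 + ~~ sd (phi l))%N.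
  by rewrite /tm /sd /=; case: (chi k); case: (chi l) => /=; lia.
have va k : valid Sp n (phi k).
  split; first exact: ltn_ord.
  have [h1 h2] := Xlr (eps k); have := XZ k.
  by rewrite /sd /el /=; case: (chi k) => [/h1|/h2].
have chiE : (fun k => sd (phi k)) = chi by [].
case e : (chi_seq chi) => [|x s]; first by have := mem_chi_seq chi i; rewrite e.
have := cumulant_left lt va (fun=> ce1 FD) e; rewrite mul1r.
have -> : (fun k => prodl (sd (phi k)) [:: scal Sp (sd (phi k)) 1; el (phi k)]) = Z.
  apply/funext => k; rewrite /prodl /scal /sd /el /=.
  by case: (chi k); rewrite !big_cons big_nil mulr1 ?Rb1 ?rmorph1 ?mul1r ?mulr1.
rewrite chiE => ->.
have eu : phi x :: unzip2 [seq (1 : B, phi q) | q <- s] = map phi (chi_seq chi).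
  by rewrite e /= /unzip2 -map_comp.
apply: mv.
- rewrite eu; split; first exact: chi_seq_ok.
  by apply/allP => y /mapP[k _ ->]; apply/asboolP; apply: XZ.
- elim: (s) => //= q s' IH; split=> //; exact: (ce1 FD).
apply/negP => um; have col_eq k : eps k = eps x.
  have := mem_chi_seq chi k; rewrite e inE => /orP[/eqP->//|ks].
  apply/eqP; apply: (allP um (phi k)); rewrite /unzip2 -map_comp.
  exact: (map_f (snd \o (fun q => (1 : B, phi q))) ks).
by apply: ij; rewrite !col_eq.
Qed.

End Faces.

(** * From freeness to reduced cumulants *)

Section ScalarKernel.

Context (K : fieldType) (B A : algType K) (Sp : bb_space B A).
Context (D : B -> Prop) (F : B -> B) (FD : cond_exp D F).
Context (I J : Type) (ZI : I -> A) (ZJ : J -> A).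
Local Notation letter := (letter A).
Local Notation over := (over Sp).
Local Notation isvar := (isvar ZI ZJ).
Local Notation NB := (Nx Sp id).
Implicit Types (x y : letter) (acc w u v : seq (B * letter)) (P : pred letter).
Implicit Types (Q : letter -> seq (B * letter) -> B).

(** Scalars of colour [true] come from the pair generated over [D], so they are confined to [D];
    those of colour [false] are arbitrary. *)
Definition scalar_value x : set B :=
  [set b | el x = scal Sp (sd x) b /\ (col x -> D b)]%classic.

Definition isscal x : bool := `[< exists b, scalar_value x b >].

Definition sval x : B := xget 0 (scalar_value x).

Lemma svalP x : isscal x -> el x = scal Sp (sd x) (sval x) /\ (col x -> D (sval x)).
Proof. by move=> /asboolP[b h]; have := xgetI 0 h. Qed.

(* The kernel [Q] on the variables, extended so that a scalar letter is never
   joined to another one. *)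
Definition scalar_kernel Q m x acc : B :=
  if `[< over isvar m (x :: unzip2 acc) >] then Q x acc
  else if nilp acc && isscal x then sval x else 0.

Local Notation smom Q m := (mom (scalar_kernel Q m)).

Lemma scalar_mom_centered Q m c rs : kadd Q ->
  (forall x acc, over isvar m (x :: unzip2 acc) -> D (Q x acc)) ->
  (forall x u b y v, over isvar m (x :: unzip2 (u ++ (b, y) :: v)) -> F b = 0 ->
     Q x (u ++ (b, y) :: v) = 0) ->
  rs != [::] -> alt col c rs [::] -> coefs_in D (flatten rs) ->
  F (cens (fun r => F (smom Q m r)) rs (smom Q m) [::]) = 0.
Proof.
move=> QA QD QF; apply: (cens_mom_eq0 FD (mom_is_mom (@everything _) _)).
- move=> x u b b' y v; rewrite /scalar_kernel /unzip2 !map_cat /=.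
  by case: ifP => _; [exact: QA|case: (u) => [|p u']; rewrite /= subr0].
- move=> x acc h; rewrite /scalar_kernel; case: ifP => [/asboolP[_ zx]|_].
    case/negP: h; apply/allP => y yacc; have := zx; rewrite /= => /andP[/andP[-> _] za].
    by have /andP[-> _] := allP za y yacc.
  by case: acc h.
- move=> x acc cx; rewrite /scalar_kernel; case: ifP => [/asboolP/QD//|_].
  by case: ifP => [/andP[_ /svalP[_ h]]|_]; [exact: h|exact: (ce0 FD)].
- move=> x u b y v _ Fb; rewrite /scalar_kernel; case: ifP => [/asboolP h|_]; first exact: QF.
  by case: (u).
Qed.

(** Scalar letters pass into the following coefficient in the same way for the expectation and for
    the kernel, so they are removed one at a time until only variables remain. *)
Lemma scalar_momE Q m w : over (predU isvar isscal) m (unzip2 w) ->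
  (forall w', over isvar m (unzip2 w') -> subseq (unzip2 w') (unzip2 w) -> NB m w' = smom Q m w') ->
  NB m w = smom Q m w.
Proof.
have [n] := ubnP (size w); elim: n w => // n IH w lt ow H.
case: (boolP (all isvar (unzip2 w))) => [zw|/allPn[y /mapP[[b y'] pw /= ->] ny]].
  by apply: H => //; case: ow.
case/splitPr: pw ow H lt => u v [ow gw] H lt.
have sy : isscal y'.
  have := allP gw y'; rewrite unzip2_cat mem_cat inE eqxx orbT /= => /(_ isT).
  by rewrite (negPf ny).
rewrite NxB_NE // (NE_scalar ow (proj1 (svalP sy))).
rewrite (mom_scalar (p := fun x => ~~ isvar x) (q := scalar_kernel Q m)) //; last 2 first.
- exact: mom_is_mom.
- move=> x acc an hp; rewrite /scalar_kernel; case: ifP => [/asboolP[_ h]|_].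
    by have := hp; rewrite has_predC h.
  by case: (acc) an.
have -> : scalar_kernel Q m y' [::] = sval y'.
  by rewrite /scalar_kernel /= sy asboolF // => -[_]; rewrite /= (negPf ny).
set d := b * sval y'.
have step h : unzip2 h = unzip2 v -> NE Sp m (u ++ h) = smom Q m (u ++ h).
  move=> hv; have ss : subseq (unzip2 (u ++ h)) (unzip2 (u ++ (b, y') :: v)).
    by rewrite !unzip2_cat hv; apply: cat_subseq => //; apply: subseq_cons.
  have oh := ok_sub ss ow; rewrite -NxB_NE //; apply: IH.
  - move: lt; have := congr1 size hv; rewrite !size_map !size_cat /= => ->.
    by rewrite addnS ltnS.
  - by split=> //; apply/allP => z /(mem_subseq ss) /(allP gw).
  - by move=> w' ow' sw'; apply: H => //; apply: subseq_trans sw' ss.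
by case: (v) step => [|[c z] v'] step /=; rewrite step.
Qed.

End ScalarKernel.

Section Reduction.

Context (K : fieldType) (B A : algType K) (Sp : bb_space B A).
Context (D : set B) (F : B -> B) (FD : cond_exp D F).
Context (I J : Type) (ZI : I -> A) (ZJ : J -> A).
Context (X : bool -> bool -> set A).
Context (XI : forall i, X true true (ZI i)) (XJ : forall j, X true false (ZJ j)).
Context (Xscal : forall s b, X false s (scal Sp s b)).
Context (mixed : mixed_vanish Sp D F X).
Context (faithful : forall b1 : B, (forall b2 : B, F (b2 * b1) = 0) -> b1 = 0).
Local Notation letter := (letter A).
Local Notation over := (over Sp).
Local Notation isvar := (isvar ZI ZJ).
Local Notation isscal := (isscal Sp D).
Local Notation cumD := (cumD Sp F).
Local Notation NB := (Nx Sp id).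
Local Notation ND := (Nx Sp F).
Implicit Types (x y : letter) (acc w u v : seq (B * letter)) (m : nat).

Let Q m x acc := cumD m x (mapc F acc).
Local Notation Qmom m := (mom (scalar_kernel Sp D ZI ZJ (Q m) m)).
Let P : pred letter := predU isvar (fun x => ~~ col x && isscal x).

Let over_face m s : over P m s -> over (in_face X) m s.
Proof.
case=> os ps; split=> //; apply: sub_all ps => x /orP[/andP[cx /asboolP[v [sv ev]]]|/andP[cx sx]];
  apply/asboolP.
  by rewrite cx ev -sv; case: (v).
by have [-> _] := svalP sx; rewrite (negPf cx).
Qed.

Let over_gen m s : over P m s -> over (predU isvar isscal) m s.
Proof.
case=> os ps; split=> //; apply: sub_all ps => x /orP[/= -> //|/andP[_ sx]] /=.
by rewrite sx orbT.
Qed.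

Let isvar_col x : isvar x -> col x.
Proof. by case/andP. Qed.

(** A run of colour [false] contains only scalars, and removing them computes both sides. A run of
    colour [true] contains only variables with coefficients in [D], on which the kernel is the
    [D]-cumulant itself. *)
Lemma Qmom_centers m c r : over P m (unzip2 r) -> mono col c r -> coefs_in D r ->
  F (Qmom m r) = ND m r.
Proof.
move=> or mr Dr; have okr := proj1 or.
case: c mr => mr; last first.
  rewrite -(scalar_momE (Q := Q m) (over_gen or)) ?(NxD_NxB FD) // => -[|[b x] w'] //.
  case=> _ /= /andP[/isvar_col cx _] sw; exfalso.
  have : x \in unzip2 r by apply: (mem_subseq sw); rewrite mem_head.
  by case/mapP => -[b' y] /(allP mr) /= /eqP cy /= xy; move: cx; rewrite xy cy.
have vr : over isvar m (unzip2 r).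
  split=> //; apply/allP => x xr; have /orP[//|/andP[/negP[]]] := allP (proj2 or) _ xr.
  by case/mapP: xr => -[b y] /(allP mr) /= /eqP cy ->.
rewrite -[RHS](ce_id FD); last exact: (NxD_in FD).
congr (F _); apply: (mom_uniq (ce_submonoid FD) (over_sub isvar m) (mom_is_mom _ _) (Nx_is_mom _ _ _ _) _ _ vr) => //.
  apply: (mom_in (ce1 FD) (ceM FD) (ceB FD) (over_sub isvar m) (mom_is_mom _ _)).
  move=> x e ve De; rewrite /scalar_kernel asboolT //.
  by apply: (cumD_in FD); rewrite ?unzip2_mapc; [case: ve|apply: mapc_in; apply: (ce_in FD)].
by move=> x e ve De; rewrite /scalar_kernel asboolT // /Q (mapc_id (ce_id FD) De).
Qed.

(** Both sides are moments of the model kernel: the right one because mixed cumulants vanish, the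
    left one because its centred moments do. *)
Lemma expect_Qmom m w : over P m (unzip2 w) -> coefs_in D w ->
  F (Qmom m w) = F (NB m w).
Proof.
move=> ow Dw; rewrite -(NxD_NxB FD) //; last by case: ow.
have <- : mom (mono_kernel Sp F P m) w = ND m w.
  apply: (free_momE FD (over_sub (Sp := Sp) P m)) => // x acc ox Da um.
  by apply: mixed => //; apply: over_face.
apply: (centered_free FD (f := fun w => F (Qmom m w)) (ctr := fun r => F (Qmom m r))) => //.
- exact: (ce_id FD (ce1 FD)).
- by move=> r; apply: (ce_in FD).
- exact: Qmom_centers.
move=> c rs rn ha ors Drs.
rewrite (cens_expect FD (fun r => ce_in FD (Qmom m r)) Drs (f := Qmom m) (v := [::]) Logic.I) //.
apply: (scalar_mom_centered FD _ _ _ rn ha Drs).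
- exact: kadd_mapc (cumD_add Sp FD m) (ce_sub FD).
- move=> x acc [ox _]; apply: (cumD_in FD); first by rewrite unzip2_mapc.
  by apply: mapc_in; apply: (ce_in FD).
- move=> x u b y v _ Fb; rewrite /Q /mapc map_cat /= Fb kadd0 //.
  exact: (cumD_add Sp FD).
Qed.

(* Each coefficient is turned into a scalar letter standing in front of the
   letter it belongs to. *)
Definition coef_letter (b : B) x : letter := (tm x, sd x, false, scal Sp (sd x) b).

Fixpoint detach w : seq (B * letter) :=
  if w is (b, x) :: w' then (1, coef_letter b x) :: (1, x) :: detach w' else [::].

Lemma coef_letter_scal b x : isscal (coef_letter b x).
Proof. by apply/asboolP; exists b. Qed.

(** [sval] is a choice of scalar; injectivity of the two embeddings identifies it. *)
Lemma coef_letter_sval b x : sval Sp D (coef_letter b x) = b.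
Proof.
have [+ _] := svalP (coef_letter_scal b x); rewrite /el /sd /= /scal.
by case: (sd x) => /esym; [apply: (@Lb_inj _ _ _ Sp)|apply: (@Rb_inj _ _ _ Sp)].
Qed.

Lemma detach_ok m s w : ok Sp m (s ++ unzip2 w) -> ok Sp m (s ++ unzip2 (detach w)).
Proof.
elim: w s => [|[b x] w IH] s //= ox.
have xm : valid Sp m x by apply: (proj2 ox); rewrite mem_cat inE eqxx orbT.
have := IH (s ++ [:: coef_letter b x; x]); rewrite -!catA /=; apply.
apply: (ok_replace (t := [:: coef_letter b x; x]) ox) => y.
rewrite !inE => /orP[]/eqP-> //; split.
  by case: (x) => [[[]]].
by case: xm => xm _; exact: (@valid_scal _ _ _ Sp m (coef_letter b x) b xm).
Qed.

Lemma detach_P m w : over isvar m (unzip2 w) -> over P m (unzip2 (detach w)).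
Proof.
move=> [ow vw]; split; first exact: (@detach_ok m [::]).
elim: w vw {ow} => [|[b x] w IH] //= /andP[vx /IH->].
have -> : P (coef_letter b x) by apply/orP; right; rewrite /= coef_letter_scal.
by rewrite /P /= vx.
Qed.

Lemma detach_in w : coefs_in D (detach w).
Proof. by elim: w => // -[b x] w IH /=; split; [|split]; rewrite //; apply: (ce1 FD). Qed.

Lemma NE_detach m u w : ok Sp m (unzip2 u ++ unzip2 w) ->
  NE Sp m (u ++ detach w) = NE Sp m (u ++ w).
Proof.
elim: w u => [|[b x] w IH] u //= ox.
rewrite (NE_scalar (beta := b)) //; last first.
  rewrite unzip2_cat; exact: (@detach_ok m _ ((b, x) :: w)).
by rewrite /= mulr1 mul1r -cat_rcons IH ?cat_rcons // /unzip2 map_rcons cat_rcons.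
Qed.

Lemma Qmom_detach m u w : all isvar (unzip2 u ++ unzip2 w) ->
  Qmom m (u ++ detach w) = Qmom m (u ++ w).
Proof.
elim: w u => [|[b x] w IH] u //= vx.
have nv : ~~ isvar (coef_letter b x) by rewrite /isvar.
rewrite (mom_scalar (p := fun x => ~~ isvar x) (q := scalar_kernel Sp D ZI ZJ (Q m) m)) //; last 2 first.
- exact: mom_is_mom.
- move=> y acc an hp; rewrite /scalar_kernel; case: ifP => [/asboolP[_ h]|_].
    by have := hp; rewrite has_predC h.
  by case: (acc) an.
have -> : scalar_kernel Sp D ZI ZJ (Q m) m (coef_letter b x) [::] = b.
  rewrite /scalar_kernel /= coef_letter_scal coef_letter_sval asboolF // => -[_].
  by move=> /andP[]; rewrite (negPf nv).
by rewrite /= mulr1 mul1r -cat_rcons IH ?cat_rcons // /unzip2 map_rcons cat_rcons.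
Qed.

(** A detached word carries its coefficients as letters, so [expect_Qmom] compares both moments
    under [F]. An arbitrary [b2] multiplied into the leading coefficient comes out in front, and
    faithfulness removes [F]. *)
Lemma Qmom_var m w : over isvar m (unzip2 w) -> NB m w = Qmom m w.
Proof.
case: w => [|[b x] w] vw //.
apply/eqP; rewrite -subr_eq0; apply/eqP/faithful => b2.
pose w' := (b2 * b, x) :: w.
have e : Qmom m w' = b2 * Qmom m ((b, x) :: w).
  have [_ NS] := mom_is_mom (@everything _) (scalar_kernel Sp D ZI ZJ (Q m) m).
  by rewrite !NS // mulrA.
have [ow aw] := vw; rewrite mulrBr -e.
have -> : b2 * NB m ((b, x) :: w) = NB m w' by rewrite !Nx_ok // mulrA.
have dP : over P m (unzip2 (detach w')) by apply: detach_P.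
have -> : NB m w' = NB m (detach w').
  have od := proj1 dP; rewrite NxB_NE // [RHS]NxB_NE //.
  by have := @NE_detach m [::] w' ow => <-.
by rewrite -(@Qmom_detach m [::] w') // (ce_sub FD) (expect_Qmom dP (detach_in _)) subrr.
Qed.

Theorem mixed_reduced : F_reduced Sp F ZI ZJ.
Proof.
move=> m x acc vx.
transitivity (scalar_kernel Sp D ZI ZJ (Q m) m x acc); last by rewrite /scalar_kernel asboolT.
apply: (cum_uniq (@submonoidT B) (over_sub isvar m) (Nx_is_mom _ _ _ _) (mom_is_mom _ _) _ vx (coefs_inT _)).
by move=> w vw _; split=> //; apply: Qmom_var.
Qed.

End Reduction.

(** * From invariant cumulants to freeness *)

Section Multilinearity.

Context (K : fieldType) (B A : algType K) (Sp : bb_space B A).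
Local Notation letter := (letter A).
Local Notation NB := (Nx Sp id).
Implicit Types (x y : letter) (u v w r : seq (B * letter)) (l : seq A) (ls : seq (seq A)).
Implicit Types (f ctr : seq (B * letter) -> B) (rs : seq (seq (B * letter))).

(** The products are non-empty because the coefficient of the replaced letter needs a letter to
    stand before. *)
Definition sum_of_products x ls : Prop :=
  all (fun l => l != [::]) ls /\ el x = \sum_(l <- ls) prodl (sd x) l.

Definition expandable f : Prop := forall u b x ls v, sum_of_products x ls ->
  f (u ++ (b, x) :: v) = \sum_(l <- ls) f (u ++ expand b x l ++ v).

Lemma NE_subel m u b x a a' v : (tm x < m)%N ->
  NE Sp m (u ++ (b, setel x (a - a')) :: v) =
  NE Sp m (u ++ (b, setel x a) :: v) - NE Sp m (u ++ (b, setel x a') :: v).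
Proof.
move=> xm; rewrite /NE -raddfB; congr (expect Sp _); apply: (prod_sub xm) => [j jy|].
  by rewrite -!(cat1s _ v) !lprod_cat !rprod_cat !lprod1 !rprod1 [tm _ == j]eq_sym (negPf jy) !andbF.
rewrite -!(cat1s _ v) !lprod_cat !rprod_cat !lprod1 !rprod1 eqxx !andbT.
rewrite /sd /= -/(sd x) /el /=.
by case: (sd x) => /=; rewrite !(mulrBl, mulrBr).
Qed.

Lemma Nx_subel m u b x a a' v :
  NB m (u ++ (b, setel x (a - a')) :: v) =
  NB m (u ++ (b, setel x a) :: v) - NB m (u ++ (b, setel x a') :: v).
Proof.
have tE c : tm (setel x c) = tm x by [].
case: u => [|[c z] u] /=; rewrite /unzip2 ?map_cat /=.
  case: ifP => h; last by rewrite subr0.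
  by rewrite -mulrBr; congr (_ * _); apply: (@NE_subel m [::]); case/andP: h.
rewrite !all_cat /=; case: ifP => h; last by rewrite subr0.
rewrite -mulrBr; congr (_ * _); apply: (@NE_subel m ((1, z) :: u)).
by case/and4P: h.
Qed.

Lemma Nx_expand m u b x l v : l != [::] ->
  NB m (u ++ expand b x l ++ v) = NB m (u ++ (b, setel x (prodl (sd x) l)) :: v).
Proof.
move=> l0; have tmE : all (fun y => tm y < m)%N (unzip2 (expand b x l)) = (tm x < m)%N.
  case: l l0 => // a l _; rewrite /= /tm /= -/(tm x) /unzip2 -map_comp all_map.
  by elim: l => [|c l /= IH] /=; rewrite ?andbT // IH andbb.
case: u => [|[c z] u] /=; last first.
  by rewrite /unzip2 !map_cat !all_cat tmE /= -!cat_cons -NE_expand.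
rewrite -[X in _ = if X then _ else _]/((tm x < m)%N && all (fun y => tm y < m)%N (unzip2 v)).
rewrite -tmE -all_cat -unzip2_cat.
have := @NE_expand _ _ _ Sp m [::] 1 x l v l0; case: l l0 {tmE} => // a l _ /= <-.
by case: ifP.
Qed.

Lemma Nx_expandable m : expandable (NB m).
Proof.
move=> u b x ls v [ls0 ex].
have -> : (b, x) = (b, setel x (\sum_(l <- ls) prodl (sd x) l)).
  by rewrite -ex /setel /el; case: (x).
rewrite (sub_morph_sum (f := fun a => NB m (u ++ (b, setel x a) :: v))); last first.
  by move=> a a'; apply: Nx_subel.
by apply: eq_big_seq => l /(allP ls0) l0; rewrite Nx_expand.
Qed.

Context (ctr : seq (B * letter) -> B).

Lemma cen_expandable r f : expandable f -> expandable (cen ctr r f).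
Proof.
move=> fx u b x ls v sx; rewrite /cen sumrB; congr (_ - _).
  by rewrite catA (fx _ _ _ ls) //; apply: eq_bigr => l _; rewrite -catA.
case: u => [|[c z] u] /=; last by rewrite -cat_cons (fx _ _ _ ls).
have := fx [::] (ctr r * b) x ls v sx; rewrite /= => ->.
case: sx => ls0 _; apply: eq_big_seq => l /(allP ls0).
by case: l.
Qed.

Lemma cens_expandable rs f : expandable f -> expandable (cens ctr rs f).
Proof. by elim: rs f => //= r rs IH f fx; apply: IH; apply: cen_expandable. Qed.

Lemma cen_add r f : fadd f -> fadd (cen ctr r f).
Proof.
move=> fA u b b' y v; rewrite /cen opprD addrACA -opprD; congr (_ - _).
  by rewrite !catA fA.
case: u => [|[c z] u] /=; last by rewrite -!cat_cons fA.
by rewrite mulrBr; apply: (fA [::]).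
Qed.

Lemma cens_fadd rs f : fadd f -> fadd (cens ctr rs f).
Proof. by elim: rs f => //= r rs IH f fA; apply: IH; apply: cen_add. Qed.

Lemma cens_sum (T : Type) (s : seq T) (g : T -> seq (B * letter) -> B) rs v :
  cens ctr rs (fun w => \sum_(i <- s) g i w) v = \sum_(i <- s) cens ctr rs (g i) v.
Proof.
elim: s => [|i s IH]; rewrite ?big_nil ?big_cons.
  transitivity (cens ctr rs (fun=> 0 * (0 : B)) v); last by rewrite cens_mull mul0r.
  by apply: cens_eq => w; rewrite big_nil mulr0.
rewrite -IH -cens_add; apply: cens_eq => w; exact: big_cons.
Qed.

(** A run enters its centred factor twice, as part of the word and through its centre, so both
    functionals must be expandable; additivity of [f] distributes the expanded centre. *)
Lemma cens_run_expand rs1 r1 b x ls r2 rs2 f v : fadd f -> expandable f -> expandable ctr ->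
  sum_of_products x ls ->
  cens ctr (rs1 ++ (r1 ++ (b, x) :: r2) :: rs2) f v =
  \sum_(l <- ls) cens ctr (rs1 ++ (r1 ++ expand b x l ++ r2) :: rs2) f v.
Proof.
move=> fA fx cx sx; rewrite cens_cat /=; under eq_bigr => l _ do rewrite cens_cat /=.
have := cens_fadd rs1 fA; have := cens_expandable rs1 fx.
move: (cens ctr rs1 f) => g gx gA; rewrite -cens_sum; apply: cens_eq => w.
rewrite /cen sumrB; congr (_ - _).
  by rewrite -catA /= (gx _ _ _ ls) //; apply: eq_bigr => l _; rewrite -!catA.
rewrite (cx _ _ _ ls) // (sub_morph_sum (f := fun d => sc d g w)) // => d d'.
case: w => [|[c y] w] /=; first by rewrite mulrBr.
by rewrite mulrBl (gA [::]).
Qed.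

End Multilinearity.

Lemma gen_alg_subalgebra (K : pzRingType) (A : algType K) (S : set A) : subalgebra (gen_alg S).
Proof.
apply/subalgebraP; split.
- by move=> T [/subalgebraP[]].
- by move=> k a b ha hb T hT; case/subalgebraP: (proj1 hT) => _ h _; apply: h; [apply: ha|apply: hb].
- by move=> a b ha hb T hT; case/subalgebraP: (proj1 hT) => _ _ h; apply: h; [apply: ha|apply: hb].
Qed.

Lemma prodl_cat (K : fieldType) (A : algType K) (s : bool) (l l' : seq A) :
  prodl s (l ++ l') = if s then prodl s l * prodl s l' else prodl s l' * prodl s l.
Proof. by case: s; rewrite /prodl ?rev_cat big_cat. Qed.

(** Multiples of 1 among the generators serve as extra factors, so that linear combinations become
    plain sums of products. For [s = false] the lists are concatenated in the opposite order. *)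
Lemma gen_alg_products (K : fieldType) (A : algType K) (S : set A) (s : bool) :
  (forall k, S (k%:A)) -> forall a, gen_alg S a -> exists ls : seq (seq A),
  (forall l, l \in ls -> l != [::] /\ forall c, c \in l -> S c) /\
  a = \sum_(l <- ls) prodl s l.
Proof.
move=> Sk a; pose T : set A := [set a | exists ls : seq (seq A),
  (forall l, l \in ls -> l != [::] /\ forall c, c \in l -> S c) /\
  a = \sum_(l <- ls) prodl s l]%classic.
have single c : prodl s [:: c] = c by rewrite /prodl; case: (s); rewrite big_seq1.
apply: (_ : (gen_alg S `<=` T)%classic); apply: smallest_sub; last first.
  move=> c Sc; exists [:: [:: c]]; rewrite big_seq1 single; split=> // l.
  by rewrite inE => /eqP->; split=> // d; rewrite inE => /eqP->.
apply/subalgebraP; split.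
- exists [:: [:: 1%:A]]; rewrite big_seq1 single scale1r; split=> // l.
  by rewrite inE => /eqP->; split=> // d; rewrite inE => /eqP->; have := Sk 1; rewrite scale1r.
- move=> k _ _ [ls [lsP ->]] [ls' [lsP' ->]].
  exists ([seq k%:A :: l | l <- ls] ++ ls'); split.
    move=> l; rewrite mem_cat => /orP[/mapP[l' /lsP[_ h] ->]|/lsP'//]; split=> // c.
    by rewrite inE => /orP[/eqP->//|/h].
  rewrite big_cat big_map scaler_sumr; congr (_ + _); apply: eq_bigr => l _.
  rewrite -cat1s prodl_cat single.
  by case: (s); rewrite -?scalerAl -?scalerAr ?mul1r ?mulr1.
- move=> _ _ [ls [lsP ->]] [ls' [lsP' ->]].
  exists (if s then [seq l ++ l' | l <- ls, l' <- ls'] else [seq l' ++ l | l <- ls, l' <- ls']).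
  split.
    have key l l' : l \in ls -> l' \in ls' ->
        (l ++ l' != [::] /\ forall c, c \in l ++ l' -> S c) /\
        (l' ++ l != [::] /\ forall c, c \in l' ++ l -> S c).
      move=> /lsP[l0 h] /lsP'[l0' h']; split; split.
      + by case: (l) l0.
      + by move=> c; rewrite mem_cat => /orP[/h|/h'].
      + by case: (l') l0'.
      + by move=> c; rewrite mem_cat => /orP[/h'|/h].
    by case: (s) => _ /allpairsP[[l l'] /= [hl hl' ->]]; have [] := key l l' hl hl'.
  rewrite mulr_suml; case: (s); rewrite big_allpairs_dep; apply: eq_bigr => l _;
    by rewrite mulr_sumr; apply: eq_bigr => l' _; rewrite prodl_cat.
Qed.

Section Freeness.

Context (K : fieldType) (B A : algType K) (Sp : bb_space B A).
Context (D : set B) (F : B -> B) (FD : cond_exp D F).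
Context (I J : Type) (ZI : I -> A) (ZJ : J -> A).
Context (X : bool -> bool -> set A).
Context (invariant : F_invariant Sp F ZI ZJ).
Local Notation letter := (letter A).
Local Notation over := (over Sp).
Local Notation isvar := (isvar ZI ZJ).
Local Notation isscal := (isscal Sp D).
Local Notation gen := (predU isvar isscal).
Local Notation cumD := (cumD Sp F).
Local Notation cumB := (cumB Sp).
Local Notation NB := (Nx Sp id).
Local Notation ND := (Nx Sp F).
Implicit Types (x y : letter) (acc w u v : seq (B * letter)) (m : nat).

Context (X_expand : forall x, X (col x) (sd x) (el x) -> exists ls,
  sum_of_products x ls /\ forall l, l \in ls -> forall a, a \in l ->
    gen (setel x a) /\ X (col x) (sd x) a).
Context (X_valid : forall c, (X c true `<=` left_alg Sp setT)%classic /\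
  (X c false `<=` right_alg Sp setT)%classic).

Local Notation smom m := (mom (scalar_kernel Sp D ZI ZJ (cumB m) m)).

Lemma NB_gen m w : over gen m (unzip2 w) -> NB m w = smom m w.
Proof.
move=> ow; apply: (scalar_momE ow) => w' ow' _.
apply: (mom_uniq (@submonoidT B) (over_sub isvar m) (Nx_is_mom _ _ _ _) (mom_is_mom _ _) _ _ ow' (coefs_inT _)) => //.
by move=> x e oe _; rewrite /scalar_kernel asboolT.
Qed.

Definition centred m rs := F (cens (fun r => F (NB m r)) rs (NB m) [::]) = 0.

Lemma centred_gen m c rs : rs != [::] -> alt col c rs [::] ->
  over gen m (unzip2 (flatten rs)) -> coefs_in D (flatten rs) -> centred m rs.
Proof.
move=> rn ha ors Drs; rewrite /centred.
rewrite (cens_ctr (ctr' := fun r => F (smom m r))); last first.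
  by move=> r rrs; rewrite NB_gen //; apply: over_sub ors; apply: unzip2_run.
have Dn : coefs_in D ([::] : seq (B * letter)) by [].
have ctrD r : D (F (smom m r)) by apply: (ce_in FD).
rewrite (cens_ext (ce_submonoid FD) ctrD Drs Dn (f' := smom m)); last first.
  by move=> h Dh; rewrite cats0 => hs; apply: NB_gen; apply: over_sub ors.
apply: (scalar_mom_centered FD _ _ _ rn ha Drs).
- exact: cumB_add.
- by move=> x acc ox; rewrite invariant //; apply: (ce_in FD).
- move=> x u b y v ox Fb; rewrite invariant // /mapc map_cat /= Fb kadd0 ?(ceF0 FD) //.
  exact: cumB_add.
Qed.

Lemma alt_expand c rs1 r1 b x l r2 rs2 v : l != [::] ->
  alt col c (rs1 ++ (r1 ++ (b, x) :: r2) :: rs2) v ->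
  alt col c (rs1 ++ (r1 ++ expand b x l ++ r2) :: rs2) v.
Proof.
move=> l0; elim: rs1 c => [|r rs1 IH] c /= /and3P[h1 h2 h3]; last first.
  by apply/and3P; split=> //; apply: IH.
apply/and3P; split=> //; first by case: (r1) (l) l0 => // -[].
move: h2; rewrite !mono_cat /= => /and3P[-> cx ->]; rewrite andbT /=.
case: l l0 => // a l _; rewrite /expand /mono /= /col /= -/(col x) cx /=.
by rewrite all_map; apply/allP.
Qed.

Lemma expand_letters (b : B) x l : unzip2 (expand b x l) = [seq setel x a | a <- l].
Proof. by case: l => // a l; rewrite /= /unzip2 -map_comp. Qed.

(* By induction on the number of letters that are neither variables nor scalars:
   such a letter is a sum of products of generators, and is replaced by letters
   sitting at the same time and side. *)
Lemma centred_face m c rs : rs != [::] -> alt col c rs [::] ->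
  over (in_face X) m (unzip2 (flatten rs)) -> coefs_in D (flatten rs) -> centred m rs.
Proof.
have [n] := ubnP (count (predC gen) (unzip2 (flatten rs))).
elim: n rs c => // n IH rs c lt rn ha ors Drs.
case: (boolP (all gen (unzip2 (flatten rs)))) => [ga|].
  by apply: (@centred_gen m c) => //; split=> //; case: ors.
move/allPn => [_ /mapP[[b x] /flattenP[r rrs xr] ->] /= nx].
case/splitPr: rrs rn ha ors Drs lt => rs1 rs2; case/splitPr: xr => r1 r2 rn ha ors Drs lt.
have fE t : flatten (rs1 ++ (r1 ++ t ++ r2) :: rs2) = (flatten rs1 ++ r1) ++ t ++ (r2 ++ flatten rs2).
  by rewrite flatten_cat /= !catA.
rewrite (fE [:: (b, x)]) /= in ors Drs lt.
have [ox fx] := ors; rewrite unzip2_cat /= in ox fx lt.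
have /X_expand[ls [sx lsP]] : X (col x) (sd x) (el x).
  by have := allP fx x; rewrite mem_cat inE eqxx orbT => /(_ isT) /asboolP.
have cx : expandable (fun r => F (NB m r)).
  move=> u b' y l' v sy; rewrite (@Nx_expandable _ _ _ Sp m u b' y l' v sy) (sub_morph_sum (f := F)) //.
  exact: (ce_sub FD).
have NA : fadd (NB m) := Nx_add Sp (cond_exp_id B) m.
rewrite /centred (@cens_run_expand _ _ _ _ _ _ _ _ _ _ _ _ _ NA (@Nx_expandable _ _ _ Sp m) cx sx).
rewrite (sub_morph_sum (f := F)); last exact: (ce_sub FD).
apply: big1_seq => l /andP[_ lls]; have l0 := allP (proj1 sx) l lls.
apply: (IH _ c); last 1 first.
- move: Drs; rewrite fE => /coefs_in_cat[D1 [Db D2]].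
  apply/coefs_in_cat; split=> //; apply/coefs_in_cat; split=> //.
  case: (l) => // a l' /=; split=> //; elim: l' => //= a' l' IHl; split=> //.
  exact: (ce1 FD).
- rewrite fE !unzip2_cat !count_cat expand_letters; move: lt; rewrite !unzip2_cat !count_cat /= nx count_cat.
  suff -> : count (predC gen) [seq setel x a | a <- l] = 0%N by lia.
  apply/eqP; rewrite -leqn0 leqNgt -has_count; apply/hasPn => _ /mapP[a al ->] /=.
  by rewrite negbK; case: (lsP l lls a al).
- by case: (rs1).
- exact: alt_expand.
rewrite fE !unzip2_cat expand_letters; split.
  move: ox; rewrite !unzip2_cat => ox.
  apply: (ok_replace (t := [seq setel x a | a <- l]) ox) => _ /mapP[a al ->]; split=> //.
  have [_ Xa] := lsP l lls a al; split.
    by apply: (proj1 (proj2 ox x _)); rewrite mem_cat inE eqxx orbT.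
  have [h1 h2] := X_valid (col x); move: Xa; rewrite /sd /el /= -/(sd x).
  by case: (sd x) => [/h1|/h2].
move: fx; rewrite !unzip2_cat !all_cat /= all_cat => /and3P[-> _ /andP[-> ->]]; rewrite !andbT /=.
apply/allP => _ /mapP[a al ->]; apply/asboolP.
by case: (lsP l lls a al).
Qed.

Theorem invariant_mixed : mixed_vanish Sp D F X.
Proof.
have E m w : over (in_face X) m (unzip2 w) -> coefs_in D w ->
    F (NB m w) = mom (mono_kernel Sp F (in_face X) m) w.
  move=> ow Dw; apply: (centered_free FD (f := fun w => F (NB m w)) (ctr := fun r => F (NB m r))) => //.
  - exact: (ce_id FD (ce1 FD)).
  - by move=> r; apply: (ce_in FD).
  - by move=> c r or _ Dr; rewrite (NxD_NxB FD) //; case: or.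
  move=> c rs rn ha ors Drs.
  rewrite (cens_expect FD (fun r => ce_in FD (NB m r)) Drs (f := NB m) (v := [::]) Logic.I) //.
  exact: (centred_face rn ha).
move=> m x acc ox Dacc um.
transitivity (mono_kernel Sp F (in_face X) m x acc); last by rewrite /mono_kernel (negPf um) andbF.
apply: (cum_uniq (ce_submonoid FD) (over_sub (in_face X) m) (Nx_is_mom _ _ _ _) (mom_is_mom _ _) _ ox Dacc).
move=> w ow Dw; rewrite (NxD_NxB FD) //; last by case: ow.
by rewrite -E //; split=> //; apply: (ce_in FD).
Qed.

End Freeness.

(* The two pairs of faces in the statement *)
From mathcomp Require Import complex reals.
Local Open Scope classical_set_scope.
Local Open Scope ring_scope.

Lemma cond_expectation_ce (K : pzRingType) (B : algType K) (D : set B) (F : {linear B -> B}) :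
  subalgebra D -> cond_expectation D F -> cond_exp D F.
Proof.
move=> /subalgebraP[D1 Dl DM] [DF Fid Fb]; split=> //.
- by move=> b b' Db Db'; have := Dl (-1) b' b Db' Db; rewrite scaleN1r addrC.
- by move=> b b'; rewrite raddfB.
- by move=> b d Dd; have := Fb d b 1 Dd D1; rewrite !mulr1.
- by move=> b d Dd; have := Fb 1 b d D1 Dd; rewrite !mul1r.
Qed.

Section Pairs.

Context (K : fieldType) (B A : algType K) (Sp : bb_space B A) (D : set B).
Context (I J : Type) (ZI : I -> A) (ZJ : J -> A).
Context (ZIl : forall i, left_alg Sp setT (ZI i)) (ZJr : forall j, right_alg Sp setT (ZJ j)).
Context (Dalg : subalgebra D).

Definition faces (k s : bool) : set A :=
  match k, s with
  | true, true => gen_alg (Lb Sp @` D `|` range ZI)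
  | true, false => gen_alg (Rb Sp @` D `|` range ZJ)
  | false, true => range (Lb Sp)
  | false, false => range (Rb Sp)
  end.

Lemma left_alg_subalgebra (C : set B) : subalgebra (left_alg Sp C).
Proof.
apply/subalgebraP; split=> [d _|k a b ha hb d Cd|a b ha hb d Cd]; first by rewrite mul1r mulr1.
  by rewrite mulrDl mulrDr -scalerAl -scalerAr ha // hb.
by rewrite -mulrA hb // mulrA ha // mulrA.
Qed.

Lemma right_alg_subalgebra (C : set B) : subalgebra (right_alg Sp C).
Proof.
apply/subalgebraP; split=> [d _|k a b ha hb d Cd|a b ha hb d Cd]; first by rewrite mul1r mulr1.
  by rewrite mulrDl mulrDr -scalerAl -scalerAr ha // hb.
by rewrite -mulrA hb // mulrA ha // mulrA.
Qed.

Lemma sub_gen_alg (S : set A) : S `<=` gen_alg S.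
Proof. exact: sub_smallest. Qed.

Lemma faces_valid k : faces k true `<=` left_alg Sp setT /\ faces k false `<=` right_alg Sp setT.
Proof.
case: k => /=; split; try (by move=> _ [b _ <-] d _; rewrite LbRbC).
- apply: smallest_sub; first exact: left_alg_subalgebra.
  by move=> _ [[b _ <-] d _|[i _ <-]]; [rewrite LbRbC|apply: ZIl].
- apply: smallest_sub; first exact: right_alg_subalgebra.
  by move=> _ [[b _ <-] d _|[i _ <-]]; [rewrite LbRbC|apply: ZJr].
Qed.

Lemma faces_pair k : pair_of_faces Sp D (faces k).
Proof.
have [vl vr] := faces_valid k.
split.
- case: k {vl vr}; first exact: gen_alg_subalgebra.
  apply/subalgebraP; split; first by exists 1; rewrite ?rmorph1.
    by move=> c _ _ [b _ <-] [b' _ <-]; exists (c *: b + b'); rewrite ?linearP.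
  by move=> _ _ [b _ <-] [b' _ <-]; exists (b * b'); rewrite ?rmorphM.
- case: k {vl vr}; first exact: gen_alg_subalgebra.
  apply/subalgebraP; split; first by exists 1; rewrite ?Rb1.
    by move=> c _ _ [b _ <-] [b' _ <-]; exists (c *: b + b'); rewrite ?linearP.
  by move=> _ _ [b _ <-] [b' _ <-]; exists (b' * b); rewrite ?RbM.
- split; last by move=> a /vl h d _; apply: h.
  by case: k {vl vr} => _ [d Dd <-]; [apply: sub_gen_alg; left; exists d|exists d].
- split; last by move=> a /vr h d _; apply: h.
  by case: k {vl vr} => _ [d Dd <-]; [apply: sub_gen_alg; left; exists d|exists d].
Qed.

Let generators s : set A := if s then Lb Sp @` D `|` range ZI else Rb Sp @` D `|` range ZJ.

Let generators_scal s d : D d -> generators s (scal Sp s d).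
Proof. by case: s => Dd; left; exists d. Qed.

Let generatorsP (x : letter A) a : col x -> generators (sd x) a ->
  predU (isvar ZI ZJ) (isscal Sp D) (setel x a).
Proof.
move=> cx ga; apply/orP.
have : (exists2 d, D d & scal Sp (sd x) d = a) \/
    exists v : I + J, side v = sd x /\ a = var ZI ZJ v.
  case: (sd x) ga => -[[d Dd <-]|[i _ <-]]; [by left; exists d| |by left; exists d|].
    by right; exists (inl i).
  by right; exists (inr i).
case=> [[d Dd <-]|[v [sv ->]]]; [right|left]; first by apply/asboolP; exists d.
by apply/andP; split=> //; apply/asboolP; exists v.
Qed.

(** Multiples of 1 are scalars of [D], so the faces of the first pair consist of sums of products of
    generators; an element of the second pair is a scalar, hence its own expansion. *)
Lemma faces_expand (x : letter A) : faces (col x) (sd x) (el x) -> exists ls,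
  sum_of_products x ls /\ forall l, l \in ls -> forall a, a \in l ->
    predU (isvar ZI ZJ) (isscal Sp D) (setel x a) /\ faces (col x) (sd x) a.
Proof.
have [D1 Dl _] := (subalgebraP D).1 Dalg.
case cx : (col x) => fx.
  have gx : gen_alg (generators (sd x)) (el x) by move: fx; rewrite /generators /=; case: (sd x).
  have Sk k : generators (sd x) (k%:A).
    have -> : k%:A = scal Sp (sd x) (k *: 1).
      by rewrite /scal; case: (sd x); rewrite linearZ /= ?rmorph1 ?Rb1.
    apply: generators_scal.
    have D0 : D 0 by have := Dl (-1) 1 1 D1 D1; rewrite scaleN1r addNr.
    by have := Dl k 1 0 D1 D0; rewrite addr0.
  have [ls [lsP e]] := gen_alg_products (sd x) Sk gx.
  exists ls; split; first by split=> //; apply/allP => l /lsP[].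
  move=> l /lsP[_ lS] a /lS ga; split; first exact: generatorsP.
  by rewrite /generators in ga; case: (sd x) ga => ga /=; apply: sub_gen_alg.
exists [:: [:: el x]]; split.
  by split=> //; rewrite big_seq1 /prodl; case: (sd x); rewrite big_seq1.
move=> l; rewrite inE => /eqP-> a; rewrite inE => /eqP->; split=> //.
apply/orP; right; have [b eb] : exists b, el x = scal Sp (sd x) b.
  by case: (sd x) fx => /= -[b _ <-]; exists b.
by apply/asboolP; exists b; split; [exact: eb|rewrite /col /= -/(col x) cx].
Qed.

End Pairs.

Theorem theorem3p2 (R : realType) (B A : algType R[i]) (Sp : bb_space B A)
    (D : set B) (F : {linear B -> B})
    (I J : Type) (ZI : I -> A) (ZJ : J -> A) :
  subalgebra D ->
  cond_expectation D F ->
  (forall i, left_alg Sp setT (ZI i)) ->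
  (forall j, right_alg Sp setT (ZJ j)) ->
  (forall b1 : B, (forall b2 : B, F (b2 * b1) = 0) -> b1 = 0) ->
  (bifree Sp D (F \o expect Sp)
     (fun (k : bool) (s : bool) =>
        match k, s with
        | true, true => gen_alg (Lb Sp @` D `|` range ZI)
        | true, false => gen_alg (Rb Sp @` D `|` range ZJ)
        | false, true => range (Lb Sp)
        | false, false => range (Rb Sp)
        end)
   <->
   (forall (n : nat) (omega : 'I_n.+1 -> I + J) (b : n.-tuple B),
      kappa Sp ZI ZJ omega (expect Sp) b
      = F (kappa Sp ZI ZJ omega (expect Sp) (map_tuple F b))))
  /\
  ((forall (n : nat) (omega : 'I_n.+1 -> I + J) (b : n.-tuple B),
      kappa Sp ZI ZJ omega (expect Sp) b
      = F (kappa Sp ZI ZJ omega (expect Sp) (map_tuple F b)))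
   <->
   (forall (n : nat) (omega : 'I_n.+1 -> I + J) (b : n.-tuple B),
      kappa Sp ZI ZJ omega (expect Sp) b
      = kappa Sp ZI ZJ omega (F \o expect Sp) (map_tuple F b))).
Proof.
move=> Dalg FE ZIl ZJr faithful; have FD := cond_expectation_ce Dalg FE.
have e1 := kappa_invariantE FD ZIl ZJr; have e2 := kappa_reducedE FD ZIl ZJr.
have e3 := invariant_reduced Sp FD ZI ZJ.
split; last by split=> [/e1/e3/e2|/e2/e3/e1].
split=> [/bifree_mixed mv|/e1 inv].
  apply/e1/e3; apply: (mixed_reduced FD _ _ _ (mv FD) faithful).
  - by move=> i; apply: sub_gen_alg; right; exists i.
  - by move=> j; apply: sub_gen_alg; right; exists j.
  - by case=> b; exists b.
apply: (mixed_bifree FD).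
- exact: faces_pair.
- exact: faces_valid.
- apply: (invariant_mixed FD inv); first exact: faces_expand.
  exact: faces_valid.
Qed.
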